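(* Let $\Lambda_n \subseteq \mathbb{C}^{n\times n}$ be the affine variety of $n\times n$ skew-symmetric matrices. For integers $n \geq 2$ and $r\geq 1$, the dimension of $\mu_r(\Lambda_n)$ is as follows: \begin{itemize} \item if $n = 2$ and $r \geq 1$: $\dim \mu_r(\Lambda_2) = 1$; \item if $n \geq 3$ and $r=1$: $\dim \mu_1(\Lambda_n) = n(n-1)/2$; \item if $n \geq 3$ and $r = 2$: $\dim \mu_2(\Lambda_n) = n^2 - \lfloor 3n/2 \rfloor$; \item if $n = 3$: $\dim \mu_3(\Lambda_3) = 7$, and $\dim \mu_r(\Lambda_3) = 8$ for all $r \geq 4$; \item if $n = 4$: $\dim \mu_3(\Lambda_4) = 13$, $\dim \mu_4(\Lambda_4) = 15$, and $\dim \mu_r(\Lambda_4) = 16$ for all $r \geq 5$; \item if $n = 6$: $\dim \mu_3(\Lambda_6) = 35$, and $\dim \mu_r(\Lambda_6) = 36$ for all $r \geq 4$; \item if $n \geq 5$ is odd and $r \geq 3$: $\dim \mu_r(\Lambda_n) = n^2-1$; \item if $n \geq 8$ is even and $r \geq 3$: $\dim \mu_r(\Lambda_n) = n^2$. \end{itemize}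
   Context: For an affine variety $X \subseteq \mathbb{C}^{n\times n}$ and an integer $r \geq 1$, let $\mu_r^0(X) = \{M_1\cdots M_r : M_1,\dots,M_r \in X\}$ and let $\mu_r(X)$ be the Zariski closure of $\mu_r^0(X)$ in $\mathbb{C}^{n\times n}$. A matrix $M$ is skew-symmetric if $M^T=-M$. Dimension is the (Krull) dimension of an affine variety over $\mathbb{C}$. *)

(* Defs.v *)
From HB Require Import structures.
From mathcomp Require Import all_boot all_order all_algebra.
From mathcomp Require Import boolp classical_sets reals.
From mathcomp Require Import complex mpoly.

Set Implicit Arguments.
Unset Strict Implicit.
Unset Printing Implicit Defensive.

Import GRing.Theory.
Local Open Scope ring_scope.
Local Open Scope classical_set_scope.

Section Zariski.
Context {F : fieldType} {n : nat}.
Implicit Types (S : set {mpoly F[n * n]}) (A B X : set 'M[F]_n).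

(* Affine space F^(n x n) is coordinatized by [mxvec]: the variable of index
   [mxvec_index i j] is the (i, j) entry. *)
Definition zero_locus S : set 'M[F]_n :=
  [set M | forall p, S p -> p.@[fun k => mxvec M 0 k] = 0].

Definition zariski_closed X : Prop := exists S, X = zero_locus S.

Definition zariski_closure A : set 'M[F]_n :=
  \bigcap_(Z in [set Z | zariski_closed Z /\ A `<=` Z]) Z.

Definition irreducible_closed X : Prop :=
  [/\ zariski_closed X, X !=set0 &
      forall A B, zariski_closed A -> zariski_closed B ->
        X `<=` A `|` B -> X `<=` A \/ X `<=` B].

(* Strict chain Z 0 < Z 1 < ... < Z d; the values Z i for i > d are junk. *)
Definition irreducible_chain X (d : nat) (Z : nat -> set 'M[F]_n) : Prop :=
  (forall i, (i <= d)%N -> irreducible_closed (Z i) /\ Z i `<=` X) /\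
  (forall i, (i < d)%N -> Z i `<` Z i.+1).

(* Krull dimension of a Zariski-closed X, as a relation: it holds for at most
   one d, and for no d when X is empty. *)
Definition krull_dim X (d : nat) : Prop :=
  (exists Z, irreducible_chain X d Z) /\
  (forall e Z, irreducible_chain X e Z -> (e <= d)%N).

Definition mu0 (r : nat) X : set 'M[F]_n :=
  [set P | exists M : 'I_r -> 'M[F]_n,
     (forall i, X (M i)) /\ P = \prod_(i < r) M i].

Definition mu (r : nat) X : set 'M[F]_n := zariski_closure (mu0 r X).

End Zariski.

Definition skew_mx (F : fieldType) (n : nat) : set 'M[F]_n :=
  [set M | M^T = - M].

Arguments skew_mx : clear implicits.

(* Main.v *)
(** The variety is the closure of the image of the polynomial map prodmap, (X_i) |-> prod A_i
    with A_i = X_i - X_i^T, so its dimension is the generic rank of the Jacobian matrix: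
    - a chain Z_0 < ... < Z_e of irreducible closed sets yields e functions that are
      algebraically independent on the image, and in characteristic 0 these have independent
      differentials at a generic parameter;
    - conversely, d independent tangent vectors at one parameter yield a chain of length d,
      namely the closures of the images of an increasing flag of affine subspaces.
    The rank is n^2 minus the dimension of the annihilator of the tangent space for the trace
    form. If n is even and the A_i are invertible, multiplication by prod A_i identifies this
    annihilator with the Lie algebra of the stabilizer in GL_n of (A_i), seen alternately as
    bivectors and 2-forms. Once A_0 = J and A_2 = [[0, D], [-D, 0]], a stabilizing matrix is a
    family of t_i in sl_2, intertwined by the 2 x 2 blocks of the remaining A_i: these leave a
    3-dimensional space for n = 4, a line (the traceless part of the holonomy around the
    triangle) for n = 6 and nothing for n >= 8, and each further factor adds constraints.
    If n is odd, the determinant vanishes identically, and the annihilator is computed at an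
    explicit point. For r = 2 the fibre through (A, B) contains (A p(B A), p(B A)^-1 B) for
    every polynomial p. *)

From HB Require Import structures.
Require Import Defs.
From mathcomp Require Import all_boot all_order all_algebra.
From mathcomp Require Import boolp classical_sets reals complex mpoly ring zify.

Set Implicit Arguments.
Unset Strict Implicit.
Unset Printing Implicit Defensive.

Import GRing.Theory Num.Theory.
Local Open Scope ring_scope.

Local Notation widen := (widen_ord (leqnSn _)).

(** * Polynomial functions and algebraic dependence *)

Section PolynomialFunctions.
Variable F : numFieldType.

(** The two bounds ask for different things. A lower bound needs the rank at a single well chosen
    point. An upper bound needs the rank on a Zariski dense set of parameters. It comes from the
    ambient dimension, from the equation [\det] = 0 in odd size, from explicit kernel directions of
    the differential (rescaling the factors by scalars of product 1, or moving along the fibre when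
    r = 2), and for n = 4 and n = 6 from explicit stabilizing matrices.

    These last cases are the delicate ones, because the stabilizer is visible only when the first
    and third factors are in normal form. Instead of reducing an arbitrary pair of skew matrices,
    the proof shows that the parameters congruent to a normal form are dense. This is again the
    Jacobian criterion, applied to the map [gauge] at the identity change of basis.

    Writing a factor as X - X^T makes the parameters free variables; the price is a factor 2,
    compensated by 1/2 at each explicit point. *)

Lemma mpoly_rmorph_ext k (S : comNzRingType) (f g : {rmorphism {mpoly F[k]} -> S}) :
  (forall c, f c%:MP = g c%:MP) -> (forall i, f 'X_i = g 'X_i) -> f =1 g.
Proof.
move=> fgC fgX p; rewrite (mpolyE p) !raddf_sum; apply: eq_bigr => m _ /=.
rewrite -mul_mpolyC !rmorphM fgC; congr (_ * _).
rewrite mpolyXE_id !rmorph_prod; apply: eq_bigr => i _.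
by rewrite !rmorphXn /= fgX.
Qed.

Lemma meval_mwiden k (p : {mpoly F[k]}) (y : 'I_k.+1 -> F) :
  (mwiden p).@[y] = p.@[fun i => y (widen i)].
Proof.
pose f : {rmorphism _ -> F} := (meval y \o @mwiden k F)%FUN.
pose g : {rmorphism _ -> F} := meval (fun i : 'I_k => y (widen i)).
apply: (@mpoly_rmorph_ext k F f g) => [c|i] /=; first by rewrite mwidenC !mevalC.
by rewrite mwidenX mnmwiden1 !mevalXU.
Qed.

Lemma mpoly_split_last k (p : {mpoly F[k.+1]}) :
  exists q p', p = mwiden q + 'X_ord_max * p'.
Proof.
rewrite (mpolyE p); elim/big_rec: _ => [|m s _ [q [p' ->]]].
  by exists 0, 0; rewrite mwiden0 mulr0 addr0.
have [m0|m0] := posnP (m ord_max).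
  pose m' := [multinom (m (widen i)) | i < k].
  exists (p@_m *: 'X_[m'] + q), p'; rewrite mwidenD mwidenZ mwidenX addrA.
  suff -> : mnmwiden m' = m by [].
  apply/mnmP => i; case: (unliftP ord_max i) => [j|] ->; last by rewrite mnmwiden_ordmax.
  have -> : lift ord_max j = widen j by apply/val_inj; rewrite /= /bump leqNgt ltn_ord.
  by rewrite mnmwiden_widen mnmE.
exists q, (p@_m *: 'X_[m - U_(ord_max)] + p').
rewrite mulrDr -scalerAr addrCA -mpolyXD addmC submK //.
by rewrite lep1mP -lt0n.
Qed.

Lemma mwiden_of_msupp k (p : {mpoly F[k.+1]}) :
  (forall m, m \in msupp p -> m ord_max = 0%N) -> exists q, p = mwiden q.
Proof.
move=> p0; exists (\sum_(m <- msupp p) p@_m *: 'X_[[multinom (m (widen i)) | i < k]]).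
rewrite raddf_sum {1}(mpolyE p) /= big_seq [RHS]big_seq; apply: eq_bigr => m /p0 m0.
rewrite mwidenZ mwidenX; congr (_ *: 'X_[_]).
apply/mnmP => i; case: (unliftP ord_max i) => [j|] ->; last by rewrite mnmwiden_ordmax.
have -> : lift ord_max j = widen j by apply/val_inj; rewrite /= /bump leqNgt ltn_ord.
by rewrite mnmwiden_widen mnmE.
Qed.

Lemma poly_infinite_eq0 (q : {poly F}) : (forall s, q.[s] = 0) -> q = 0.
Proof.
move=> q0; apply/eqP/negPn/negP => nzq.
have := @max_poly_roots F q [seq i%:R | i <- iota 0 (size q)] nzq.
rewrite size_map size_iota ltnn => H; suff: false by []; apply: H.
  by apply/allP => x _; rewrite rootE q0.
by rewrite map_inj_uniq ?iota_uniq // => a b /eqP; rewrite eqr_nat => /eqP.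
Qed.

Lemma horner_mmap k (p : {mpoly F[k]}) (h : 'I_k -> {poly F}) s :
  (mmap polyC h p).[s] = p.@[fun i => (h i).[s]].
Proof.
pose f : {rmorphism {mpoly F[k]} -> F} := (horner_eval s \o mmap polyC h)%FUN.
pose g : {rmorphism {mpoly F[k]} -> F} := meval (fun i : 'I_k => (h i).[s]).
apply: (@mpoly_rmorph_ext k F f g) => [c|i]; rewrite /f /g /= /horner_eval.
  by rewrite mmapC mevalC hornerC.
by rewrite mmapX mmap1U mevalXU.
Qed.

Lemma mpoly_infinite_eq0 k (p : {mpoly F[k]}) : (forall x, p.@[x] = 0) -> p = 0.
Proof.
elim: k p => [|k IH] p p0.
  by have := p0 (fun=> 0); rewrite -(mpolyKC p) mevalC => ->; rewrite mpolyC0.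
have [n] := ubnP (msize p); elim: n p p0 => // n IHn p p0 le_pn.
have [q [p' pE]] := mpoly_split_last p.
have q0 : q = 0.
  apply: IH => x; pose y (i : 'I_k.+1) := oapp x 0 (unlift ord_max i).
  have := p0 y; rewrite pE mevalD mevalM mevalXU {2}/y unlift_none mul0r addr0.
  rewrite meval_mwiden => <-; apply: meval_eq => i; rewrite /y.
  have -> : widen i = lift ord_max i by apply/val_inj; rewrite /= /bump leqNgt ltn_ord.
  by rewrite liftK.
move: pE; rewrite q0 mwiden0 add0r => pE.
have [p'0|nzp'] := eqVneq p' 0; first by rewrite pE p'0 mulr0.
suff p'0 : p' = 0 by rewrite p'0 eqxx in nzp'.
apply: IHn => [x|]; last first.
  by move: le_pn; rewrite pE msizeM ?msizeX ?mdeg1 // -msize_poly_eq0 msizeX.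
(* Cancelling the variable pointwise says nothing where it vanishes. On the line through x parallel
   to the last axis, p' becomes a univariate polynomial whose product with 'X vanishes identically,
   and there 'X can be cancelled. *)
pose h i := if i == ord_max then 'X else (x i)%:P : {poly F}.
have u0 : 'X * mmap polyC h p' = 0.
  apply: poly_infinite_eq0 => s.
  rewrite hornerM hornerX horner_mmap -(p0 (fun i => (h i).[s])) pE mevalM mevalXU.
  by rewrite /h eqxx hornerX.
have u00 : mmap polyC h p' = 0.
  by apply/eqP; move/eqP: u0; rewrite mulf_eq0 polyX_eq0.
have := horner_mmap p' h (x ord_max); rewrite u00 horner0 => e; rewrite [RHS]e.
apply: meval_eq => i; rewrite /h; case: eqP => [->|_]; by rewrite ?hornerX ?hornerC.
Qed.
End PolynomialFunctions.

Section AlgebraicDependence.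
Variable F : numFieldType.

Lemma mpoly_ring_ind k (P : {mpoly F[k]} -> Prop) :
  (forall c, P c%:MP) -> (forall i, P 'X_i) ->
  (forall p q, P p -> P q -> P (p + q)) ->
  (forall p q, P p -> P q -> P (p * q)) -> forall p, P p.
Proof.
move=> PC PX PD PM p; rewrite (mpolyE p); elim/big_rec: _ => [|m q _ Pq].
  by rewrite -(mpolyC0 k F); apply: (PC).
apply: (PD) => //; rewrite -mul_mpolyC; apply: (PM) => //.
rewrite mpolyXE_id; elim/big_rec: _ => [|i r _ Pr].
  by rewrite -(mpolyC1 k F); apply: (PC).
apply: (PM) => //; elim: (m i) => [|e IH]; first by rewrite expr0 -(mpolyC1 k F); apply: (PC).
by rewrite exprS; apply: (PM).
Qed.

Definition compm t k (g : 'I_t -> {mpoly F[k]}) (p : {mpoly F[t]}) : {mpoly F[k]} :=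
  mmap (@mpolyC k F) g p.

HB.instance Definition _ t k (g : 'I_t -> {mpoly F[k]}) :=
  GRing.RMorphism.copy (compm g) (mmap (@mpolyC k F) g).

Lemma compmC t k (g : 'I_t -> {mpoly F[k]}) c : compm g c%:MP = c%:MP.
Proof. by rewrite /compm mmapC. Qed.

Lemma compmX t k (g : 'I_t -> {mpoly F[k]}) i : compm g 'X_i = g i.
Proof. by rewrite /compm mmapX mmap1U. Qed.

Lemma meval_compm t k (g : 'I_t -> {mpoly F[k]}) p x :
  (compm g p).@[x] = p.@[fun i => (g i).@[x]].
Proof.
pose f1 : {rmorphism {mpoly F[t]} -> F} := (meval x \o compm g)%FUN.
pose f2 : {rmorphism {mpoly F[t]} -> F} := meval (fun i : 'I_t => (g i).@[x]).
apply: (@mpoly_rmorph_ext F t F f1 f2) => [c|i]; rewrite /f1 /f2 /=.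
  by rewrite compmC !mevalC.
by rewrite compmX mevalXU.
Qed.

Lemma mderiv_compm t k (g : 'I_t -> {mpoly F[k]}) p j :
  (compm g p)^`M(j) = \sum_i compm g (p^`M(i)) * (g i)^`M(j).
Proof.
elim/mpoly_ring_ind: p => [c|l|p q IHp IHq|p q IHp IHq].
- rewrite compmC mderivC big1 // => i _.
  by rewrite mderivC raddf0 mul0r.
- rewrite compmX (bigD1 l) //= mderivX mnm1E eqxx scale1r -[X in 'X_[X - _]]add0m addmK.
  rewrite mpolyX0 rmorph1 mul1r big1 ?addr0 // => i /negPf il.
  by rewrite mderivX mnm1E eq_sym il scale0r raddf0 mul0r.
- rewrite raddfD /= mderivD IHp IHq -big_split; apply: eq_bigr => i _ /=.
  by rewrite mderivD raddfD mulrDl.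
- rewrite rmorphM /= mderivM IHp IHq mulr_suml mulr_sumr -big_split.
  by apply: eq_bigr => i _ /=; rewrite mderivM raddfD /= !rmorphM /=; ring.
Qed.

Lemma msize_prod_exp_le t k (g : 'I_t -> {mpoly F[k]}) d e (m : 'I_t -> nat) :
  (forall i, (msize (g i) <= d.+1)%N) -> (forall i, (m i <= e)%N) ->
  (msize (\prod_i g i ^+ m i) <= (t * (e * d)).+1)%N.
Proof.
move=> gd me.
have mulP (p q : {mpoly F[k]}) a b :
    (msize p <= a.+1 -> msize q <= b.+1 -> msize (p * q) <= (a + b).+1)%N.
  move=> pa qb; have [->|p0] := eqVneq p 0; first by rewrite mul0r msize0.
  have [->|q0] := eqVneq q 0; first by rewrite mulr0 msize0.
  rewrite msizeM //; apply: (@leq_trans (a.+1 + b.+1).-1); last by rewrite addnS addSn.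
  by rewrite -!subn1 leq_sub2r ?leq_add.
have expP i c : (msize (g i ^+ c) <= (c * d).+1)%N.
  elim: c => [|c IH]; first by rewrite expr0 msize1.
  by rewrite exprS mulSn; apply: mulP.
suff H n (nt : (n <= t)%N) : (msize (\prod_(i < t | (i < n)%N) g i ^+ m i) <= (n * (e * d)).+1)%N.
  rewrite (eq_bigl (fun i : 'I_t => (i < t)%N)); first exact: H.
  by move=> i; rewrite ltn_ord.

elim: n nt => [|n IH] nt; first by rewrite big_pred0 // msize1.
rewrite (bigD1 (Ordinal nt)) //= mulSn; apply: mulP.
  by apply: leq_trans (expP _ _) _; rewrite ltnS leq_mul2r me orbT.
rewrite (eq_bigl (fun i : 'I_t => (i < n)%N)); first by apply: IH; apply: ltnW.
by move=> i; rewrite -val_eqE /= ltnS andbC ltn_neqAle.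
Qed.

Lemma row_kernel m n (A : 'M[F]_(m, n)) : (n < m)%N ->
  exists2 v : 'rV[F]_m, v != 0 & v *m A = 0.
Proof.
move=> nm; have : kermx A != 0.
  rewrite -mxrank_eq0 mxrank_ker subn_eq0 -ltnNge.
  exact: leq_ltn_trans (rank_leq_col A) nm.
case/rowV0Pn => v /sub_kermxP vA v0; by exists v.
Qed.

(* Polynomials of degree < e in each of the t variables form a space of dimension
   e^t, while their values at g have degree < (t d + 1) e in each of the k variables;
   e^t wins once e > (t d + 1)^k. *)
Lemma compm_dependent t k (g : 'I_t -> {mpoly F[k]}) : (k < t)%N ->
  exists2 p : {mpoly F[t]}, p != 0 & compm g p = 0.
Proof.
move=> kt; pose d := \max_i msize (g i).
have gd i : (msize (g i) <= d.+1)%N by apply: leqW; exact: leq_bigmax.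
pose e := ((t * d).+1 ^ k).+1; pose B := ((t * d).+1 * e)%N.
pose I := {ffun 'I_t -> 'I_e}; pose J := {ffun 'I_k -> 'I_B}.
pose mI (f : I) : 'X_{1..t} := [multinom (f i : nat) | i < t].
pose mJ (f : J) : 'X_{1..k} := [multinom (f i : nat) | i < k].
pose A : 'M[F]_(#|{: I}|, #|{: J}|) :=
  \matrix_(a, b) (\prod_i g i ^+ (mI (enum_val a) i))@_(mJ (enum_val b)).
have ltJI : (#|{: J}| < #|{: I}|)%N.
  rewrite !card_ffun !card_ord expnMn.
  apply: (@leq_trans (e ^ k.+1)); last by rewrite leq_pexp2l.
  by rewrite expnS ltn_mul2r expn_gt0 /= ltnS.
have [v v0 vA] := row_kernel A ltJI.
exists (\sum_a v 0 a *: 'X_[mI (enum_val a)]).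
  apply: contraNneq v0 => p0; apply/eqP/rowP => a; rewrite mxE.
  have := congr1 (mcoeff (mI (enum_val a))) p0; rewrite mcoeff0 raddf_sum /= => <-.
  rewrite (bigD1 a) //= mcoeffZ mcoeffX eqxx mulr1 big1 ?addr0 // => b ba.
  rewrite mcoeffZ mcoeffX; case: eqP => [/mnmP E|_]; last by rewrite mulr0.
  case/negP: ba; apply/eqP/enum_val_inj/ffunP => i; apply/val_inj.
  by have := E i; rewrite !mnmE.
rewrite raddf_sum /=; apply/mpolyP => m; rewrite mcoeff0 raddf_sum /=.
have compE a : compm g (v 0 a *: 'X_[mI (enum_val a)])
    = v 0 a *: \prod_i g i ^+ (mI (enum_val a) i).
  rewrite -!mul_mpolyC rmorphM /= compmC mpolyXE_id rmorph_prod /=; congr (_ * _).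
  by apply: eq_bigr => i _; rewrite rmorphXn /= compmX.
have [mB|mB] := boolP [forall j, (m j < B)%N].
  pose f : J := [ffun j => Ordinal (forallP mB j)].
  have -> : m = mJ (enum_val (enum_rank f)).
    by apply/mnmP => j; rewrite mnmE enum_rankK ffunE.
  have := congr1 (fun M : 'rV__ => M 0 (enum_rank f)) vA; rewrite !mxE => vA0; rewrite -[RHS]vA0.
  by apply: eq_bigr => a _; rewrite compE mcoeffZ !mxE.
rewrite big1 // => a _; rewrite compE mcoeffZ memN_msupp_eq0 ?mulr0 //.
apply/msize_mdeg_ge; apply: leq_trans (msize_prod_exp_le (e := e.-1) gd _) _.
  by move=> i; rewrite mnmE -ltnS (leq_trans (ltn_ord _)).
move: mB; rewrite negb_forall => /existsP[j]; rewrite -leqNgt => Bm.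
apply: (@leq_trans (m j)); last by rewrite mdegE (bigD1 j) //= leq_addr.
apply: leq_trans Bm; rewrite /B mulSn -add1n leq_add //.
by rewrite [(e.-1 * d)%N]mulnC mulnA leq_mul2l leq_pred orbT.
Qed.

End AlgebraicDependence.

(** * The Jacobian criterion *)

Section JacobianCriterion.
Variable F : numFieldType.

Definition algindep t k (g : 'I_t -> {mpoly F[k]}) :=
  forall p : {mpoly F[t]}, compm g p = 0 -> p = 0.

Definition Jac t k (g : 'I_t -> {mpoly F[k]}) (x : 'I_k -> F) : 'M[F]_(t, k) :=
  \matrix_(i, j) ((g i)^`M(j)).@[x].

Lemma msize_mderiv k (p : {mpoly F[k]}) i : p != 0 -> (msize (p^`M(i)) < msize p)%N.
Proof.
move=> p0; rewrite -(@prednK (msize p)) ?lt0n ?msize_poly_eq0 // ltnS msizeE.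
apply/bigmax_leqP_seq => m; rewrite mcoeff_msupp mcoeff_deriv => pm _.
have : (m + U_(i))%MM \in msupp p.
  by rewrite mcoeff_msupp; apply: contraNneq pm => ->; rewrite mul0rn.
by move/msize_mdeg_lt; rewrite mdegD mdeg1 addn1; case: (msize p).
Qed.

Lemma mderiv_eq0_const k (p : {mpoly F[k]}) :
  (forall i, p^`M(i) = 0) -> p = (p@_0)%:MP.
Proof.
move=> dp; apply/mpolyP => m; rewrite mcoeffC.
have [->|m0] := eqVneq m 0%MM; first by rewrite mulr1.
rewrite mulr0; have [i mi] : exists i, (0 < m i)%N.
  apply/existsP; apply: contraNT m0; rewrite negb_exists => /forallP H.
  by apply/eqP/mnmP => i; rewrite mnm0E; apply/eqP; have := H i; rewrite -eqn0Ngt.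
have := mcoeff_deriv i (m - U_(i))%MM p; rewrite dp mcoeff0 submK ?lep1mP -?lt0n //.
by move/esym/eqP; rewrite mulrn_eq0 /= => /eqP.
Qed.

(** The partial derivatives of a relation p, composed with g, form a row killed by the polynomial
    Jacobian J. A right inverse R of the Jacobian at x gives det (J R) the value 1 at x, so J can be
    cancelled: each partial derivative is again a relation, of smaller size, hence zero by
    induction. In characteristic 0, p is then constant. *)
Lemma jac_indep t k (g : 'I_t -> {mpoly F[k]}) x : row_free (Jac g x) -> algindep g.
Proof.
case/row_freeP => R JR p; have [n] := ubnP (msize p); elim: n p => // n IH p pn gp0.
pose r : 'rV_t := \row_i compm g (p^`M(i)).
pose J : 'M[{mpoly F[k]}]_(t, k) := \matrix_(i, j) (g i)^`M(j).
pose N := J *m map_mx (@mpolyC k F) R.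
have rJ : r *m J = 0.
  apply/rowP => j; rewrite !mxE; transitivity ((compm g p)^`M(j)); last by rewrite gp0 mderiv0.
  by rewrite mderiv_compm; apply: eq_bigr => i _; rewrite !mxE.
have nzN : \det N != 0.
  apply: contra_eq_neq (det1 F t) => N0; rewrite -JR.
  have -> : Jac g x *m R = map_mx (meval x) N.
    rewrite map_mxM; congr (_ *m _); first by apply/matrixP => i j; rewrite !mxE.
    by apply/matrixP => i j; rewrite !mxE /= mevalC.
  by rewrite det_map_mx N0 raddf0 eq_sym oner_neq0.
have r0 i : compm g (p^`M(i)) = 0.
  have : r *m N *m \adj N = 0 by rewrite /N [r *m _]mulmxA rJ !mul0mx.
  rewrite -mulmxA mul_mx_adj mul_mx_scalar => /rowP/(_ i); rewrite !mxE => /eqP.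
  by rewrite mulf_eq0 (negPf nzN) => /eqP.
have [//|p0] := eqVneq p 0.
have dp i : p^`M(i) = 0.
  by apply: IH (r0 i); rewrite -ltnS (leq_trans _ pn) // ltnS msize_mderiv.
move: gp0; rewrite (mderiv_eq0_const dp) compmC => /eqP.
by rewrite mpolyC_eq0 => /eqP ->; rewrite mpolyC0.
Qed.

Definition rconsf t k (h : 'I_t -> {mpoly F[k]}) (f : {mpoly F[k]}) (i : 'I_t.+1) :=
  oapp h f (unlift ord_max i).

Lemma rconsf_max t k (h : 'I_t -> {mpoly F[k]}) f : rconsf h f ord_max = f.
Proof. by rewrite /rconsf unlift_none. Qed.

Lemma widen_lift t (i : 'I_t) : widen i = lift ord_max i.
Proof. by apply/val_inj; rewrite /= /bump leqNgt ltn_ord. Qed.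

Lemma rconsf_widen t k (h : 'I_t -> {mpoly F[k]}) f i : rconsf h f (widen i) = h i.
Proof. by rewrite /rconsf widen_lift liftK. Qed.

Lemma compm_rconsf_mwiden t k (h : 'I_t -> {mpoly F[k]}) f p :
  compm (rconsf h f) (mwiden p) = compm h p.
Proof.
pose f1 : {rmorphism {mpoly F[t]} -> _} := (compm (rconsf h f) \o @mwiden t F)%FUN.
pose f2 : {rmorphism {mpoly F[t]} -> _} := compm h.
apply: (@mpoly_rmorph_ext F t _ f1 f2) => [c|i]; rewrite /f1 /f2 /=.
  by rewrite mwidenC !compmC.
by rewrite mwidenX mnmwiden1 !compmX rconsf_widen.
Qed.

(* A relation of least size works: if its last derivative vanishes, then it does not
   involve f. *)
Lemma separable_relation t k (h : 'I_t -> {mpoly F[k]}) f :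
  algindep h -> ~ algindep (rconsf h f) ->
  exists2 p, compm (rconsf h f) p = 0 & compm (rconsf h f) (p^`M(ord_max)) != 0.
Proof.
move=> ih dep; apply: contrapT => nex; apply: dep => p.
have [n] := ubnP (msize p); elim: n p => // n IH p pn hp0.
have [//|p0] := eqVneq p 0.
have dp : p^`M(ord_max) = 0.
  apply: IH; first by rewrite -ltnS (leq_trans _ pn) // ltnS msize_mderiv.
  by apply/eqP/negPn/negP => nz; apply: nex; exists p.
have [|q pq] := @mwiden_of_msupp F t p.
  move=> m; rewrite mcoeff_msupp => pm; apply/eqP; apply: contraNT pm => m0.
  have := mcoeff_deriv ord_max (m - U_(ord_max))%MM p.
  by rewrite dp mcoeff0 submK ?lep1mP // => /esym/eqP; rewrite mulrn_eq0.
by rewrite pq (ih q) ?mwiden0 // -(compm_rconsf_mwiden h f) -pq.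
Qed.

(** A largest algebraically independent family h extending g by variables is a transcendence basis.
    Differentiating a separable relation of 'X_j over h writes the j-th coordinate differential as a
    combination of those of h wherever the product w of the separants is nonzero. There the Jacobian
    of h, which has at most k rows, is invertible, and the Jacobian of g consists of some of its
    rows. *)
Lemma indep_jac t k (g : 'I_t -> {mpoly F[k]}) : algindep g ->
  exists2 w : {mpoly F[k]}, w != 0 & forall x, w.@[x] != 0 -> row_free (Jac g x).
Proof.
move=> ig.
pose P s := exists2 h : 'I_s -> {mpoly F[k]}, algindep h &
  exists2 ts : (t <= s)%N, forall i : 'I_t, h (widen_ord ts i) = g i &
  forall i : 'I_s, (t <= i)%N -> exists j, h i = 'X_j.
have exP : exists s, `[< P s >].
  exists t; apply/asboolP; exists g => //; exists (leqnn t).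
    by move=> i; congr g; apply/val_inj.
  by move=> i; rewrite leqNgt ltn_ord.
have leP s : `[< P s >] -> (s <= k)%N.
  move=> /asboolP[h ih _]; rewrite leqNgt; apply/negP => /(compm_dependent h)[p p0 hp].
  by rewrite (ih p hp) eqxx in p0.
case: (ex_maxnP exP leP) => s Ps smax.
have {exP} sk := leP s Ps; case/asboolP: Ps => h ih [ts hg hX].
have dep j : ~ algindep (rconsf h 'X_j).
  move=> idep; suff /smax : `[< P s.+1 >] by rewrite ltnn.
  apply/asboolP; exists (rconsf h 'X_j) => //; exists (leqW ts).
    move=> i; rewrite -hg -(rconsf_widen h 'X_j); congr rconsf.
    exact/val_inj.
  move=> i ti; case: (unliftP ord_max i) ti => [l|] -> ti; last first.
    by exists j; rewrite rconsf_max.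
  rewrite -widen_lift rconsf_widen; apply: hX; move: ti.
  by rewrite -widen_lift.
have /choice [r rP] : forall j, exists p, compm (rconsf h 'X_j) p = 0
    /\ compm (rconsf h 'X_j) (p^`M(ord_max)) != 0.
  by move=> j; have [p] := separable_relation ih (dep j); exists p.
exists (\prod_j compm (rconsf h 'X_j) ((r j)^`M(ord_max))).
  by apply/prodf_neq0 => j _; case: (rP j).
move=> x; rewrite rmorph_prod => /prodf_neq0 wx.
have full : row_full (Jac h x).
  rewrite -sub1mx; apply/row_subP => j; rewrite row1.
  have [rj0 _] := rP j; have cx := wx j isT.
  pose v := \row_i (compm (rconsf h 'X_j) ((r j)^`M(widen i))).@[x].
  suff E : (compm (rconsf h 'X_j) ((r j)^`M(ord_max))).@[x] *: delta_mx 0 j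
      = - v *m Jac h x.
    rewrite -(eqmx_scale _ cx) E; exact: submxMl.
  have := congr1 (fun q => (q^`M(_)).@[x]) rj0 => dr.
  apply/rowP => l; have := dr l; rewrite mderiv0 meval0 mderiv_compm.
  rewrite raddf_sum big_ord_recr /= rconsf_max mevalM => /eqP.
  rewrite addrC addr_eq0 => /eqP E.
  have XE : ('X_j^`M(l)).@[x] = (j == l)%:R :> F.
    rewrite mderivX mevalZ mnm1E; case: eqP => [->|_]; last by rewrite mul0r.
    by rewrite -[X in 'X_[X - _]]add0m addmK mpolyX0 meval1 mulr1.
  rewrite mulNmx !mxE eqxx /= eq_sym -XE E; congr (- _); apply: eq_bigr => i _.
  by rewrite !mxE mevalM rconsf_widen.
have free : row_free (Jac h x).
  rewrite /row_free eqn_leq rank_leq_row.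
  by move: full; rewrite /row_full => /eqP ->.
case/row_freeP: free => B JB; apply/row_freeP; exists (colsub (widen_ord ts) B).
have -> : Jac g x = rowsub (widen_ord ts) (Jac h x).
  by apply/matrixP => i j; rewrite !mxE hg.
rewrite -mxsub_mul JB; apply/matrixP => i j; rewrite !mxE -val_eqE; by [].
Qed.

End JacobianCriterion.

(** * Krull dimension of the image of a polynomial map *)

Section KrullDimension.
Local Open Scope classical_set_scope.
Variables (F : numFieldType) (n : nat).
Implicit Types (X Y Z : set 'M[F]_n) (q : {mpoly F[n * n]}).

Definition mxeval q (M : 'M[F]_n) : F := q.@[fun l => mxvec M 0 l].

Lemma zariski_closureE X :
  zariski_closure X = zero_locus [set q | forall M, X M -> mxeval q M = 0].
Proof.
apply/seteqP; split => [M clM|M zM Z [[S ->] XS] q Sq].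
  apply: clM; split; first by exists [set q | forall M, X M -> mxeval q M = 0].
  by move=> M' XM' q qX; apply: qX.
by apply: zM => M' /XS; apply.
Qed.

Lemma closed_zariski_closure X : zariski_closed (zariski_closure X).
Proof. by rewrite zariski_closureE; eexists. Qed.

Lemma sub_zariski_closure X : X `<=` zariski_closure X.
Proof. by move=> M XM Z [_]; apply. Qed.

Lemma closure_vanish X q : (forall M, X M -> mxeval q M = 0) ->
  forall M, zariski_closure X M -> mxeval q M = 0.
Proof. by move=> qX M; rewrite zariski_closureE; apply. Qed.

Lemma zariski_closure_mono X Y : X `<=` Y -> zariski_closure X `<=` zariski_closure Y.
Proof. by move=> XY M clM Z [cZ YZ]; apply: clM; split=> // M' /XY/YZ. Qed.

Definition polymap k (Phi : 'I_(n * n) -> {mpoly F[k]}) (x : 'I_k -> F) : 'M[F]_n :=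
  vec_mx (\row_l (Phi l).@[x]).

Lemma mxeval_polymap k (Phi : 'I_(n * n) -> {mpoly F[k]}) q x :
  mxeval q (polymap Phi x) = (compm Phi q).@[x].
Proof.
rewrite meval_compm; apply: meval_eq => l.
by rewrite /polymap vec_mxK mxE.
Qed.

(** If some q in S has a nonzero pullback, its product with the pullback of any p in T vanishes
    everywhere, and polynomials form a domain. *)
Lemma irreducible_polymap k (Phi : 'I_(n * n) -> {mpoly F[k]}) :
  irreducible_closed (zariski_closure (range (polymap Phi))).
Proof.
split; first exact: closed_zariski_closure.
  by exists (polymap Phi (fun=> 0)); apply: sub_zariski_closure; exists (fun=> 0).
move=> _ _ [S ->] [T ->] XST; have [|/existsNP[q /not_implyP[Sq nq]]] :=
  pselect (forall q, S q -> compm Phi q = 0).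
  move=> S0; left; rewrite zariski_closureE => M zM q Sq.
  by apply: (zM q) => _ [x _ <-]; rewrite mxeval_polymap S0 // meval0.
right => M clM p Tp; apply: (closure_vanish _ clM) => _ [x _ <-].
rewrite mxeval_polymap; suff -> : compm Phi p = 0 by rewrite meval0.
apply/eqP; suff : compm Phi q * compm Phi p == 0 by rewrite mulf_eq0 (negPf (introN eqP nq)).
apply/eqP/mpoly_infinite_eq0 => y; rewrite mevalM -!mxeval_polymap.
have [|H|H] := XST (polymap Phi y); first by apply: sub_zariski_closure; exists y.
  by rewrite [mxeval q _]H ?mul0r.
by rewrite [mxeval p _]H ?mulr0.
Qed.

Definition indep_on Z t (f : 'I_t -> {mpoly F[n * n]}) :=
  forall p : {mpoly F[t]}, (forall M, Z M -> mxeval (compm f p) M = 0) -> p = 0.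

(* A function vanishing on Y but not on Z is independent of the functions independent on Y. *)
Lemma indep_on_step Y Z t (f : 'I_t -> {mpoly F[n * n]}) :
  zariski_closed Y -> irreducible_closed Z -> Y `<` Z -> indep_on Y f ->
  exists f' : 'I_t.+1 -> {mpoly F[n * n]}, indep_on Z f'.
Proof.
move=> [S YE] [_ _ irrZ] [YZ nZY] iY.
have [g gY [M0 ZM0 gM0]] : exists2 g, (forall M, Y M -> mxeval g M = 0) &
    exists2 M, Z M & mxeval g M <> 0.
  apply: contrapT => nex; apply: nZY => M ZM; rewrite YE => g Sg.
  apply: contrapT => gM; apply: nex; exists g; last by exists M.
  by move=> M'; rewrite YE; apply.
exists (rconsf f g) => p.
have [e] := ubnP (msize p); elim: e p => // e IH p pe pZ.
have [q [p' pE]] := mpoly_split_last p.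
have compE M : mxeval (compm (rconsf f g) p) M =
    mxeval (compm f q) M + mxeval g M * mxeval (compm (rconsf f g) p') M.
  rewrite pE (rmorphD (compm (rconsf f g))) (rmorphM (compm (rconsf f g))) /=.
  by rewrite compm_rconsf_mwiden compmX rconsf_max /mxeval mevalD mevalM.
have q0 : q = 0.
  apply: iY => M YM; have := pZ M (YZ M YM).
  by rewrite compE (gY M YM) mul0r addr0.
have [p'0|nzp'] := eqVneq p' 0; first by rewrite pE q0 p'0 mulr0 mwiden0 addr0.
suff p'0 : p' = 0 by rewrite p'0 eqxx in nzp'.
apply: IH.
  move: pe; rewrite pE q0 mwiden0 add0r msizeM //; last first.
    by rewrite -msize_poly_eq0 msizeX.
  by rewrite msizeX mdeg1.
have [|||ZA|ZB] := irrZ (zero_locus [set compm (rconsf f g) p']) (zero_locus [set g]).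
- by eexists.
- by eexists.
- move=> M ZM; have := pZ M ZM; rewrite compE q0 raddf0 /mxeval meval0 add0r.
  move/eqP; rewrite mulf_eq0 => /orP[/eqP H|/eqP H]; [right|left]; by move=> _ ->.
- by move=> M /ZA; apply.
- by case: gM0; apply: (ZB _ ZM0).
Qed.

Lemma chain_indep X e (Z : nat -> set 'M[F]_n) : irreducible_chain X e Z ->
  exists f : 'I_e -> {mpoly F[n * n]}, indep_on X f.
Proof.
case=> irr lt.
suff H i : (i <= e)%N -> exists f : 'I_i -> {mpoly F[n * n]}, indep_on (Z i) f.
  have [f If] := H e (leqnn e); exists f => p pX; apply: If => M ZM; apply: pX.
  by have [_] := irr e (leqnn e); apply.
elim: i => [_|i IH ie].
  exists (fun=> 0) => p; have [[_ [M ZM] _] _] := irr 0%N isT => /(_ M ZM).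
  rewrite -(mpolyKC p) compmC /mxeval mevalC => ->; exact: mpolyC0.
have [f If] := IH (ltnW ie); have [[cZ _ _] _] := irr i (ltnW ie).
by have [irrZ _] := irr i.+1 ie; apply: indep_on_step (lt i ie) If.
Qed.

Lemma Jac_compm t m k (f : 'I_t -> {mpoly F[m]}) (Phi : 'I_m -> {mpoly F[k]}) x :
  Jac (fun i => compm Phi (f i)) x = Jac f (fun l => (Phi l).@[x]) *m Jac Phi x.
Proof.
apply/matrixP => i j; rewrite !mxE mderiv_compm raddf_sum; apply: eq_bigr => l _ /=.
by rewrite !mxE mevalM meval_compm.
Qed.

Lemma compm_comp t m k (f : 'I_t -> {mpoly F[m]}) (Phi : 'I_m -> {mpoly F[k]}) p :
  compm (fun i => compm Phi (f i)) p = compm Phi (compm f p).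
Proof.
pose f1 : {rmorphism {mpoly F[t]} -> _} := compm (fun i => compm Phi (f i)).
pose f2 : {rmorphism {mpoly F[t]} -> _} := (compm Phi \o compm f)%FUN.
apply: (@mpoly_rmorph_ext F t _ f1 f2) => [c|i]; rewrite /f1 /f2 /=.
  by rewrite !compmC.
by rewrite !compmX.
Qed.

(** Zariski density, stated on principal open sets. *)
Definition zdense k (Q : ('I_k -> F) -> Prop) :=
  forall w : {mpoly F[k]}, w != 0 -> exists2 x, Q x & w.@[x] != 0.

(** The e functions given by a chain stay algebraically independent after composition with the map,
    so the composite Jacobian has rank e off a hypersurface. By the chain rule it factors through
    [Jac Phi], and density supplies a point off that hypersurface where the latter has rank at most
    d. *)
Lemma krull_upper k (Phi : 'I_(n * n) -> {mpoly F[k]}) d e (Z : nat -> set 'M[F]_n) :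
  zdense (fun x => (\rank (Jac Phi x) <= d)%N) ->
  irreducible_chain (zariski_closure (range (polymap Phi))) e Z -> (e <= d)%N.
Proof.
move=> dns /chain_indep[f If].
have /indep_jac[w /dns[x rkd wx] free] : algindep (fun i => compm Phi (f i)).
  move=> p; rewrite compm_comp => p0; apply: If; apply: closure_vanish => _ [x _ <-].
  by rewrite mxeval_polymap p0 meval0.
have := free x wx; rewrite /row_free Jac_compm => /eqP <-.
exact: leq_trans (mxrankM_maxr _ _) rkd.
Qed.

Lemma rank_hypersurface k (Phi : 'I_(n * n) -> {mpoly F[k]}) q x : q != 0 ->
  (forall y, mxeval q (polymap Phi y) = 0) -> (\rank (Jac Phi x) <= n ^ 2 - 1)%N.
Proof.
move=> q0 qPhi; rewrite -mulnn subn1 -ltnS; case: (posnP (n * n)) => [n0|n0].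
  by rewrite ltnS (leq_trans (rank_leq_row _)) ?n0.
rewrite prednK // ltn_neqAle rank_leq_row andbT; apply: contraNneq q0 => rk.
apply/eqP/(@jac_indep F _ k Phi x); first by apply/eqP.
by apply: mpoly_infinite_eq0 => y; rewrite -mxeval_polymap.
Qed.

End KrullDimension.

Section KrullLower.
Local Open Scope classical_set_scope.
Variables (F : numFieldType) (n : nat).

Lemma rank_ge_unit_minor m p (A : 'M[F]_(m, p)) d : (d <= \rank A)%N ->
  exists V : 'M[F]_(d, m), exists R : 'M[F]_(p, d), V *m A *m R = 1%:M.
Proof.
move=> dA; exists (pid_mx d *m invmx (col_ebase A)).
exists (invmx (row_ebase A) *m pid_mx d).
rewrite -{2}(mulmx_ebase A) !mulmxA mulmxKV ?col_ebase_unit //.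
rewrite -[_ *m row_ebase A *m _]mulmxA mulmxV ?row_ebase_unit // mulmx1.
rewrite !mul_pid_mx -(pid_mx_1 F d); congr pid_mx.
have dm := leq_trans dA (rank_leq_row A); have dp := leq_trans dA (rank_leq_col A).
lia.
Qed.

Lemma mderivXU k (i j : 'I_k) : ('X_i : {mpoly F[k]})^`M(j) = (i == j)%:R.
Proof.
rewrite mderivX mnm1E; case: eqP => [->|_]; last by rewrite scale0r.
by rewrite scale1r -[X in 'X_[X - _]]add0m addmK mpolyX0.
Qed.

Section Flag.
Variables (k d : nat) (Phi : 'I_(n * n) -> {mpoly F[k]}) (x : 'I_k -> F).
Variables (V : 'M[F]_(d, k)) (R : 'M[F]_(n * n, d)).
Hypothesis VR : V *m (Jac Phi x)^T *m R = 1%:M.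

(** Rows of V and columns of R are indexed by all naturals, with 0 out of range, so that [aff i],
    the affine subspace through x along the first i rows of V, is defined for every i and the sets
    [Z i] are compared without casts. *)
Let Vn (l : nat) j := oapp (fun l' : 'I_d => V l' j) 0 (insub l).
Let Rn c (l : nat) := oapp (fun l' : 'I_d => R c l') 0 (insub l).

Let aff h (j : 'I_k) : {mpoly F[h]} := (x j)%:MP + \sum_(l < h) Vn l j *: 'X_l.
Let Psi i l := compm (aff i) (Phi l).
Let coords i (l : 'I_i) : {mpoly F[n * n]} := \sum_c Rn c l *: 'X_c.

Let meval_aff i j s : (aff i j).@[s] = x j + \sum_(l < i) Vn l j * s l.
Proof.
rewrite /aff mevalD mevalC raddf_sum; congr (_ + _); apply: eq_bigr => l _ /=.
by rewrite mevalZ mevalXU.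
Qed.

Let polymap_Psi i s : polymap (Psi i) s = polymap Phi (fun j => (aff i j).@[s]).
Proof. by congr vec_mx; apply/rowP => l; rewrite !mxE meval_compm. Qed.

Let Z i := zariski_closure (range (polymap (Psi i))).

Let Z_sub i : Z i `<=` zariski_closure (range (polymap Phi)).
Proof.
by apply: zariski_closure_mono => _ [s _ <-]; rewrite polymap_Psi; eexists.
Qed.

Let Z_mono i : Z i `<=` Z i.+1.
Proof.
apply: zariski_closure_mono => _ [s _ <-].
exists (fun l => oapp s 0 (unlift ord_max l)) => //; rewrite !polymap_Psi.
congr polymap; apply: funext => j; rewrite !meval_aff big_ord_recr /= unlift_none mulr0 addr0.
congr (_ + _); apply: eq_bigr => l _.
by rewrite widen_lift liftK /=; congr (Vn _ _ * _); rewrite /bump leqNgt ltn_ord.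
Qed.

(** At the parameter 0, which is the point x, the Jacobian of these composites is the transpose of
    the leading i x i block of V (Jac Phi x)^T R = 1. *)
Let coords_indep i : (i <= d)%N -> algindep (fun l : 'I_i => compm (Psi i) (coords l)).
Proof.
move=> id; apply: (@jac_indep F _ _ _ (fun=> 0)).
rewrite /row_free Jac_compm /Psi Jac_compm.
have -> : (fun j => (aff i j).@[fun=> 0]) = x.
  by apply: funext => j; rewrite meval_aff big1 ?addr0 // => l _; rewrite mulr0.
suff -> : Jac (@coords i) (fun l => (compm (aff i) (Phi l)).@[fun=> 0])
    *m (Jac Phi x *m Jac (aff i) (fun=> 0)) = 1%:M by rewrite mxrank1.
have -> : Jac (@coords i) (fun l => (compm (aff i) (Phi l)).@[fun=> 0])
    = (colsub (widen_ord id) R)^T.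
  apply/matrixP => a c; rewrite !mxE /coords (raddf_sum (mderiv c)) (raddf_sum (meval _)) (bigD1 c) //=.
  rewrite mderivZ mevalZ mderivXU eqxx meval1 mulr1 big1 ?addr0.
    rewrite /Rn insubT /=; first exact: leq_trans (ltn_ord a) id.
    by move=> lt; congr (R c _); apply/val_inj.
  by move=> e /negPf ec; rewrite mderivZ mevalZ mderivXU ec meval0 mulr0.
have -> : Jac (aff i) (fun=> 0) = (rowsub (widen_ord id) V)^T.
  apply/matrixP => j a; rewrite !mxE /aff mderivD mderivC add0r.
  rewrite (raddf_sum (mderiv a)) (raddf_sum (meval _)).
  rewrite (bigD1 a) //= mderivZ mevalZ mderivXU eqxx meval1 mulr1 big1 ?addr0.
    rewrite /Vn insubT /=; first exact: leq_trans (ltn_ord a) id.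
    by move=> lt; congr (V _ j); apply/val_inj.
  by move=> e /negPf ec; rewrite mderivZ mevalZ mderivXU ec meval0 mulr0.
apply: trmx_inj; rewrite !trmx_mul !trmxK trmx1.
rewrite !mul_rowsub_mx mulmx_colsub VR.
by apply/matrixP => a b; rewrite !mxE -!val_eqE.
Qed.

(* The i + 1 linear forms coords, dual to the first directions of V, are dependent on Z i,
   which is parametrized by i variables, but not on Z i.+1. *)
Lemma chain_of_flag : exists C : nat -> set 'M[F]_n,
  irreducible_chain (zariski_closure (range (polymap Phi))) d C.
Proof.
exists Z; split=> i id; first by split; [exact: irreducible_polymap | exact: Z_sub].
split=> // ZZ.
have [p p0 gp] := compm_dependent (fun l : 'I_i.+1 => compm (Psi i) (coords l)) (ltnSn i).
suff p0' : p = 0 by rewrite p0' eqxx in p0.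
apply: (coords_indep id); rewrite compm_comp; apply: mpoly_infinite_eq0 => s.
rewrite -mxeval_polymap; apply: (@closure_vanish F n (range (polymap (Psi i)))).
  by move=> _ [s' _ <-]; rewrite mxeval_polymap -compm_comp gp meval0.
by apply: ZZ; apply: sub_zariski_closure; exists s.
Qed.

End Flag.

Lemma krull_lower k (Phi : 'I_(n * n) -> {mpoly F[k]}) x d :
  (d <= \rank (Jac Phi x))%N -> exists C : nat -> set 'M[F]_n,
    irreducible_chain (zariski_closure (range (polymap Phi))) d C.
Proof.
rewrite -mxrank_tr => /rank_ge_unit_minor[V [R VR]]; exact: chain_of_flag VR.
Qed.

Lemma krull_dim_polymap k (Phi : 'I_(n * n) -> {mpoly F[k]}) x d :
  (d <= \rank (Jac Phi x))%N -> zdense (fun y => (\rank (Jac Phi y) <= d)%N) ->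
  krull_dim (zariski_closure (range (polymap Phi))) d.
Proof.
move=> dx dns; split; first exact: krull_lower dx.
by move=> e C; apply: krull_upper.
Qed.

End KrullLower.

(** * Products of skew-symmetric matrices and their tangent spaces *)

Section Products.
Variables (R : pzRingType) (n : nat).
Implicit Types (A B : nat -> 'M[R]_n) (Z : 'M[R]_n).

Fixpoint prodm A r : 'M[R]_n := if r is r'.+1 then prodm A r' *m A r' else 1%:M.

Fixpoint tang A B r : 'M[R]_n :=
  if r is r'.+1 then tang A B r' *m A r' + prodm A r' *m B r' else 0.

Definition skewize A i := A i - (A i)^T.

Lemma prodmE A r : prodm A r = \prod_(i < r) A i.
Proof. by elim: r => [|r IH]; rewrite ?big_ord0 // big_ord_recr /= IH. Qed.

Lemma eq_prodm A A' r : (forall i, (i < r)%N -> A i = A' i) -> prodm A r = prodm A' r.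
Proof. by elim: r => //= r IH E; rewrite IH ?E // => i /ltnW/E. Qed.

Lemma eq_tang A A' B B' r : (forall i, (i < r)%N -> A i = A' i) ->
  (forall i, (i < r)%N -> B i = B' i) -> tang A B r = tang A' B' r.
Proof.
elim: r => //= r IH EA EB; rewrite IH ?EA ?EB ?(eq_prodm (A' := A')) //.
all: by move=> i ir; rewrite ?EA ?EB // ltnW.
Qed.

Lemma tang0 A B r : (forall i, (i < r)%N -> B i = 0) -> tang A B r = 0.
Proof.
elim: r => //= r IH B0; rewrite IH ?B0 // ?mul0mx ?mulmx0 ?addr0 //.
by move=> i ir; rewrite B0 // ltnW.
Qed.

End Products.

Lemma map_prodm (R S : pzRingType) (f : {rmorphism R -> S}) n (A : nat -> 'M[R]_n) r :
  map_mx f (prodm A r) = prodm (fun i => map_mx f (A i)) r.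
Proof. by elim: r => [|r IH] /=; rewrite ?map_mx1 // map_mxM IH. Qed.

Lemma tangZ (R : comPzRingType) n (c : R) (A B : nat -> 'M[R]_n) r :
  tang A (fun i => c *: B i) r = c *: tang A B r.
Proof.
elim: r => [|r IH] /=; first by rewrite scaler0.
by rewrite IH scalerDr scalemxAl scalemxAr.
Qed.

Lemma mxtrace_mul_delta (R : pzRingType) n (U : 'M[R]_n) i j :
  \tr (U *m delta_mx i j) = U j i.
Proof.
rewrite /mxtrace (bigD1 j) //= big1 ?addr0.
  rewrite !mxE (bigD1 i) //= !mxE !eqxx mulr1 big1 ?addr0 // => l li.
  by rewrite mxE (negPf li) mulr0.
by move=> l lj; rewrite mxE big1 // => m _; rewrite mxE (negPf lj) andbF mulr0.
Qed.

Section Annihilator.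
Variables (F : numFieldType) (n : nat).
Implicit Types (A B V : nat -> 'M[F]_n) (Z W : 'M[F]_n).

(* Z is orthogonal, for the trace form, to the tangent space at A of the products of
   r skew-symmetric matrices. *)
Fixpoint ann A r Z : Prop :=
  if r is r'.+1 then ann A r' (A r' *m Z) /\ (Z *m prodm A r')^T = Z *m prodm A r'
  else True.

Lemma trace_skew_eq0 W : (forall M, \tr (W *m (M - M^T)) = 0) <-> W^T = W.
Proof.
split=> [H|sW M]; last first.
  by rewrite mulmxBr raddfB /= -[\tr (_ *m M^T)]mxtrace_tr trmx_mul trmxK sW mxtrace_mulC subrr.
apply/matrixP => i j; have := H (delta_mx i j).
by rewrite trmx_delta mulmxBr raddfB /= !mxtrace_mul_delta mxE => /eqP; rewrite subr_eq0 => /eqP.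
Qed.

(** By cyclicity the trace splits into a part blind to the last direction and a part that sees only
    it. Varying the last direction alone makes Z P orthogonal to every skew matrix, that is
    symmetric, P being the product of the first r factors; setting it to zero leaves the recursion
    on A_r Z. *)
Lemma annP A r Z : ann A r Z <-> (forall V, \tr (Z *m tang A (skewize V) r) = 0).
Proof.
elim: r Z => [|r IH] Z /=; first by split=> // _ V; rewrite mulmx0 mxtrace0.
have trE V : \tr (Z *m (tang A (skewize V) r *m A r + prodm A r *m skewize V r))
    = \tr (A r *m Z *m tang A (skewize V) r) + \tr (Z *m prodm A r *m skewize V r).
  by rewrite mulmxDr raddfD /= !mulmxA mxtrace_mulC !mulmxA.
split=> [[/IH aZ /trace_skew_eq0 sZ] V|H]; first by rewrite trE aZ sZ addr0.
split.
  apply/IH => V; pose V' i := if (i < r)%N then V i else 0.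
  have V'r : skewize V' r = 0 by rewrite /skewize /V' ltnn trmx0 subr0.
  have := H V'; rewrite trE V'r mulmx0 mxtrace0 addr0.
  by rewrite (@eq_tang _ _ A A _ (skewize V)) // => i ir; rewrite /skewize /V' ir.
apply/trace_skew_eq0 => M; pose V' i := if i == r then M else 0.
have := H V'; rewrite trE tang0; last first.
  by move=> i /ltn_eqF ir; rewrite /skewize /V' ir trmx0 subr0.
by rewrite mulmx0 mxtrace0 add0r /skewize /V' eqxx.
Qed.

End Annihilator.

Definition skew_pairs n := [set p : 'I_n * 'I_n | (p.1 < p.2)%N]%SET.

Lemma card_skew_pairs n : #|skew_pairs n| = 'C(n, 2).
Proof.
rewrite -sum1_card -bin2_sum.
rewrite (eq_bigl (fun p : 'I_n * 'I_n => (p.1 < p.2)%N)); last by move=> p; rewrite inE.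
rewrite -(pair_big_dep xpredT (fun a b : 'I_n => (a < b)%N) (fun _ _ => 1%N)) /=.
rewrite (exchange_big_dep xpredT) //= big_mkord; apply: eq_bigr => b _.
by rewrite -(big_ord_widen n (fun=> 1%N)) ?sum1_card ?card_ord // ltnW.
Qed.

Section ProductMap.
Local Open Scope classical_set_scope.
Variables (F : numFieldType) (n r : nat).
Local Notation K := (r * (n * n))%N.
Implicit Types (A B V X : nat -> 'M[F]_n) (Z M : 'M[F]_n).

Definition encode X : 'rV[F]_K := mxvec (\matrix_(i < r) mxvec (X i)).
Definition param X (c : 'I_K) : F := encode X 0 c.

Definition entry_index (i : 'I_r) (a b : 'I_n) : 'I_K := mxvec_index i (mxvec_index a b).

Lemma param_entry X i a b : param X (entry_index i a b) = X i a b.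
Proof. by rewrite /param /encode mxvecE mxE mxvecE. Qed.

Lemma encode_surj (v : 'rV[F]_K) : exists X, encode X = v.
Proof.
exists (fun i => oapp (fun i' : 'I_r => vec_mx (row i' (vec_mx v))) 0 (insub i)).
apply: (canLR vec_mxK); apply/row_matrixP => i.
by rewrite rowK insubT //= => lt; rewrite vec_mxK; congr row; apply/val_inj.
Qed.

Lemma param_surj (x : 'I_K -> F) : exists X, param X = x.
Proof.
have [X XE] := encode_surj (\row_c x c); exists X.
by apply: funext => c; rewrite /param XE mxE.
Qed.

Definition varmx (i : nat) : 'M[{mpoly F[K]}]_n :=
  oapp (fun i' : 'I_r => \matrix_(a, b) 'X_(entry_index i' a b)) 0 (insub i).

Definition prodmap (l : 'I_(n * n)) : {mpoly F[K]} :=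
  mxvec (prodm (skewize varmx) r) 0 l.

Lemma meval_varmx X i : (i < r)%N -> map_mx (meval (param X)) (varmx i) = X i.
Proof.
move=> ir; rewrite /varmx insubT /=.
by apply/matrixP => a b; rewrite !mxE /= mevalXU param_entry.
Qed.

Lemma meval_skewize X i : (i < r)%N ->
  map_mx (meval (param X)) (skewize varmx i) = skewize X i.
Proof. by move=> ir; rewrite /skewize map_mxB -map_trmx meval_varmx. Qed.

Lemma meval_prodm X m : (m <= r)%N ->
  map_mx (meval (param X)) (prodm (skewize varmx) m) = prodm (skewize X) m.
Proof.
move=> mr; rewrite map_prodm; apply: eq_prodm => i im.
by rewrite meval_skewize // (leq_trans im).
Qed.

Lemma polymap_prodmap X : polymap prodmap (param X) = prodm (skewize X) r.
Proof.
apply: (canLR mxvecK); apply/rowP => l.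
rewrite -meval_prodm // mxE -map_mxvec mxE; congr (meval _ _); exact: esym.
Qed.

Lemma mu0_skewE : mu0 r (skew_mx F n) = range (polymap prodmap).
Proof.
apply/seteqP; split=> [P [M [sM ->]]|_ [x _ <-]].
  pose X i := oapp (fun i' : 'I_r => 2%:R^-1 *: M i') 0 (insub i).
  exists (param X) => //; rewrite polymap_prodmap prodmE; apply: eq_bigr => i _.
  rewrite /skewize /X valK /=.
  have sMi : (M i)^T = - M i := sM i.
  rewrite linearZ /= sMi scalerN opprK -scalerDl -mulr2n -[_ *+ 2]mulr_natr mulVf ?scale1r //.
  by rewrite pnatr_eq0.
have [X <-] := param_surj x; rewrite polymap_prodmap prodmE.
exists (fun i => skewize X i); split=> // i; rewrite /skew_mx /= /skewize.
by rewrite raddfB /= trmxK opprB.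
Qed.

(** The entrywise differential at x along v. By the Leibniz rule it takes a product of generic skew
    matrices to [tang]. *)
Definition dmx (x v : 'I_K -> F) m p (P : 'M[{mpoly F[K]}]_(m, p)) : 'M[F]_(m, p) :=
  \matrix_(a, b) \sum_j ((P a b)^`M(j)).@[x] * v j.

Lemma dmxM x v m p q (P : 'M_(m, p)) (Q : 'M_(p, q)) :
  dmx x v (P *m Q) = dmx x v P *m map_mx (meval x) Q + map_mx (meval x) P *m dmx x v Q.
Proof.
apply/matrixP => a b; rewrite !mxE -big_split /=.
under eq_bigr do rewrite (raddf_sum (mderiv _)) (raddf_sum (meval _)) mulr_suml.
rewrite exchange_big /=; apply: eq_bigr => c _.
rewrite !mxE mulr_suml mulr_sumr -big_split; apply: eq_bigr => j _ /=.
by rewrite mderivM mevalD !mevalM; ring.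
Qed.

Lemma dmxD x v m p (P Q : 'M_(m, p)) : dmx x v (P + Q) = dmx x v P + dmx x v Q.
Proof.
apply/matrixP => a b; rewrite !mxE -big_split; apply: eq_bigr => j _ /=.
by rewrite mderivD mevalD mulrDl.
Qed.

Lemma dmxN x v m p (P : 'M_(m, p)) : dmx x v (- P) = - dmx x v P.
Proof.
apply/matrixP => a b; rewrite !mxE -sumrN; apply: eq_bigr => j _ /=.
by rewrite mderivN mevalN mulNr.
Qed.

Lemma dmx_tr x v m p (P : 'M_(m, p)) : dmx x v P^T = (dmx x v P)^T.
Proof. by apply/matrixP => a b; rewrite !mxE; apply: eq_bigr. Qed.

Lemma dmx_const x v m p (M : 'M[F]_(m, p)) : dmx x v (map_mx (@mpolyC K F) M) = 0.
Proof.
apply/matrixP => a b; rewrite !mxE big1 // => j _.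
by rewrite mderivC meval0 mul0r.
Qed.

Lemma dmxZ x v m p c (P : 'M_(m, p)) : dmx x v (c%:MP *: P) = c *: dmx x v P.
Proof.
apply/matrixP => a b; rewrite !mxE mulr_sumr; apply: eq_bigr => j _ /=.
by rewrite mderiv_mulC mevalM mevalC mulrA.
Qed.

Lemma dmx_block x v m1 m2 p1 p2 (A : 'M_(m1, p1)) (B : 'M_(m1, p2)) (C : 'M_(m2, p1))
    (D : 'M_(m2, p2)) : dmx x v (block_mx A B C D)
  = block_mx (dmx x v A) (dmx x v B) (dmx x v C) (dmx x v D).
Proof.
have bE := (block_mxEul, block_mxEur, block_mxEdl, block_mxEdr).
apply/matrixP => a b; case: (split_ordP a) => a' ->; case: (split_ordP b) => b' ->;
  by rewrite [LHS]mxE ?bE [RHS]mxE; apply: eq_bigr => j _; rewrite ?bE.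
Qed.

Lemma dmx_diag x v m (d : 'rV_m) : dmx x v (diag_mx d) = diag_mx (dmx x v d).
Proof.
apply/matrixP => a b; rewrite !mxE; case: eqP => _; last first.
  by rewrite big1 // => j _; rewrite mulr0n mderiv0 meval0 mul0r.
by rewrite mulr1n.
Qed.

Lemma dmx_varmx X V i : (i < r)%N -> dmx (param X) (param V) (varmx i) = V i.
Proof.
move=> ir; apply/matrixP => a b.
rewrite !mxE /varmx insubT /= mxE (bigD1 (entry_index (Ordinal ir) a b)) //=.
rewrite mderivXU eqxx meval1 mul1r param_entry big1 ?addr0 // => j /negPf je.
by rewrite mderivXU eq_sym je meval0 mul0r.
Qed.

Lemma dmx_skewize X V i : (i < r)%N ->
  dmx (param X) (param V) (skewize varmx i) = skewize V i.
Proof. by move=> ir; rewrite /skewize dmxD dmxN dmx_tr dmx_varmx. Qed.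

Lemma dmx_prodm X V m : (m <= r)%N ->
  dmx (param X) (param V) (prodm (skewize varmx) m) = tang (skewize X) (skewize V) m.
Proof.
elim: m => [_|m IH mr] /=.
  apply/matrixP => a b; rewrite !mxE big1 // => j _.
  by rewrite -mpolyC_nat mderivC meval0 mul0r.
by rewrite dmxM dmx_skewize // IH ?meval_skewize ?meval_prodm // ltnW.
Qed.

Lemma Jac_prodmap X V : encode V *m (Jac prodmap (param X))^T
  = mxvec (tang (skewize X) (skewize V) r).
Proof.
apply/rowP => l; case/mxvec_indexP: l => a b.
rewrite -dmx_prodm // mxvecE !mxE; apply: eq_bigr => j _.
by rewrite !mxE /prodmap mxvecE mulrC.
Qed.

Lemma mxvec_tr Z M : \sum_l mxvec Z 0 l * mxvec M 0 l = \tr (Z^T *m M).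
Proof.
rewrite /mxtrace; under [RHS]eq_bigr do rewrite mxE.
rewrite exchange_big pair_bigA /= (reindex _ (curry_mxvec_bij n n)) /=.
by apply: eq_bigr => -[a b] _; rewrite /= !mxvecE mxE.
Qed.

Lemma ann_Jac X Z : mxvec Z^T *m Jac prodmap (param X) = 0 <-> ann (skewize X) r Z.
Proof.
have trE V : (mxvec Z^T *m Jac prodmap (param X) *m (encode V)^T) 0 0
    = \tr (Z *m tang (skewize X) (skewize V) r).
  rewrite -mulmxA -[Jac _ _]trmxK -trmx_mul Jac_prodmap.
  rewrite -{2}(trmxK Z) -mxvec_tr mxE; apply: eq_bigr => l _; by rewrite [X in _ * X]mxE.
split=> [Z0|/annP aZ]; first by apply/annP => V; rewrite -trE Z0 mul0mx mxE.
apply/rowP => c; rewrite [RHS]mxE; have [V VE] := encode_surj (delta_mx 0 c).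
by rewrite -(aZ V) -trE VE trmx_delta -colE [RHS]mxE.
Qed.

(** The forms tr (C_i Z) are jointly injective on the annihilator, which is the left kernel of the
    Jacobian up to transposition, so its dimension is at most #|I|. Except for n = 2, every lower
    bound comes from here, with as many forms as the expected dimension of the annihilator. *)
Lemma rank_ge_ann X (I : finType) (C : I -> 'M[F]_n) :
  (forall Z, ann (skewize X) r Z -> (forall i, \tr (C i *m Z) = 0) -> Z = 0) ->
  (n * n - #|I| <= \rank (Jac prodmap (param X)))%N.
Proof.
move=> inj; set J := Jac _ _.
pose L : 'M[F]_(n * n, #|I|) := \matrix_(l, i) mxvec (C (enum_val i)) 0 l.
have cap0 : (kermx J :&: kermx L)%MS = 0.
  apply/eqP/rowV0P => v; rewrite sub_capmx => /andP[/sub_kermxP vJ /sub_kermxP vL].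
  pose Z := (vec_mx v)^T; have vZ : v = mxvec Z^T by rewrite trmxK vec_mxK.
  suff Z0 : Z = 0 by rewrite vZ Z0 trmx0 linear0.
  apply: inj => [|i]; first by apply/ann_Jac; rewrite -vZ.
  have := congr1 (fun M : 'rV_ _ => M 0 (enum_rank i)) vL; rewrite [v]vZ !mxE => tr0.
  rewrite mxtrace_mulC -{1}(trmxK Z) -mxvec_tr -[RHS]tr0; apply: eq_bigr => l _.
  by rewrite mxE enum_rankK.
have := mxrank_mul_ker (kermx J) L; rewrite cap0 mxrank0 addn0 mxrank_ker => kL.
have := rank_leq_col (kermx J *m L); rewrite kL; have := rank_leq_row J; lia.
Qed.

Lemma rank_le_ann X c (S : 'I_c -> 'M[F]_n) :
  (forall i, ann (skewize X) r (S i)) ->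
  (forall u : 'I_c -> F, \sum_i u i *: S i = 0 -> forall i, u i = 0) ->
  (\rank (Jac prodmap (param X)) <= n * n - c)%N.
Proof.
move=> aS free; set J := Jac _ _.
pose L : 'M[F]_(c, n * n) := \matrix_(i < c) mxvec (S i)^T.
have LJ : (L <= kermx J)%MS.
  by apply/sub_kermxP/row_matrixP => i; rewrite row_mul rowK row0; apply/ann_Jac.
have : row_free L.
  rewrite -kermx_eq0; apply/rowV0P => u /sub_kermxP uL; apply/rowP => i.
  rewrite [RHS]mxE; apply: (free (u 0)); apply: trmx_inj; apply: (can_inj mxvecK).
  rewrite trmx0 linear0 -uL mulmx_sum_row !linear_sum /=.
  by apply: eq_bigr => j _; rewrite rowK !linearZ.
rewrite /row_free => /eqP rL; have := mxrankS LJ; rewrite rL mxrank_ker.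
have := rank_leq_row J; lia.
Qed.

Let T : {set 'I_r * ('I_n * 'I_n)} := finset.setX [set: 'I_r]%SET (skew_pairs n).

Let unit_skew (x : 'I_r * ('I_n * 'I_n)) (j : nat) : 'M[F]_n :=
  if j == x.1 then delta_mx x.2.1 x.2.2 - delta_mx x.2.2 x.2.1 else 0.

Let E : 'M[F]_(#|T|, K) := \matrix_(t < #|T|) encode (unit_skew (enum_val t)).

Let skew_coords B : 'rV[F]_#|T| :=
  \row_(t < #|T|) (fun x : 'I_r * ('I_n * 'I_n) => B x.1 x.2.1 x.2.2) (enum_val t).

Let encode_skew B : (forall j, (B j)^T = - B j) -> encode B = skew_coords B *m E.
Proof.
move=> sB; apply/rowP => c; case/mxvec_indexP: c => j c; case/mxvec_indexP: c => a b.
transitivity (B j a b); first exact: param_entry.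
have sumT (f : 'I_r * ('I_n * 'I_n) -> F) y :
    \sum_(x in T) f x * (x == y)%:R = if y \in T then f y else 0.
  case: ifP => yT; last first.
    rewrite big1 // => x xT; case: eqP => [xy|_]; last by rewrite mulr0.
    by rewrite -xy xT in yT.
  rewrite (bigD1 y) //= eqxx mulr1 big1 ?addr0 // => x /andP[_ /negPf ->].
  by rewrite mulr0.
have tE x : encode (unit_skew x) 0 (mxvec_index j (mxvec_index a b)) =
    (x == (j, (a, b)))%:R - (x == (j, (b, a)))%:R.
  rewrite [LHS]param_entry /unit_skew; case: x => i [p q] /=; rewrite !xpair_eqE.
  rewrite val_eqE eq_sym; case: eqP => _ /=; last by rewrite mxE subrr.
  by rewrite !mxE ![a == _]eq_sym ![b == _]eq_sym [in X in _ - X]andbC.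
transitivity (\sum_(x in T) B x.1 x.2.1 x.2.2 *
    ((x == (j, (a, b)))%:R - (x == (j, (b, a)))%:R)); last first.
  by rewrite mxE big_enum_val /=; apply: eq_bigr => t _; rewrite ![in RHS]mxE tE.
under eq_bigr do rewrite mulrBr.
rewrite sumrB !sumT !inE /=.
have Bba : B j b a = - B j a b by have /matrixP/(_ a b) := sB j; rewrite !mxE.
case: (ltngtP a b) => [ab|ba|/val_inj ab].
- by rewrite subr0.
- by rewrite Bba sub0r opprK.
- rewrite subr0; move: Bba; rewrite ab => /eqP.
  by rewrite -addr_eq0 -mulr2n mulrn_eq0 /= => /eqP.
Qed.

(** Only the skew part of a direction matters, so the Jacobian has the rank of its restriction to
    the space of skew families, spanned by the r * 'C(n, 2) rows of [E]. Each independent kernel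
    direction in that space lowers the bound by one. *)
Lemma rank_le_ker X c (B : 'I_c -> nat -> 'M[F]_n) :
  (forall i j, (B i j)^T = - B i j) ->
  (forall i, tang (skewize X) (B i) r = 0) ->
  (forall u : 'I_c -> F, (forall j, (j < r)%N -> \sum_i u i *: B i j = 0) ->
     forall i, u i = 0) ->
  (\rank (Jac prodmap (param X)) <= r * 'C(n, 2) - c)%N.
Proof.
move=> sB tB free; rewrite -mxrank_tr; set J := (Jac _ _)^T.
have JskewE B' : (forall j, (B' j)^T = - B' j) ->
    encode B' *m J = 2%:R *: mxvec (tang (skewize X) B' r).
  move=> sB'; rewrite Jac_prodmap -linearZ; congr mxvec; rewrite -tangZ.
  by apply: eq_tang => // l _; rewrite /skewize sB' opprK scaler_nat mulr2n.
have JE : (J <= E *m J)%MS.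
  apply/row_subP => k; rewrite rowE; have [V <-] := encode_surj (delta_mx 0 k).
  have -> : encode V *m J = 2%:R^-1 *: (encode (skewize V) *m J).
    rewrite (JskewE (skewize V)) ?Jac_prodmap ?scalerA ?mulVf ?scale1r ?pnatr_eq0 // => j.
    by rewrite /skewize raddfB /= trmxK opprB.
  apply: scalemx_sub; rewrite encode_skew -?mulmxA ?submxMl // => j.
  by rewrite /skewize raddfB /= trmxK opprB.
pose L : 'M[F]_(c, #|T|) := \matrix_(i < c) skew_coords (B i).
have LEJ : (L <= kermx (E *m J))%MS.
  apply/sub_kermxP/row_matrixP => i; rewrite row_mul rowK row0 mulmxA -encode_skew //.
  by rewrite JskewE // tB linear0 scaler0.
have freeL : row_free L.
  rewrite -kermx_eq0; apply/rowV0P => u /sub_kermxP uL; apply/rowP => i.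
  rewrite [RHS]mxE; apply: (free (u 0)) => j jr.
  pose C j' := \sum_i u 0 i *: B i j'.
  have sC j' : (C j')^T = - C j'.
    by rewrite /C raddf_sum -sumrN; apply: eq_bigr => l _; rewrite /= linearZ /= sB scalerN.
  have CE : encode C = 0.
    rewrite encode_skew //; have -> : skew_coords C = u *m L; last by rewrite uL mul0mx.
    apply/rowP => t; rewrite [LHS]mxE [RHS]mxE /C /= summxE.
    by apply: eq_bigr => l _; rewrite !mxE.
  apply/matrixP => a b; rewrite -[LHS](param_entry C (Ordinal jr)) /param CE !mxE; by [].
have cardT : #|T| = (r * 'C(n, 2))%N by rewrite cardsX cardsT card_ord card_skew_pairs.
apply: leq_trans (mxrankS JE) _; have := mxrankS LEJ; rewrite mxrank_ker.
by move: freeL; rewrite /row_free => /eqP ->; have := rank_leq_row (E *m J); rewrite -cardT; lia.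
Qed.

End ProductMap.

(** * Generic rank bounds, and one factor *)

Section MuDimension.
Local Open Scope classical_set_scope.
Variables (F : numFieldType) (n : nat).
Implicit Types (A B V X : nat -> 'M[F]_n) (Z M : 'M[F]_n).

Local Notation J r X := (Jac (@prodmap F n r) (param X)).

Lemma krull_mu r d X : (d <= \rank (J r X))%N ->
  zdense (fun y => (\rank (Jac (@prodmap F n r) y) <= d)%N) ->
  krull_dim (mu r (skew_mx F n)) d.
Proof. by move=> dX dns; rewrite /mu mu0_skewE; apply: krull_dim_polymap dX dns. Qed.

Lemma zdense_nonzero k (h : {mpoly F[k]}) (Q : ('I_k -> F) -> Prop) : h != 0 ->
  (forall x, h.@[x] != 0 -> Q x) -> zdense Q.
Proof.
move=> h0 hQ w w0; have /existsNP[x nx] : ~ forall x, (w * h).@[x] = 0.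
  by move=> /mpoly_infinite_eq0/eqP; rewrite mulf_eq0 (negPf w0) (negPf h0).
by move/eqP: nx; rewrite mevalM mulf_eq0 negb_or => /andP[wx /hQ]; exists x.
Qed.

Lemma zdense_all k (Q : ('I_k -> F) -> Prop) : (forall x, Q x) -> zdense Q.
Proof. by move=> HQ; apply: (@zdense_nonzero k 1) => //; rewrite oner_neq0. Qed.

Lemma skewize_half A : (forall i, (A i)^T = - A i) ->
  skewize (fun i => 2%:R^-1 *: A i) = A.
Proof.
move=> sA; apply: funext => i; rewrite /skewize linearZ /= sA scalerN opprK -scalerDl.
by rewrite -mulr2n -[_ *+ 2]mulr_natr mulVf ?scale1r // pnatr_eq0.
Qed.

Lemma rank_ge_skew r A (I : finType) (C : I -> 'M[F]_n) :
  (forall i, (A i)^T = - A i) ->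
  (forall Z, ann A r Z -> (forall i, \tr (C i *m Z) = 0) -> Z = 0) ->
  (n * n - #|I| <= \rank (J r (fun i => (2%:R^-1 *: A i)%R)))%N.
Proof. by move=> sA inj; apply: (rank_ge_ann (C := C)); rewrite skewize_half. Qed.

Lemma tang_scale A (b : nat -> F) r :
  tang A (fun i => b i *: A i) r = (\sum_(i < r) b i) *: prodm A r.
Proof.
elim: r => [|r IH] /=; first by rewrite big_ord0 scale0r.
by rewrite IH big_ord_recr /= scalerDl scalemxAl scalemxAr.
Qed.

(** Scalars of product 1 can be distributed over the factors without changing the product. Rescaling
    factor i + 1 against factor 0 gives r - 1 kernel directions, independent because the factors are
    nonzero. The bound is attained for n = 2, and for n = 3 with r = 3, where it is 9 - 2. *)
Lemma rank_le_scale r X : (forall j, (j < r)%N -> skewize X j != 0) ->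
  (\rank (J r X) <= r * 'C(n, 2) - r.-1)%N.
Proof.
move=> nz; pose b (i : 'I_r.-1) (j : nat) : F := (j == i.+1)%:R - (j == 0)%:R.
apply: (rank_le_ker (B := fun i j => b i j *: skewize X j)).
- by move=> i j; rewrite linearZ /= /skewize raddfB /= trmxK -scalerN opprB.
- move=> i; rewrite tang_scale; case: r i {nz} @b => [[]//|r] i b.
  rewrite (bigD1 ord0) //= (bigD1 (lift ord0 i)) //= big1 ?addr0.
    by rewrite /b /= eqxx sub0r subr0 addNr scale0r.
  move=> j /andP[j0 ji]; rewrite /b; move: j0 ji; rewrite -!val_eqE /= => /negPf -> /negPf.
  by rewrite /bump /= add1n => ->; rewrite subrr.
- move=> u H i; have ir : (i.+1 < r)%N by have := ltn_ord i; lia.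
  have := H i.+1 ir; rewrite (bigD1 i) //= big1 ?addr0.
    rewrite /b eqxx subr0 scale1r => /eqP; rewrite scaler_eq0 (negPf (nz _ ir)) orbF.
    by move/eqP.
  move=> l /negPf li; rewrite /b /= eqSS subr0.
  by rewrite eq_sym val_eqE li scale0r scaler0.
Qed.

Lemma zdense_rank_scale r : (1 < n)%N ->
  zdense (fun y => (\rank (Jac (@prodmap F n r) y) <= r * 'C(n, 2) - r.-1)%N).
Proof.
move=> n1; pose a : 'I_n := Ordinal (ltnW n1); pose b : 'I_n := Ordinal n1.
apply: (@zdense_nonzero _ (\prod_(i < r) skewize (@varmx F n r) i a b)).
  apply/prodf_neq0 => i _; apply/eqP => /(congr1 (meval (param (fun=> delta_mx a b : 'M[F]_n)))).
  rewrite meval0 => H; have := meval_skewize (fun=> delta_mx a b : 'M[F]_n) (ltn_ord i).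
  move/matrixP/(_ a b); rewrite [LHS]mxE H /skewize trmx_delta !mxE !eqxx /= subr0 => /esym/eqP.
  by rewrite oner_eq0.
move=> x; have [X <-] := param_surj x; rewrite rmorph_prod => /prodf_neq0 nz.
apply: rank_le_scale => j jr; have := nz (Ordinal jr) isT; apply: contraNneq => X0.
have /matrixP/(_ a b) := meval_skewize X jr; rewrite X0 [LHS]mxE [RHS]mxE => H.
exact/eqP.
Qed.

Lemma det_skew_odd M : odd n -> M^T = - M -> \det M = 0.
Proof.
move=> on sM; have := det_tr M; rewrite sM -scaleN1r detZ -signr_odd on expr1 mulN1r.
move/eqP; rewrite eq_sym -addr_eq0 -mulr2n mulrn_eq0 /= => /eqP //.
Qed.

Lemma zdense_rank_odd r : odd n -> (0 < r)%N ->
  zdense (fun y => (\rank (Jac (@prodmap F n r) y) <= n ^ 2 - 1)%N).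
Proof.
move=> on; case: r => // r _; apply: zdense_all => x.
pose G : 'M[{mpoly F[n * n]}]_n := \matrix_(a, b) 'X_(mxvec_index a b).
have Gev M : mxeval (\det G) M = \det M.
  rewrite /mxeval -det_map_mx; congr (\det _); apply/matrixP => a b.
  by rewrite !mxE /= mevalXU mxvecE.
apply: (@rank_hypersurface F n _ _ (\det G)).
  apply/eqP => G0; have := Gev 1%:M; rewrite G0 det1 /mxeval meval0 => /esym/eqP.
  by rewrite oner_eq0.
move=> y; have [Y <-] := param_surj y; rewrite polymap_prodmap Gev /= det_mulmx.
by rewrite [X in _ * X]det_skew_odd ?mulr0 // /skewize raddfB /= trmxK opprB.
Qed.

Lemma zdense_rank_full r :
  zdense (fun y => (\rank (Jac (@prodmap F n r) y) <= n ^ 2)%N).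
Proof. by apply: zdense_all => x; rewrite -mulnn rank_leq_row. Qed.

(** For one factor the annihilator is the space of symmetric matrices whatever the point, so the
    zero family already has the required rank. The forms read the entries on and above the
    diagonal. *)
Lemma dim_mu1 : (1 < n)%N -> krull_dim (mu 1 (skew_mx F n)) 'C(n, 2).
Proof.
move=> n1; pose I := {p : 'I_n * 'I_n | (p.1 <= p.2)%N}.
have cardI : (n * n - #|{: I}| = 'C(n, 2))%N.
  rewrite card_sig -(card_skew_pairs n).
  have := cardC [pred p : 'I_n * 'I_n | (p.1 <= p.2)%N].
  rewrite card_prod card_ord => <-; rewrite addKn.
  pose sw (p : 'I_n * 'I_n) := (p.2, p.1).
  have swK : cancel sw sw by case.
  rewrite -(card_imset _ (can_inj swK)); apply: eq_card => p.
  rewrite inE /= -ltnNge; apply/idP/imsetP => [pp|[q qq ->]]; last by rewrite inE in qq.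
  by exists (sw p); rewrite ?swK // inE.
apply: (krull_mu (X := fun=> 2%:R^-1 *: 0)); last first.
  move=> w /(@zdense_rank_scale 1 n1)[x rx wx]; exists x => //.
  by apply: leq_trans rx _; rewrite subn0 mul1n.
rewrite -{1}cardI.
pose C (i : I) : 'M[F]_n := delta_mx (val i).2 (val i).1.
apply: (rank_ge_skew (A := fun=> 0) (C := C)); first by move=> _; rewrite trmx0 oppr0.
move=> Z [_]; rewrite mulmx1 => sZ CZ.
have Z0 (a b : 'I_n) : (a <= b)%N -> Z a b = 0.
  by move=> ab; rewrite -(CZ (Sub (a, b) ab)) /C /= mxtrace_mulC mxtrace_mul_delta.
apply/matrixP => a b; rewrite [RHS]mxE; have [ab|ba] := leqP a b; first exact: Z0.
by rewrite -sZ mxE Z0 // ltnW.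
Qed.

End MuDimension.

(** * Symplectic normal forms, and size 2 *)

Section Blocks.
Variables (R : comNzRingType) (m : nat).
Implicit Types (T : 'M[R]_(m + m)) (d : 'rV[R]_m).

Definition symplectic_mx d : 'M[R]_(m + m) := block_mx 0 (diag_mx d) (- diag_mx d) 0.
Local Notation J := (symplectic_mx (const_mx 1)).

Lemma diag_mx_const1 : diag_mx (const_mx 1 : 'rV[R]_m) = 1%:M.
Proof. by rewrite diag_const_mx. Qed.

Lemma symplectic_skew d : (symplectic_mx d)^T = - symplectic_mx d.
Proof. by rewrite tr_block_mx opp_block_mx !trmx0 oppr0 linearN /= tr_diag_mx opprK. Qed.

Lemma mul_symplectic d e : symplectic_mx d *m symplectic_mx e =
  block_mx (- (diag_mx d *m diag_mx e)) 0 0 (- (diag_mx d *m diag_mx e)).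
Proof.
by rewrite mulmx_block !mul0mx !mulmx0 !add0r !addr0 mulmxN mulNmx.
Qed.

Lemma mulJJ : J *m J = - 1%:M.
Proof.
by rewrite mul_symplectic diag_mx_const1 mulmx1 -[in LHS]oppr0 -opp_block_mx -scalar_mx_block.
Qed.

Lemma sym_mulJl T : (J *m T)^T = J *m T -> (T *m J)^T = T *m J.
Proof.
move=> JT; have TJ : T *m J = J *m (J *m T) *m J^T.
  by rewrite !mulmxA mulJJ symplectic_skew mulmxN !mulNmx opprK mul1mx.
by rewrite TJ trmx_mul trmxK [(J *m (J *m T))^T]trmx_mul JT !mulmxA.
Qed.

End Blocks.

Section Torus.
Variables (F : fieldType) (m : nat).
Implicit Types (T : 'M[F]_(m + m)) (d : 'rV[F]_m).
Local Notation J := (symplectic_mx (const_mx 1)).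

Lemma comm_diag_mx d (M : 'M[F]_m) : injective (d 0) ->
  M *m diag_mx d = diag_mx d *m M -> M = diag_mx (\row_i M i i).
Proof.
move=> dI /matrixP comm; apply/matrixP => i j; rewrite !mxE.
have := comm i j; rewrite mul_mx_diag mul_diag_mx !mxE.
have [-> _|ij] := eqVneq i j; first by rewrite mulr1n.
move/eqP; rewrite mulrC -subr_eq0 -mulrBl mulf_eq0 subr_eq0 mulr0n.
by case/orP => [/eqP/dI /eqP|/eqP //]; rewrite eq_sym (negPf ij).
Qed.

(** Symmetry of T J makes the off-diagonal blocks b and c symmetric and the last block - a^T.
    Symmetry of the other product then makes a, b and c commute with [diag_mx d], whose entries are
    distinct. The result is sl_2^m, with t_i = [[a_i, b_i], [c_i, - a_i]]. *)
Lemma symplectic_torus d T : injective (d 0) ->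
  (T *m J)^T = T *m J -> (T *m symplectic_mx d)^T = T *m symplectic_mx d ->
  exists a b c, T = block_mx (diag_mx a) (diag_mx b) (diag_mx c) (- diag_mx a).
Proof.
move=> dI; rewrite -[T]submxK; move: (ulsubmx T) (ursubmx T) (dlsubmx T) (drsubmx T).
move=> a b c e; rewrite /symplectic_mx !mulmx_block !mulmx0 !add0r !addr0 diag_mx_const1.
rewrite !mulmxN !mulmx1 !tr_block_mx.
case/eq_block_mx; rewrite !linearN /= => /oppr_inj bT eT aT cT.
case/eq_block_mx; rewrite !trmx_mul tr_diag_mx bT cT => /oppr_inj db ad _ dc.
have ad' : a *m diag_mx d = diag_mx d *m a by rewrite -ad -eT mulmxN.
exists (\row_i a i i), (\row_i b i i), (\row_i c i i).
rewrite -(comm_diag_mx dI ad') -(comm_diag_mx dI (esym db)) -(comm_diag_mx dI (esym dc)).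
congr block_mx; rewrite -[LHS]opprK -aT (comm_diag_mx dI ad') tr_diag_mx.
by congr (- diag_mx _); apply/rowP => i; rewrite !mxE eqxx mulr1n.
Qed.

End Torus.

Section LowProducts.
Variable F : numFieldType.

Definition natrow m : 'rV[F]_m := \row_i (i.+1)%:R.

Lemma natrow_inj m : injective (natrow m 0).
Proof. by move=> i j; rewrite !mxE => /eqP; rewrite eqr_nat eqSS => /eqP/val_inj. Qed.

Lemma unit_prodm n (A : nat -> 'M[F]_n) r :
  (forall i, (i < r)%N -> A i \in unitmx) -> prodm A r \in unitmx.
Proof.
elim: r => [|r IH] uA /=; first exact: unitmx1.
by rewrite unitmx_mul IH ?uA // => i /ltnW/uA.
Qed.

Lemma unit_symplectic m (d : 'rV[F]_m) : (forall i, d 0 i != 0) ->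
  symplectic_mx d \in unitmx.
Proof.
move=> d0; pose e : 'rV[F]_m := \row_i - (d 0 i)^-1.
have /mulmx1_unit[] // : symplectic_mx d *m symplectic_mx e = 1%:M.
rewrite mul_symplectic (scalar_mx_block m m 1).
suff -> : diag_mx d *m diag_mx e = - 1%:M by rewrite opprK.
rewrite mulmx_diag; apply/matrixP => i j; rewrite !mxE.
by case: eqP => [->|_]; rewrite ?mulrN ?divff ?mulr0n ?oppr0.
Qed.

(** Euler's relation: in the direction of the point itself, the tangent vector is r times the
    product. *)
Lemma rank_ge1 n r (A : nat -> 'M[F]_n) : (0 < r)%N -> (forall i, (A i)^T = - A i) ->
  prodm A r != 0 ->
  (1 <= \rank (Jac (@prodmap F n r) (param (fun i => 2%:R^-1 *: A i))))%N.
Proof.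
move=> r0 sA P0; rewrite lt0n mxrank_eq0; apply: contra P0 => /eqP J0.
have := Jac_prodmap r (fun i => 2%:R^-1 *: A i) (fun i => 2%:R^-1 *: A i).
rewrite J0 trmx0 mulmx0 skewize_half // => /esym/eqP.
have -> : tang A A r = tang A (fun i => 1 *: A i) r.
  by apply: eq_tang => // i _; rewrite scale1r.
rewrite tang_scale sumr_const card_ord mxvec_eq0 scaler_eq0 pnatr_eq0.
by rewrite eqn0Ngt r0.
Qed.

Lemma dim_mu_n2 r : (0 < r)%N -> krull_dim (mu r (skew_mx F 2)) 1.
Proof.
move=> r0; pose J : 'M[F]_(1 + 1) := symplectic_mx (const_mx 1).
have uJ : J \in unitmx by apply: unit_symplectic => i; rewrite mxE oner_neq0.
apply: (krull_mu (X := fun=> 2%:R^-1 *: J)); last first.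
  move=> w /(@zdense_rank_scale F 2 r isT)[x rx wx]; exists x => //.
  by apply: leq_trans rx _; rewrite binn; lia.
apply: (rank_ge1 (A := fun=> J)) => // [_|]; first exact: symplectic_skew.
have : prodm (fun=> J) r \in unitmx by apply: unit_prodm.
by apply: contraTneq => ->; rewrite unitmxE det0 unitr0.
Qed.

End LowProducts.

(** * Two factors *)

Section Alternating.
Variables (R : comNzRingType) (n : nat).
Implicit Types (A B : 'M[R]_n).

(** The word A (B A)^k. Being a palindrome of odd length, it is skew whenever A and B are. *)
Fixpoint altmx A B k : 'M[R]_n := if k is k'.+1 then altmx A B k' *m B *m A else A.

Lemma altmxSl A B k : A *m B *m altmx A B k = altmx A B k *m B *m A.
Proof. by elim: k => [|k IH] /=; rewrite ?mulmxA ?IH. Qed.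

Lemma altmx_swap A B k : A *m altmx B A k = altmx A B k *m B.
Proof. by elim: k => //= k IH; rewrite !mulmxA IH. Qed.

Lemma altmx_skew A B k : A^T = - A -> B^T = - B -> (altmx A B k)^T = - altmx A B k.
Proof.
move=> sA sB; elim: k => //= k IH.
by rewrite !trmx_mul IH sA sB !(mulNmx, mulmxN, opprK) mulmxA altmxSl.
Qed.

End Alternating.

Lemma map_altmx (R S : comNzRingType) (f : {rmorphism R -> S}) n (A B : 'M[R]_n) k :
  map_mx f (altmx A B k) = altmx (map_mx f A) (map_mx f B) k.
Proof. by elim: k => //= k IH; rewrite !map_mxM IH. Qed.

Section TwoFactors.
Variable F : numFieldType.

Local Notation Jac2 n := (Jac (@prodmap F n 2)).

(* The fibre of (A, B) |-> A B contains (A p(B A), p(B A)^-1 B) for every polynomial p;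
   its tangent directions are A (B A)^k and - (B A)^k B. *)
Lemma zdense_rank_two n m (e f : 'I_m -> 'I_n) (A B : 'M[F]_n) :
  A^T = - A -> B^T = - B ->
  \det (\matrix_(k < m, i < m) altmx A B k (e i) (f i)) != 0 ->
  zdense (fun y => (\rank (Jac2 n y) <= 2 * 'C(n, 2) - m)%N).
Proof.
move=> sA sB nz; pose G := skewize (@varmx F n 2).
(* The determinant of the hypothesis, taken on generic skew matrices. It is a nonzero polynomial
   since it is nonzero at (A, B), and off its zeros the m kernel directions are independent. *)
pose h := \det (\matrix_(k < m, i < m) altmx (G 0%N) (G 1%N) k (e i) (f i)).
have hE X : h.@[param X] =
    \det (\matrix_(k < m, i < m) altmx (skewize X 0) (skewize X 1) k (e i) (f i)).
  rewrite /h -det_map_mx; congr (\det _); apply/matrixP => k i.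
  rewrite [LHS]mxE [in LHS]mxE [RHS]mxE -(meval_skewize X (isT : (0 < 2)%N)).
  by rewrite -(meval_skewize X (isT : (1 < 2)%N)) -map_altmx [RHS]mxE.
apply: (@zdense_nonzero _ _ h).
  apply: contraNneq nz => h0; pose X i := 2%:R^-1 *: (if i == 0%N then A else B).
  have := hE X; rewrite h0 meval0 skewize_half => [/= <- //|i]; by case: ifP.
move=> x; have [X <-] := param_surj x; rewrite hE => hX.
have sX i : (skewize X i)^T = - skewize X i by rewrite /skewize raddfB /= trmxK opprB.
pose D (k : 'I_m) (j : nat) : 'M[F]_n := if j == 0%N then altmx (skewize X 0) (skewize X 1) k
  else - altmx (skewize X 1) (skewize X 0) k.
apply: (rank_le_ker (B := D)).
- by move=> k j; rewrite /D; case: ifP => _; rewrite ?linearN /= altmx_skew.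
- by move=> k; rewrite /D /= mul0mx add0r !mul1mx mulmxN altmx_swap subrr.
- move=> u H; have := H 0%N isT; rewrite /D /= => H0.
  set M := \matrix_(k, i) _ in hX.
  have uM : (\row_k u k) *m M = 0.
    apply/rowP => i; rewrite [RHS]mxE.
    have /matrixP/(_ (e i) (f i)) := H0; rewrite summxE [RHS]mxE => E0.
    by rewrite -[RHS]E0 mxE; apply: eq_bigr => k _; rewrite !mxE.
  have uM1 : M \in unitmx by rewrite unitmxE unitfE.
  move=> k; have /rowP/(_ k) : (\row_k u k) = 0 by rewrite -[LHS](mulmxK uM1) uM mul0mx.
  by rewrite !mxE.
Qed.

Lemma altmx_symplectic m (d : 'rV[F]_m) k :
  altmx (symplectic_mx (const_mx 1)) (symplectic_mx d) k
  = symplectic_mx (\row_i (- d 0 i) ^+ k).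
Proof.
elim: k => [|k IH] /=.
  by congr symplectic_mx; apply/rowP => i; rewrite !mxE.
rewrite IH -mulmxA mul_symplectic diag_mx_const1 mulmx1 -linearN /=.
rewrite /symplectic_mx mulmx_block !mul0mx !mulmx0 !add0r !addr0 mulNmx mulmx_diag.
by congr (block_mx _ (diag_mx _) (- diag_mx _) _); apply/rowP => i; rewrite !mxE exprSr.
Qed.

Lemma vandermonde_neq0 m (a : 'rV[F]_m) : injective (a 0) ->
  \det (\matrix_(k < m, i < m) a 0 i ^+ k) != 0.
Proof.
move=> aI; rewrite (_ : \matrix_(k, i) _ = Vandermonde m a) ?det_Vandermonde //.
apply/prodf_neq0 => i _; apply/prodf_neq0 => j ij; rewrite subr_eq0.
by apply: contraTneq ij => /aI ->; rewrite ltnn.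
Qed.

Lemma natrow_opp_inj m : injective ((- natrow F m) 0).
Proof. by move=> i j; rewrite !mxE => /oppr_inj /eqP; rewrite eqr_nat eqSS => /eqP/val_inj. Qed.

Lemma diag_mx_eq0 m (x : 'rV[F]_m) : (forall i, x 0 i = 0) -> diag_mx x = 0.
Proof. by move=> x0; apply/matrixP => i j; rewrite !mxE x0 mul0rn. Qed.

(** At the point ([symplectic_mx d], J) the annihilator lies in sl_2^m, which has dimension 3 m. For
    the upper bound, the words in J and [symplectic_mx d] have diagonal entries (- d_i)^k, so their
    independence is a Vandermonde determinant. Both bounds are 4 m^2 - 3 m. *)
Lemma dim_mu2_even m : krull_dim (mu 2 (skew_mx F (m + m))) (2 * 'C(m + m, 2) - m)%N.
Proof.
pose d := natrow F m; pose J := symplectic_mx (const_mx 1 : 'rV[F]_m).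
pose A i := if i == 0%N then symplectic_mx d else J.
have sA i : (A i)^T = - A i by rewrite /A; case: ifP => _; apply: symplectic_skew.
apply: (krull_mu (X := fun i => 2%:R^-1 *: A i)).
  pose C (p : 'I_3 * 'I_m) : 'M[F]_(m + m) := match val p.1 with
    | 0 => delta_mx (lshift m p.2) (lshift m p.2)
    | 1 => delta_mx (rshift m p.2) (lshift m p.2)
    | _ => delta_mx (lshift m p.2) (rshift m p.2) end.
  have cardI : ((m + m) * (m + m) - #|{: 'I_3 * 'I_m}| = 2 * 'C(m + m, 2) - m)%N.
    by rewrite card_prod !card_ord bin2 -?divn2; nia.
  rewrite -cardI; apply: (rank_ge_skew (C := C)) => // Z; rewrite /= !mulmx1 !mul1mx.
  move=> [[_ sJZ] sZD] CZ.
  have [a [b [c ZE]]] := symplectic_torus (@natrow_inj F m) (sym_mulJl sJZ) sZD.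
  have Z_entry i : a 0 i = 0 /\ b 0 i = 0 /\ c 0 i = 0.
    split; last split.
    - have := CZ (inord 0, i); rewrite /C /= inordK // mxtrace_mulC mxtrace_mul_delta.
      by rewrite ZE block_mxEul mxE eqxx.
    - have := CZ (inord 1, i); rewrite /C /= inordK // mxtrace_mulC mxtrace_mul_delta.
      by rewrite ZE block_mxEur mxE eqxx.
    - have := CZ (inord 2, i); rewrite /C /= inordK // mxtrace_mulC mxtrace_mul_delta.
      by rewrite ZE block_mxEdl mxE eqxx.
  rewrite ZE !diag_mx_eq0 ?oppr0 ?block_mx0 // => i; by case: (Z_entry i) => [? []].
apply: (zdense_rank_two (e := @lshift m m) (f := @rshift m m) (A := J) (B := symplectic_mx d)).
- exact: symplectic_skew.
- exact: symplectic_skew.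
rewrite (_ : \matrix_(k, i) _ = \matrix_(k < m, i < m) (- d) 0 i ^+ k).
  exact/vandermonde_neq0/natrow_opp_inj.
by apply/matrixP => k i; rewrite !mxE altmx_symplectic block_mxEur !mxE eqxx mulr1n.
Qed.

Lemma pad_skew p (M : 'M[F]_p) : M^T = - M ->
  (block_mx M 0 0 (0 : 'M_1))^T = - block_mx M 0 0 (0 : 'M_1).
Proof. by move=> sM; rewrite tr_block_mx opp_block_mx sM !trmx0 !oppr0. Qed.

Lemma altmx_pad p (M N : 'M[F]_p) k :
  altmx (block_mx M 0 0 (0 : 'M_1)) (block_mx N 0 0 0) k = block_mx (altmx M N k) 0 0 0.
Proof.
elim: k => //= k ->.
by rewrite !mulmx_block !(mulmx0, mul0mx, addr0).
Qed.

(** The added row and column are zero in both factors. The borders of Z vanish because J and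
    [symplectic_mx d] are invertible, but its corner is free: one dimension more than in even size,
    read by the form at [None]. *)
Lemma dim_mu2_odd m :
  krull_dim (mu 2 (skew_mx F (m + m + 1))) (2 * 'C(m + m + 1, 2) - m)%N.
Proof.
pose d := natrow F m; pose J := symplectic_mx (const_mx 1 : 'rV[F]_m).
have uJ : J \in unitmx by apply: unit_symplectic => i; rewrite mxE oner_neq0.
have uD : symplectic_mx d \in unitmx by apply: unit_symplectic => i; rewrite mxE pnatr_eq0.
pose pad (M : 'M[F]_(m + m)) := block_mx M 0 0 (0 : 'M_1).
pose A i := pad (if i == 0%N then symplectic_mx d else J).
have sA i : (A i)^T = - A i.
  by apply: pad_skew; case: ifP => _; apply: symplectic_skew.
apply: (krull_mu (X := fun i => 2%:R^-1 *: A i)).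
  pose L i : 'I_(m + m + 1) := lshift 1 (lshift m i).
  pose R i : 'I_(m + m + 1) := lshift 1 (rshift m i).
  pose C (o : option ('I_3 * 'I_m)) : 'M[F]_(m + m + 1) :=
    if o is Some p then match val p.1 with
      | 0 => delta_mx (L p.2) (L p.2)
      | 1 => delta_mx (R p.2) (L p.2)
      | _ => delta_mx (L p.2) (R p.2) end
    else delta_mx (rshift _ 0) (rshift _ 0).
  have cardI : ((m + m + 1) * (m + m + 1) - #|{: option ('I_3 * 'I_m)}|
      = 2 * 'C(m + m + 1, 2) - m)%N.
    by rewrite card_option card_prod !card_ord bin2 -?divn2; nia.
  rewrite -cardI; apply: (rank_ge_skew (C := C)) => // Z; rewrite /= !mulmx1 !mul1mx.
  rewrite -[Z]submxK; move: (ulsubmx Z) (ursubmx Z) (dlsubmx Z) (drsubmx Z) => Z0 z y w.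
  rewrite !mulmx_block !(mulmx0, mul0mx, addr0) !tr_block_mx !trmx0.
  move=> [[_ /eq_block_mx[sJZ /esym Jz0 _ _]] /eq_block_mx[sZD _ yD0 _]] CZ.
  have z0 : z = 0 by rewrite -[z](mulKmx uJ) Jz0 mulmx0.
  have y0 : y = 0 by rewrite -[y](mulmxK uD) -yD0 mul0mx.
  have [a [b [c ZE]]] := symplectic_torus (@natrow_inj F m) (sym_mulJl sJZ) sZD.
  have w0 : w = 0.
    apply/matrixP => i j; rewrite !ord1 mxE; have := CZ None.
    by rewrite /C mxtrace_mulC mxtrace_mul_delta block_mxEdr.
  have Z_entry i : a 0 i = 0 /\ b 0 i = 0 /\ c 0 i = 0.
    split; last split.
    - have := CZ (Some (inord 0, i)); rewrite /C /= inordK // mxtrace_mulC mxtrace_mul_delta.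
      by rewrite block_mxEul ZE block_mxEul mxE eqxx.
    - have := CZ (Some (inord 1, i)); rewrite /C /= inordK // mxtrace_mulC mxtrace_mul_delta.
      by rewrite block_mxEul ZE block_mxEur mxE eqxx.
    - have := CZ (Some (inord 2, i)); rewrite /C /= inordK // mxtrace_mulC mxtrace_mul_delta.
      by rewrite block_mxEul ZE block_mxEdl mxE eqxx.
  rewrite z0 y0 w0 ZE !diag_mx_eq0 ?oppr0 ?block_mx0 // => i; by case: (Z_entry i) => [? []].
apply: (zdense_rank_two (e := fun i => lshift 1 (@lshift m m i))
  (f := fun i => lshift 1 (@rshift m m i)) (A := pad J) (B := pad (symplectic_mx d))).
- exact/pad_skew/symplectic_skew.
- exact/pad_skew/symplectic_skew.
rewrite (_ : \matrix_(k, i) _ = \matrix_(k < m, i < m) (- d) 0 i ^+ k).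
  exact/vandermonde_neq0/natrow_opp_inj.
apply/matrixP => k i; rewrite !mxE altmx_pad block_mxEul altmx_symplectic.
by rewrite block_mxEur !mxE eqxx mulr1n.
Qed.

End TwoFactors.

(** * Odd size *)

Section OddStep.
Variables (F : numFieldType) (n : nat) (A : nat -> 'M[F]_n) (p q : 'I_n) (D : 'M[F]_n).
Hypothesis sD : D^T = - D.
Hypothesis kerD : forall x : 'rV[F]_n, x *m D = 0 <-> x = x 0 p *: delta_mx 0 p.

Local Notation d := (delta_mx 0 p : 'rV[F]_n).
Local Notation u := (delta_mx 0 q : 'rV[F]_n).

Definition corank1 r :=
  (forall Z, ann A r Z -> row p Z = 0 -> Z = 0) /\
  (forall (x : 'rV[F]_n) k, x *m prodm A r = k *: d -> x = x 0 q *: u).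

Lemma dD0 : d *m D = 0.
Proof. by apply/kerD; rewrite mxE !eqxx scale1r. Qed.

(** D Z is in the annihilator for r factors and its row p vanishes since d D = 0. So D Z = 0, and Z
    = d^T x. With M the product, symmetry of d^T (x M) makes x M a multiple of d, and the second
    clause of [corank1] makes x a multiple of u. *)
Lemma ann_corank1 r Z : A r = D -> corank1 r -> ann A r.+1 Z -> Z = Z p q *: delta_mx p q.
Proof.
move=> Ar [H1 H2] /= [aDZ sZM]; rewrite Ar in aDZ.
have DZ : D *m Z = 0 by apply: H1; rewrite // rowE mulmxA dD0 mul0mx.
pose x := row p Z.
have ZE : Z = d^T *m x.
  apply: trmx_inj; apply/row_matrixP => i; rewrite trmx_mul trmxK row_mul.
  have /kerD -> : row i Z^T *m D = 0.
    by rewrite -row_mul -[D]trmxK -trmx_mul sD mulNmx DZ oppr0 trmx0 row0.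
  by apply/rowP => j; rewrite !mxE big_ord1 !mxE.
have xM : x *m prodm A r = (x *m prodm A r) 0 p *: d.
  have sE : d^T *m (x *m prodm A r) = (x *m prodm A r)^T *m d.
    by rewrite mulmxA -ZE -sZM ZE -mulmxA trmx_mul trmxK.
  apply/rowP => j; have /matrixP/(_ p j) := sE; rewrite !mxE !big_ord1 !mxE !eqxx mul1r.
  by [].
rewrite {1}ZE (H2 _ _ xM) /x -scalemxAr trmx_delta mul_delta_mx; congr (_ *: _).
by rewrite mxE.
Qed.

Lemma corank1_step r : A r = D -> corank1 r -> corank1 r.+1.
Proof.
move=> Ar cr; split=> [Z aZ Zp|x k].
  rewrite (ann_corank1 Ar cr aZ).
  by have /rowP/(_ q) := Zp; rewrite !mxE => ->; rewrite scale0r.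
rewrite /= Ar mulmxA => xMD; have k0 : k = 0.
  have Dd : D *m d^T = 0 by rewrite -[D]trmxK sD -trmx_mul mulmxN dD0 oppr0 trmx0.
  have := congr1 (mulmx^~ d^T) xMD; rewrite /= -mulmxA Dd mulmx0 -scalemxAl trmx_delta.
  by rewrite mul_delta_mx => /matrixP/(_ 0 0); rewrite !mxE !eqxx mulr1.
by move: xMD; rewrite k0 scale0r => /kerD; case: cr => _; apply.
Qed.

Lemma corank1_iter r s : (forall i, (r <= i)%N -> A i = D) -> (r <= s)%N ->
  corank1 r -> corank1 s.
Proof.
move=> AD; elim: s => [|s IH]; first by rewrite leqn0 => /eqP ->.
rewrite leq_eqVlt => /predU1P[<- //|]; rewrite ltnS => rs cr.
exact: corank1_step (AD _ rs) (IH rs cr).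
Qed.

End OddStep.

Section OddBase.
Variables (F : numFieldType) (m : nat) (S : 'M[F]_m).
Hypothesis sS : S^T = - S.

Local Notation d := (natrow F m).
Local Notation J := (symplectic_mx (const_mx 1 : 'rV[F]_m)).
Local Notation JD := (symplectic_mx d).

Definition pad (M : 'M[F]_(m + m)) : 'M[F]_(m + m + 1) := block_mx M 0 0 (0 : 'M_1).

Lemma mul_pad M N : pad M *m pad N = pad (M *m N).
Proof. by rewrite /pad mulmx_block !(mulmx0, mul0mx, addr0). Qed.

(** The vector (- [ones_col], 1) spans the kernel of [third_factor]. Its nonzero entries in the
    first m places are what forces a = b = 0 in [ann_three]. *)
Definition ones_col : 'cV[F]_(m + m) := col_mx (const_mx 1) 0.
Definition third_block : 'M[F]_(m + m) := block_mx S (- 1%:M) 1%:M 0.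
Definition third_block_inv : 'M[F]_(m + m) := block_mx 0 1%:M (- 1%:M) S.
(* The annihilator is a line iff S has no zero column; for m = 1 the only choice is S = 0,
   whence the exceptional dimension for n = 3. *)
Definition third_factor : 'M[F]_(m + m + 1) :=
  block_mx third_block (third_block *m ones_col) (- (third_block *m ones_col)^T) 0.

Lemma mul_third_block_inv : third_block_inv *m third_block = 1%:M.
Proof.
rewrite mulmx_block !(mul0mx, mulmx0, mul1mx, mulmx1, mulNmx, mulmxN, addr0, add0r, opprK).
by rewrite addNr -scalar_mx_block.
Qed.

Lemma mul_third_block : third_block *m third_block_inv = 1%:M.
Proof. exact: (mulmx1C mul_third_block_inv). Qed.

Lemma third_block_skew : third_block^T = - third_block.
Proof. by rewrite tr_block_mx opp_block_mx sS !linearN /= !trmx1 trmx0 oppr0 opprK. Qed.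

Lemma third_factor_skew : third_factor^T = - third_factor.
Proof. by rewrite tr_block_mx opp_block_mx third_block_skew !linearN /= trmxK trmx0 oppr0 opprK. Qed.

Lemma unitJ : J \in unitmx.
Proof. by apply: unit_symplectic => i; rewrite mxE oner_neq0. Qed.

Lemma unitJD : JD \in unitmx.
Proof. by apply: unit_symplectic => i; rewrite mxE pnatr_eq0. Qed.

Lemma mulJDJ : JD *m J = - block_mx (diag_mx d) 0 0 (diag_mx d).
Proof. by rewrite mul_symplectic diag_mx_const1 mulmx1 opp_block_mx !oppr0. Qed.

Lemma pad_ann Y : (pad J *m Y)^T = pad J *m Y -> (Y *m pad JD)^T = Y *m pad JD ->
  exists a b c w, Y = block_mx (block_mx (diag_mx a) (diag_mx b) (diag_mx c) (- diag_mx a)) 0 0 w.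
Proof.
rewrite -[Y]submxK; move: (ulsubmx Y) (ursubmx Y) (dlsubmx Y) (drsubmx Y) => Z0 z y w.
rewrite !mulmx_block !(mulmx0, mul0mx, addr0) !tr_block_mx !trmx0.
move=> /eq_block_mx[sJZ /esym Jz0 _ _] /eq_block_mx[sZD _ yD0 _].
have -> : z = 0 by rewrite -[z](mulKmx unitJ) Jz0 mulmx0.
have -> : y = 0 by rewrite -[y](mulmxK unitJD) -yD0 mul0mx.
have [a [b [c ->]]] := symplectic_torus (@natrow_inj F m) (sym_mulJl sJZ) sZD.
by exists a, b, c, w.
Qed.

Variable A : nat -> 'M[F]_(m + m + 1).
Hypotheses (A0 : A 0%N = pad JD) (A1 : A 1%N = pad J) (A2 : A 2%N = third_factor).

(** The product of [third_factor] and Z is in the annihilator for two factors, so it is an element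
    of sl_2^m plus a corner. Its vanishing lower left border, rewritten through the skewness of
    [third_block], says that [ones_col]^T kills this element, whence a = b = 0. Inverting
    [third_block] recovers Z from c and w, and symmetry of Z times the first two factors leaves S
    diag (c) = 0. *)
Lemma ann_three Z : ann A 3 Z -> exists (c : 'rV[F]_m) (w : 'M_1),
  Z = block_mx (block_mx (diag_mx c) 0 (S *m diag_mx c) 0) (- (ones_col *m w)) 0 w
  /\ S *m diag_mx c = 0.
Proof.
rewrite /= !mulmx1 !mul1mx A0 A1 A2 => -[[[_ s1] s2] s3].
have [a [b [c [w]]]] := pad_ann s1 s2; move: s3; rewrite {s1 s2}.
rewrite -[Z]submxK; move: (ulsubmx Z) (ursubmx Z) (dlsubmx Z) (drsubmx Z) => Z0 z y w'.
rewrite mulmx_block !(mulmx0, mul0mx, addr0) mulmx_block !(mulmx0, mul0mx, addr0).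
rewrite tr_block_mx => /eq_block_mx[sZ yN _ _].
have y0 : y = 0.
  have uN : JD *m J \in unitmx by rewrite unitmx_mul unitJD unitJ.
  by rewrite -[y](mulmxK uN) -[y *m _]trmxK yN trmx0 mul0mx.
rewrite mulmx_block y0 !(mulmx0, mul0mx, addr0) => /eq_block_mx[].
rewrite -mulmxA -mulmxDr => CZ Cz cZ _.
have ab : a = 0 /\ b = 0.
  move: cZ; rewrite mulNmx trmx_mul third_block_skew mulmxN mulNmx opprK -mulmxA CZ.
  rewrite /ones_col tr_col_mx trmx0 trmx_const mul_row_block !mul0mx !addr0 => /eqP.
  rewrite row_mx_eq0 => /andP[/eqP a0 /eqP b0].
  split; apply/rowP => i; [move/rowP/(_ i): a0 | move/rowP/(_ i): b0].
    by rewrite mul_mx_diag !mxE mul1r.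
  by rewrite mul_mx_diag !mxE mul1r.
have zE : z = - (ones_col *m w').
  by apply/eqP; rewrite -addr_eq0 -[z + _]mul1mx -mul_third_block_inv -mulmxA Cz mulmx0.
case: ab CZ => -> -> CZ.
have Z0E : Z0 = block_mx (diag_mx c) 0 (S *m diag_mx c) 0.
  rewrite -[Z0]mul1mx -mul_third_block_inv -mulmxA CZ !linear0 mulmx_block.
  by rewrite !(mulmx0, mul0mx, mul1mx, mulNmx, addr0, add0r, oppr0).
exists c, w'; rewrite -Z0E -zE; split=> //.
move: sZ; rewrite mulJDJ mulmxN Z0E mulmx_block !(mulmx0, mul0mx, addr0, add0r).
rewrite linearN /= => /oppr_inj; rewrite tr_block_mx => /eq_block_mx[_ _ /esym SD _].
have uD : diag_mx d \in unitmx.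
  by rewrite unitmxE det_diag unitfE; apply/prodf_neq0 => i _; rewrite mxE pnatr_eq0.
by rewrite -[LHS](mulmxK uD) SD trmx0 mul0mx.
Qed.

(** The product ends with [third_factor], so it kills the column (- [ones_col], 1). As e does not, k
    = 0, and the upper left blocks that remain are invertible. *)
Lemma kernel_three (x : 'rV[F]_(m + m + 1)) (k : F) (e : 'rV[F]_(m + m + 1)) :
  x *m prodm A 3 = k *: e -> (e *m col_mx (- ones_col) 1%:M) 0 0 != 0 ->
  lsubmx x = 0.
Proof.
rewrite /= mul1mx A0 A1 A2 => xM ev.
have X0 : (third_block *m ones_col)^T *m ones_col = 0.
  have sX : ((third_block *m ones_col)^T *m ones_col)^T = - ((third_block *m ones_col)^T *m ones_col).
    by rewrite !trmx_mul !trmxK third_block_skew mulmxN mulNmx opprK mulmxA.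
  apply/matrixP => a b; rewrite !ord1 [RHS]mxE; have /matrixP/(_ 0 0) := sX.
  rewrite [LHS]mxE [RHS]mxE => /eqP.
  by rewrite -addr_eq0 -mulr2n mulrn_eq0 /= => /eqP.
have Mv : third_factor *m col_mx (- ones_col) 1%:M = 0.
  rewrite mul_block_col !mulmxN !mulmx1 addNr addr0 mulNmx opprK X0.
  by rewrite col_mx0.
have k0 : k = 0.
  have := congr1 (mulmx^~ (col_mx (- ones_col) 1%:M)) xM.
  rewrite /= -mulmxA -[_ *m third_factor *m _]mulmxA.
  rewrite Mv !mulmx0 -scalemxAl => /matrixP/(_ 0 0); rewrite [LHS]mxE [RHS]mxE => /esym/eqP.
  by rewrite mulf_eq0 (negPf ev) orbF => /eqP.
have uN : JD *m J \in unitmx by rewrite unitmx_mul unitJD unitJ.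
have uC : third_block \in unitmx by case: (mulmx1_unit mul_third_block).
move: xM; rewrite k0 scale0r -{1}[x]hsubmxK mul_pad /pad /third_factor.
move: (JD *m J) uN => N uN; rewrite mulmx_block mul_row_block !(mulmx0, mul0mx, addr0).
move/eqP; rewrite row_mx_eq0 => /andP[/eqP xC _].
by rewrite -[LHS](mulmxK uN) -[_ *m N](mulmxK uC) -[_ *m N *m third_block]mulmxA xC !mul0mx.
Qed.

End OddBase.

Section OddDimensions.
Variable F : numFieldType.

Lemma mul_delta_entry n (Z : 'M[F]_n) p q : \tr (delta_mx q p *m Z) = Z p q.
Proof. by rewrite mxtrace_mulC mxtrace_mul_delta. Qed.

Lemma lsub_last m (x : 'rV[F]_(m + 1)) : lsubmx x = 0 ->
  x = x 0 (rshift m 0) *: delta_mx 0 (rshift m 0).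
Proof.
move=> x0; apply/rowP => j; rewrite !mxE eqxx /=; case: (split_ordP j) => l ->.
  by rewrite eq_lrshift mulr0; have /rowP/(_ l) := x0; rewrite !mxE.
by rewrite ord1 eqxx mulr1.
Qed.

Lemma zdense_odd m r : (2 < r)%N ->
  zdense (fun y => (\rank (Jac (@prodmap F (m + m + 1) r) y) <= (m + m + 1) ^ 2 - 1)%N).
Proof.
by move=> r2; apply: zdense_rank_odd; [rewrite addn1 /= addnn odd_double | apply: ltn_trans r2].
Qed.

Definition odd_family m (S : 'M[F]_m) (D : 'M[F]_(m + m + 1)) (i : nat) :=
  match i with
  | 0 => pad (symplectic_mx (natrow F m))
  | 1 => pad (symplectic_mx (const_mx 1))
  | 2 => third_factor S
  | _ => D
  end.

Lemma odd_family_skew m (S : 'M[F]_m) D i : S^T = - S -> D^T = - D ->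
  (odd_family S D i)^T = - odd_family S D i.
Proof.
move=> sS sD; case: i => [|[|[|i]]] //=; [| |exact: third_factor_skew];
exact/pad_skew/symplectic_skew.
Qed.

Lemma rank_ge_corank1 m (S : 'M[F]_m) D p (q := rshift (m + m) 0) r :
  S^T = - S -> D^T = - D ->
  (forall x : 'rV[F]_(m + m + 1), x *m D = 0 <-> x = x 0 p *: delta_mx 0 p) ->
  corank1 (odd_family S D) p q 3 -> (3 < r)%N ->
  ((m + m + 1) ^ 2 - 1 <=
    \rank (Jac (@prodmap F (m + m + 1) r) (param (fun i => 2%:R^-1 *: odd_family S D i))))%N.
Proof.
move=> sS sD kerD c3; case: r => // r; rewrite ltnS => r3.
have cr : corank1 (odd_family S D) p q r.
  by apply: (corank1_iter sD kerD _ r3 c3) => -[|[|[|i]]].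
rewrite -mulnn -[X in (_ - X)%N](card_unit).
apply: (rank_ge_skew (C := fun=> delta_mx q p)) => [i|Z aZ CZ].
  exact: odd_family_skew.
have AD : odd_family S D r = D by case: r r3 {cr aZ} => [|[|[|r]]].
rewrite (ann_corank1 sD kerD AD cr aZ).
by have := CZ tt; rewrite mul_delta_entry => ->; rewrite scale0r.
Qed.

Lemma dim_mu_odd m r : (1 < m)%N -> (2 < r)%N ->
  krull_dim (mu r (skew_mx F (m + m + 1))) ((m + m + 1) ^ 2 - 1).
Proof.
(* The entries of S off the diagonal are 1 or - 1, so for m > 1 no column of S is zero. *)
move=> m1 r2; pose S : 'M[F]_m := \matrix_(i, j) ((i < j)%N%:R - (j < i)%N%:R).
have sS : S^T = - S by apply/matrixP => i j; rewrite !mxE opprB.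
pose D := pad (symplectic_mx (const_mx 1 : 'rV[F]_m)).
have sD : D^T = - D by exact/pad_skew/symplectic_skew.
pose q : 'I_(m + m + 1) := rshift (m + m) 0.
have kerD (x : 'rV[F]_(m + m + 1)) : x *m D = 0 <-> x = x 0 q *: delta_mx 0 q.
  have xD : x *m D = row_mx (lsubmx x *m symplectic_mx (const_mx 1)) 0.
    by rewrite -{1}[x]hsubmxK mul_row_block !(mulmx0, addr0).
  split=> [|xE].
    rewrite xD => /eqP; rewrite row_mx_eq0 => /andP[/eqP x0 _]; apply: lsub_last.
    by rewrite -[LHS](mulmxK (unitJ F m)) x0 mul0mx.
  have x0 : lsubmx x = 0 by rewrite xE; apply/rowP => j; rewrite !mxE eq_lrshift mulr0.
  by rewrite xD x0 mul0mx row_mx0.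
have Sc0 (c : 'rV[F]_m) : S *m diag_mx c = 0 -> c = 0.
  move=> Sc; apply/rowP => j; rewrite [RHS]mxE.
  have [i ij] : exists i : 'I_m, i != j.
    pose i0 : 'I_m := Ordinal (ltnW m1); pose i1 : 'I_m := Ordinal m1.
    by have [ji|ji] := eqVneq i0 j; [exists i1; rewrite -ji | exists i0].
  have /matrixP/(_ i j) := Sc; rewrite mul_mx_diag !mxE => /eqP; rewrite mulf_eq0.
  case/orP => [|/eqP //]; rewrite subr_eq0; case: (ltngtP i j) ij => [_|_|/val_inj ->].
  - by rewrite eqr_nat.
  - by rewrite eqr_nat.
  - by rewrite eqxx.
have Z0 Z : ann (odd_family S D) 3 Z -> Z q q = 0 -> Z = 0.
  move=> /(ann_three sS (erefl _) (erefl _) (erefl _))[c [w [-> /Sc0 ->]]].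
  rewrite block_mxEdr => w0; have -> : w = 0 by apply/matrixP => a b; rewrite !ord1 w0 mxE.
  by rewrite linear0 !mulmx0 oppr0 !block_mx0.
have c3 : corank1 (odd_family S D) q q 3.
  split=> [Z aZ /rowP/(_ q)|x k xM]; first by rewrite !mxE => /(Z0 Z aZ).
  apply: lsub_last; apply: (kernel_three sS (erefl _) (erefl _) (erefl _) xM).
  by rewrite -rowE mxE col_mxEd mxE eqxx oner_neq0.
move: r2; rewrite leq_eqVlt => /predU1P[<-|r3].
  apply: (krull_mu (X := fun i => 2%:R^-1 *: odd_family S D i)); last exact: zdense_odd.
  rewrite -mulnn -[X in (_ - X)%N](card_unit).
  apply: (rank_ge_skew (C := fun=> delta_mx q q)) => [i|Z aZ CZ].
    exact: odd_family_skew.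
  by apply: Z0 aZ _; have := CZ tt; rewrite mul_delta_entry.
apply: krull_mu (rank_ge_corank1 sS sD kerD c3 r3) (zdense_odd _).
by apply: ltnW.
Qed.

Lemma third_n3 (Z : 'M[F]_(1 + 1 + 1)) D : ann (odd_family (0 : 'M[F]_1) D) 3 Z ->
  (Z 0 0 = 0 -> Z (rshift 2 0) (rshift 2 0) = 0 -> Z = 0) /\ (row 0 Z = 0 -> Z = 0).
Proof.
have sS : (0 : 'M[F]_1)^T = - 0 by rewrite trmx0 oppr0.
move=> /(ann_three sS (erefl _) (erefl _) (erefl _))[c [w [ZE _]]].
have E00 : (0 : 'I_(1 + 1 + 1)) = lshift 1 (lshift 1 0) by apply/val_inj.
have Z0 : c 0 0 = 0 -> w 0 0 = 0 -> Z = 0.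
  move=> c0 w0.
  have -> : Z = block_mx (block_mx (diag_mx c) 0 (0 *m diag_mx c) 0) (- (ones_col F 1 *m w)) 0 w.
    exact: ZE.
  have -> : w = 0 by apply/matrixP => a b; rewrite !ord1 w0 mxE.
  rewrite diag_mx_eq0 => [|i]; last by rewrite ord1.
  by rewrite mulmx0 oppr0 mul0mx !block_mx0.
split=> [Z00 Zw|Zr].
  apply: Z0; last by rewrite -Zw ZE block_mxEdr.
  by rewrite -Z00 ZE E00 !block_mxEul mxE eqxx.
have Zr0 j : Z 0 j = 0 by have /rowP/(_ j) := Zr; rewrite !mxE.
apply: Z0.
  by rewrite -(Zr0 0) ZE E00 !block_mxEul mxE eqxx.
have := Zr0 (rshift 2 0); rewrite ZE E00 block_mxEur !mxE big_ord1 /ones_col.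
by rewrite (col_mxEu (const_mx 1 : 'cV[F]_1)) mxE mul1r => /eqP; rewrite oppr_eq0 => /eqP.
Qed.

Lemma dim_mu3_n3 : krull_dim (mu 3 (skew_mx F 3)) 7.
Proof.
have sS : (0 : 'M[F]_1)^T = - 0 by rewrite trmx0 oppr0.
have s0 : (0 : 'M[F]_(1 + 1 + 1))^T = - 0 by rewrite trmx0 oppr0.
apply: (krull_mu (X := fun i => 2%:R^-1 *: odd_family (0 : 'M[F]_1) 0 i)); last first.
  move=> w /(@zdense_rank_scale F 3 3 isT)[x rx wx]; exists x => //.
apply: leq_trans (rank_ge_skew (A := odd_family (0 : 'M[F]_1) 0)
  (C := fun b : bool => if b then delta_mx 0 0
  else delta_mx (rshift 2 0) (rshift 2 0) : 'M[F]_(1 + 1 + 1)) _ _).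
- by rewrite card_bool.
- by move=> i; apply: odd_family_skew.
move=> Z /third_n3[Z0 _] CZ; apply: Z0; first by rewrite -mul_delta_entry (CZ true).
by rewrite -mul_delta_entry (CZ false).
Qed.

Lemma dim_mu_n3 r : (3 < r)%N -> krull_dim (mu r (skew_mx F 3)) 8.
Proof.
have sS : (0 : 'M[F]_1)^T = - 0 by rewrite trmx0 oppr0.
(* For three factors the annihilator has the two parameters c and w. The kernel of D is the line of
   the first coordinate because row 0 of Z is (c, 0, - w) and sees both, while the last row sees
   only w. *)
pose D : 'M[F]_(1 + 1 + 1) := \matrix_(i, j)
  (((i == 1 :> nat) && (j == 2 :> nat))%:R - ((i == 2 :> nat) && (j == 1 :> nat))%:R).
have sD : D^T = - D by apply/matrixP => i j; rewrite !mxE opprB; congr (_%:R - _%:R); rewrite andbC.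
pose j1 : 'I_(1 + 1 + 1) := lift ord0 ord0; pose j2 : 'I_(1 + 1 + 1) := lift ord0 (lift ord0 ord0).
have kerD (x : 'rV[F]_(1 + 1 + 1)) : x *m D = 0 <-> x = x 0 0 *: delta_mx 0 0.
  have xD j : (x *m D) 0 j = x 0 j1 * (j == 2 :> nat)%:R - x 0 j2 * (j == 1 :> nat)%:R.
    by rewrite mxE !big_ord_recl big_ord0 !mxE /= !subr0 sub0r mulr0 add0r addr0 mulrN.
  split=> [xD0|xE].
    have x1 : x 0 j1 = 0 by have := xD j2; rewrite xD0 mxE /= mulr1 mulr0 subr0.
    have x2 : x 0 j2 = 0.
      by have /esym/eqP := xD j1; rewrite xD0 mxE /= mulr1 mulr0 sub0r oppr_eq0 => /eqP.
    apply/rowP => j; rewrite !mxE eqxx /=; case: (unliftP ord0 j) => [i|] ->; last first.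
      by rewrite mulr1.
    case: (unliftP ord0 i) => [l|] ->; last by rewrite [LHS]x1 mulr0.
    by rewrite ord1 [LHS]x2 mulr0.
  have x0 l : x 0 (lift ord0 l) = 0.
    by have /rowP/(_ (lift ord0 l)) := xE; rewrite [X in _ = X -> _]mxE [X in _ * X]mxE mulr0.
  by apply/rowP => j; rewrite xD /j1 /j2 !x0 !mul0r subrr [RHS]mxE.
move=> r3; apply: krull_mu (rank_ge_corank1 sS sD kerD _ r3) (@zdense_odd 1 r (ltnW r3)).
split=> [Z /third_n3[_]|x k xM] //; apply: lsub_last.
apply: (kernel_three sS (erefl _) (erefl _) (erefl _) xM).
have E00 : (0 : 'I_(1 + 1 + 1)) = lshift 1 (lshift 1 0) by apply/val_inj.
rewrite -rowE mxE E00 col_mxEu mxE /ones_col (col_mxEu (const_mx 1 : 'cV[F]_1)) mxE.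
by rewrite oppr_eq0 oner_eq0.
Qed.

End OddDimensions.

(** * Even size: lower bounds *)

Section Stabilizer.
Variables (F : numFieldType) (n : nat).
Implicit Types (A : nat -> 'M[F]_n) (T Z : 'M[F]_n).

Definition twist i T : 'M[F]_n := if odd i then - T^T else T.

(* The A i are alternately bivectors and 2-forms; stab is the Lie algebra of the stabilizer
   of A 0, ..., A (r - 1) in GL_n. *)
Definition stab A r T := forall i, (i < r)%N -> twist i T *m A i = A i *m twist i.+1 T.

Lemma twistS i T : twist i.+1 T = - (twist i T)^T.
Proof. by rewrite /twist /=; case: (odd i); rewrite //= linearN /= trmxK opprK. Qed.

Lemma stab_prodm A r T : stab A r T -> T *m prodm A r = prodm A r *m twist r T.
Proof.
elim: r => [|r IH] sT /=; first by rewrite mulmx1 mul1mx.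
by rewrite mulmxA IH -?mulmxA ?sT // => i ir; apply: sT; apply: ltnW.
Qed.

(** The recursion does not change T = [prodm A r] *m Z, since A_r moves from the product to Z.
    Carrying T through the first r factors, of product P, gives Z P = A_r^-1 [twist r T], and its
    symmetry is the stabilizer equation for A_r. *)
Lemma ann_stab A r Z : (forall i, (A i)^T = - A i) -> (forall i, A i \in unitmx) ->
  ann A r Z <-> stab A r (prodm A r *m Z).
Proof.
move=> sA uA; elim: r Z => [|r IH] Z /=; first by split.
have uP : prodm A r \in unitmx by apply: unit_prodm.
set T := prodm A r *m A r *m Z.
have key : stab A r T -> ((Z *m prodm A r)^T = Z *m prodm A r <->
    twist r T *m A r = A r *m twist r.+1 T).
  move=> /stab_prodm TP.
  have ZP : A r *m (Z *m prodm A r) = twist r T.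
    by apply: (can_inj (mulKmx uP)); rewrite -TP /T !mulmxA.
  have {}ZP : Z *m prodm A r = invmx (A r) *m twist r T by rewrite -ZP mulKmx.
  have sV : (invmx (A r))^T = - invmx (A r).
    apply: (can_inj (mulKmx (uA r))); rewrite mulmxN mulmxV // -{1}[A r]opprK -sA.
    by rewrite mulNmx -trmx_mul mulVmx // trmx1.
  have -> : (Z *m prodm A r)^T = twist r.+1 T *m invmx (A r).
    by rewrite ZP trmx_mul sV twistS mulmxN mulNmx.
  rewrite ZP; split=> [E|E].
    by rewrite -[LHS](mulKVmx (uA r)) [invmx _ *m _]mulmxA -E mulmxKV.
  by rewrite -[LHS](mulKmx (uA r)) [A r *m _]mulmxA -E mulmxK.
rewrite IH mulmxA -/T; split=> [[sT /(key sT) sr] i|sT].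
  by rewrite ltnS leq_eqVlt => /predU1P[-> //|]; apply: sT.
have sT' : stab A r T by move=> i ir; apply: sT; apply: ltnW.
by split=> //; apply/(key sT'); apply: sT.
Qed.

Lemma rank_ge_stab r A (I : finType) (C : I -> 'M[F]_n) :
  (forall i, (A i)^T = - A i) -> (forall i, A i \in unitmx) ->
  (forall T, stab A r T -> (forall i, \tr (C i *m T) = 0) -> T = 0) ->
  (n * n - #|I| <= \rank (Jac (@prodmap F n r) (param (fun i => (2%:R^-1 *: A i)%R))))%N.
Proof.
move=> sA uA inj; apply: (rank_ge_skew (C := fun i => C i *m prodm A r)) => // Z.
move=> /(ann_stab _ _ sA uA) sZ CZ; have uP : prodm A r \in unitmx by apply: unit_prodm.
rewrite -[Z](mulKmx uP) (inj _ sZ) ?mulmx0 // => i; by rewrite mulmxA.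
Qed.

Lemma rank_le_stab r X c (S : 'I_c -> 'M[F]_n) :
  (forall i, skewize X i \in unitmx) ->
  (forall i, stab (skewize X) r (S i)) ->
  (forall u : 'I_c -> F, \sum_i u i *: S i = 0 -> forall i, u i = 0) ->
  (\rank (Jac (@prodmap F n r) (param X)) <= n * n - c)%N.
Proof.
move=> uX sS free; have uP : prodm (skewize X) r \in unitmx by apply: unit_prodm.
have sX i : (skewize X i)^T = - skewize X i by rewrite /skewize raddfB /= trmxK opprB.
apply: (rank_le_ann (S := fun i => invmx (prodm (skewize X) r) *m S i)).
  by move=> i; apply/ann_stab => //; rewrite mulKVmx.
move=> u H; apply: free; rewrite -[LHS](mulKVmx uP) mulmx_sumr.
by under eq_bigr do rewrite -scalemxAr; rewrite H mulmx0.
Qed.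

End Stabilizer.

Section EvenDimensions.
Variable F : numFieldType.

Definition torus m (a b c : 'rV[F]_m) : 'M[F]_(m + m) :=
  block_mx (diag_mx a) (diag_mx b) (diag_mx c) (- diag_mx a).

Definition skew_block m (P Q R : 'M[F]_m) : 'M[F]_(m + m) := block_mx P Q (- Q^T) R.

Lemma skew_block_skew m (P Q R : 'M[F]_m) : P^T = - P -> R^T = - R ->
  (skew_block P Q R)^T = - skew_block P Q R.
Proof. by move=> sP sR; rewrite tr_block_mx opp_block_mx sP sR !linearN /= trmxK opprK. Qed.

Lemma skew_block_unit m (P Q : 'M[F]_m) : Q \in unitmx -> skew_block P Q 0 \in unitmx.
Proof.
move=> uQ; rewrite -row_free_unit -kermx_eq0; apply/rowV0P => x /sub_kermxP.
rewrite -[x]hsubmxK /skew_block mul_row_block mulmx0 addr0 => /eqP.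
rewrite row_mx_eq0 => /andP[/eqP xP /eqP xQ].
have x1 : lsubmx x = 0 by rewrite -[LHS](mulmxK uQ) xQ mul0mx.
move/eqP: xP; rewrite x1 mul0mx add0r mulmxN oppr_eq0 => /eqP xQT.
have uQT : Q^T \in unitmx by rewrite unitmx_tr.
by rewrite -[rsubmx x](mulmxK uQT) xQT mul0mx row_mx0.
Qed.

Lemma eq0_of_eq (x y z : F) : y = z -> x = z - y -> x = 0.
Proof. by move=> -> ->; rewrite subrr. Qed.

(** All blocks of [torus a b c] are diagonal, so the equation decouples over pairs of indices. Three
    equations per ordered pair suffice: the lower left block at (i, j) repeats the upper right one
    at (j, i). *)
Lemma twist_form m (a b c : 'rV[F]_m) (P Q R : 'M[F]_m) : P^T = - P -> R^T = - R ->
  - (torus a b c)^T *m skew_block P Q R = skew_block P Q R *m torus a b c <->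
  forall i j, [/\ (a 0 i + a 0 j) * P i j + Q i j * c 0 j - c 0 i * Q j i = 0,
    (a 0 i - a 0 j) * Q i j + c 0 i * R i j + P i j * b 0 j = 0 &
    b 0 i * Q i j - Q j i * b 0 j - (a 0 i + a 0 j) * R i j = 0].
Proof.
move=> sP sR.
have Pji i j : P j i = - P i j by have /matrixP/(_ i j) := sP; rewrite !mxE.
have Rji i j : R j i = - R i j by have /matrixP/(_ i j) := sR; rewrite !mxE.
rewrite /torus /skew_block tr_block_mx !linearN /= !tr_diag_mx opp_block_mx !mulmx_block opprK.
split=> [|H].
  case/eq_block_mx => /matrixP e1 /matrixP e2 _ /matrixP e3 i j; split.
  - have := e1 i j; rewrite !(mulNmx, mulmxN, mul_diag_mx, mul_mx_diag) !mxE => E.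
    by apply: (eq0_of_eq E); ring.
  - have := e2 i j; rewrite !(mulNmx, mulmxN, mul_diag_mx, mul_mx_diag) !mxE => E.
    by apply: (eq0_of_eq E); ring.
  - have := e3 i j; rewrite !(mulNmx, mulmxN, mul_diag_mx, mul_mx_diag) !mxE => E.
    by apply: (eq0_of_eq E); ring.
congr block_mx; apply/matrixP => i j;
  rewrite !(mulNmx, mulmxN, mul_diag_mx, mul_mx_diag) !mxE; have [e1 e2 e3] := H i j;
  have [f1 f2 f3] := H j i; rewrite ?(Pji i j) ?(Rji i j) in f1 f2 f3 *.
- by apply/eqP; rewrite -subr_eq0 -oppr_eq0 -e1; apply/eqP; ring.
- by apply/eqP; rewrite -subr_eq0 -oppr_eq0 -e2; apply/eqP; ring.
- by apply/eqP; rewrite -subr_eq0 -f2; apply/eqP; ring.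
- by apply/eqP; rewrite -subr_eq0 -oppr_eq0 -e3; apply/eqP; ring.
Qed.

Definition even_family m (A1 A3 A4 : 'M[F]_(m + m)) (i : nat) : 'M[F]_(m + m) :=
  match i with
  | 1 => A1
  | 2 => symplectic_mx (natrow F m)
  | 3 => A3
  | 4 => A4
  | _ => symplectic_mx (const_mx 1)
  end.

Lemma even_family_skew m (A1 A3 A4 : 'M[F]_(m + m)) i :
  A1^T = - A1 -> A3^T = - A3 -> A4^T = - A4 ->
  (even_family A1 A3 A4 i)^T = - even_family A1 A3 A4 i.
Proof. by case: i => [|[|[|[|[|i]]]]] //= *; apply: symplectic_skew. Qed.

Lemma even_family_unit m (A1 A3 A4 : 'M[F]_(m + m)) i :
  A1 \in unitmx -> A3 \in unitmx -> A4 \in unitmx -> even_family A1 A3 A4 i \in unitmx.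
Proof.
by case: i => [|[|[|[|[|i]]]]] //= *; first [exact: unitJ | exact: unitJD].
Qed.

Lemma stab_even_family m (A1 A3 A4 : 'M[F]_(m + m)) r T :
  (2 < r)%N -> stab (even_family A1 A3 A4) r T -> exists a b c,
  T = torus a b c /\ - T^T *m A1 = A1 *m T.
Proof.
move=> r2 sT; have s0 := sT 0%N (ltnW (ltnW r2)); have s1 := sT 1%N (ltnW r2).
have s2 := sT 2%N r2; rewrite /twist /= in s0 s1 s2.
have [a [b [c TE]]] : exists a b c, T = torus a b c.
  apply: (symplectic_torus (@natrow_inj F m)).
    by rewrite trmx_mul symplectic_skew mulNmx -mulmxN.
  by rewrite trmx_mul symplectic_skew mulNmx -mulmxN.
by exists a, b, c.
Qed.

Lemma torus_eq0 m (a b c : 'rV[F]_m) : a = 0 -> b = 0 -> c = 0 -> torus a b c = 0.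
Proof. by move=> -> -> ->; rewrite /torus !linear0 block_mx0. Qed.

(** A scalar that is not an eigenvalue of - M will do. The shift makes a block invertible without
    touching the off-diagonal entries, where the constraints between distinct indices are read. *)
Lemma exists_unit_shift m (M : 'M[F]_m) : exists k : F, k%:M + M \in unitmx.
Proof.
apply: contrapT => /forallNP H.
have : char_poly (- M) = 0.
  apply: poly_infinite_eq0 => k; apply/eqP; rewrite -/(root _ _) -eigenvalue_root_char.
  rewrite /eigenvalue /eigenspace kermx_eq0 row_free_unit -opprD addrC; apply/negP => u.
  by apply: (H k); move: u; rewrite -scaleN1r unitmxZ ?unitrN1.
by move/eqP; apply/negP; exact: monic_neq0 (char_poly_monic _).
Qed.

Section LargeEven.
Variable m : nat.
Hypothesis m3 : (2 < m)%N.

(** On an edge (i, i + 1) of the cycle, P is 0 while Q is 1 in one direction and 0 in the other,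
    because the cycle has length at least 3. The equations there are b_i = 0, c_{i+1} = 0 and a_i =
    a_{i+1}, so a is constant. For m > 3 the pair {0, 2} is a chord, where P is nonzero and yields 2
    a = 0. For m = 3 it is an edge, and a line is left. *)
Let P : 'M[F]_m := \matrix_(i, j) if (3 < m)%N then
  ((i == 0 :> nat) && (j == 2 :> nat))%:R - ((i == 2 :> nat) && (j == 0 :> nat))%:R else 0.
Let shift : 'M[F]_m := \matrix_(i, j) (j == ordS i)%:R.

Lemma ordS2_neq (i : 'I_m) : (i == ordS (ordS i)) = false.
Proof.
apply/negP => /eqP/(congr1 val) /=; have im := ltn_ord i.
case: (ltnP i.+1 m) => [i1|i1]; last first.
  have e : i.+1 = m by lia.
  by rewrite e modnn modn_small; lia.
rewrite (modn_small i1); case: (ltnP i.+2 m) => [i2|i2]; first by rewrite modn_small; lia.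
have e : i.+2 = m by lia.
by rewrite e modnn; lia.
Qed.

Lemma large_even_torus k (a b c : 'rV[F]_m) :
  (forall i j, [/\ (a 0 i + a 0 j) * P i j + (k%:M + shift) i j * c 0 j - c 0 i * (k%:M + shift) j i = 0,
    (a 0 i - a 0 j) * (k%:M + shift) i j + c 0 i * (0 : 'M_m) i j + P i j * b 0 j = 0 &
    b 0 i * (k%:M + shift) i j - (k%:M + shift) j i * b 0 j - (a 0 i + a 0 j) * (0 : 'M_m) i j = 0]) ->
  [/\ b = 0, c = 0, forall i j, a 0 i = a 0 j & (3 < m)%N -> a = 0].
Proof.
move=> H.
have E i : [/\ P i (ordS i) = 0, (k%:M + shift) i (ordS i) = 1 & (k%:M + shift) (ordS i) i = 0].
  have ne : (i == ordS i) = false.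
    apply/negP => /eqP e; have := ordS2_neq i; rewrite -!e eqxx; by [].
  split.
  - rewrite mxE; case: ifP => // m4.
    have -> : (i == 0 :> nat) && (ordS i == 2 :> nat) = false.
      by apply/negP => /andP[/eqP /= ->]; rewrite modn_small //; lia.
    have -> : (i == 2 :> nat) && (ordS i == 0 :> nat) = false.
      by apply/negP => /andP[/eqP /= ->]; rewrite modn_small //; lia.
    by rewrite subrr.
  - by rewrite !mxE ne eqxx mulr0n add0r.
  - by rewrite !mxE eq_sym ne ordS2_neq mulr0n addr0.
have c0 i : c 0 (ordS i) = 0.
  have [P0 Q1 Q0] := E i; have [+ _ _] := H i (ordS i); rewrite P0 Q1 Q0.
  by rewrite !mulr0 mul1r subr0 add0r.
have b0 i : b 0 i = 0.
  have [P0 Q1 Q0] := E i; have [_ _ +] := H i (ordS i); rewrite Q1 Q0.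
  by rewrite mul0r mulr1 subr0 mxE mulr0 subr0.
have aS i : a 0 (ordS i) = a 0 i.
  have [P0 Q1 Q0] := E i; have [_ + _] := H i (ordS i); rewrite P0 Q1 mul0r addr0 mulr1 mxE mulr0 addr0.
  by move/eqP; rewrite subr_eq0 => /eqP.
have i0 : (0 < m)%N by lia.
have a0 i : a 0 i = a 0 (Ordinal i0).
  case: i => i im; elim: i im => [|i IH] im; first by congr (a 0 _); apply/val_inj.
  rewrite -(IH (ltnW im)) -[RHS]aS; congr (a 0 _); apply/val_inj => /=; by rewrite modn_small.
split.
- by apply/rowP => i; rewrite b0 mxE.
- by apply/rowP => i; rewrite -(ord_predK i) c0 mxE.
- by move=> i j; rewrite a0 [RHS]a0.
move=> m4; have i2 : (2 < m)%N by lia.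
have [+ _ _] := H (Ordinal i0) (Ordinal i2).
have ne : (Ordinal i0 == Ordinal i2) = false by [].
have ne1 : (Ordinal i2 == ordS (Ordinal i0)) = false.
  by apply/negP => /eqP/(congr1 val) /=; rewrite modn_small; lia.
have ne2 : (Ordinal i0 == ordS (Ordinal i2)) = false.
  by apply/negP => /eqP/(congr1 val) /=; rewrite modn_small; lia.
have ne' : (Ordinal i2 == Ordinal i0) = false by [].
rewrite !mxE m4 ne ne' ne1 ne2 /= !mulr0n !add0r !mul0r !mulr0 !subr0 addr0 mulr1.
rewrite (a0 (Ordinal i2)) -mulr2n => /eqP; rewrite mulrn_eq0 /= => /eqP a00.
by apply/rowP => i; rewrite a0 a00 mxE.
Qed.

Lemma skewP_large : P^T = - P.
Proof. by apply/matrixP => i j; rewrite !mxE; case: ifP => _; rewrite ?oppr0 // opprB;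
  congr (_%:R - _%:R); rewrite andbC. Qed.

Lemma exists_large_even : exists2 A1 : 'M[F]_(m + m), A1^T = - A1 /\ A1 \in unitmx &
  forall a b c, - (torus a b c)^T *m A1 = A1 *m torus a b c ->
  [/\ b = 0, c = 0, forall i j, a 0 i = a 0 j & (3 < m)%N -> a = 0].
Proof.
have [k uQ] := exists_unit_shift shift; have s0 : (0 : 'M[F]_m)^T = - 0 by rewrite trmx0 oppr0.
exists (skew_block P (k%:M + shift) 0).
  by split; [apply: skew_block_skew => //; exact: skewP_large | exact: skew_block_unit].
by move=> a b c /(twist_form _ _ _ _ skewP_large s0); apply: large_even_torus.
Qed.

End LargeEven.

Lemma dim_mu_large_even m r : (3 < m)%N -> (2 < r)%N ->
  krull_dim (mu r (skew_mx F (m + m))) ((m + m) ^ 2).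
Proof.
move=> m4 r3; have [A1 [sA1 uA1] H] := exists_large_even (ltnW m4).
pose J := symplectic_mx (const_mx 1 : 'rV[F]_m).
have sJ : J^T = - J by apply: symplectic_skew.
have uJ : J \in unitmx by apply: unitJ.
apply: (krull_mu (X := fun i => 2%:R^-1 *: even_family A1 J J i)); last exact: zdense_rank_full.
apply: leq_trans (rank_ge_stab (A := even_family A1 J J) (C := fun _ : void => 0) _ _ _).
- by rewrite card_void subn0 mulnn.
- by move=> i; apply: even_family_skew.
- by move=> i; apply: even_family_unit.
move=> T /(stab_even_family r3)[a [b [c [-> /H[b0 c0 _ /(_ m4) a0]]]]] _.
exact: torus_eq0.
Qed.

Lemma torus_diag_eq0 (m : nat) (a : 'rV[F]_m) (i j : 'I_m) (P Q : 'M[F]_m) :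
  P^T = - P -> P i j != 0 -> (forall i j, a 0 i = a 0 j) ->
  - (torus a 0 0)^T *m skew_block P Q 0 = skew_block P Q 0 *m torus a 0 0 -> a = 0.
Proof.
have s0 : (0 : 'M[F]_m)^T = - 0 by rewrite trmx0 oppr0.
move=> sP Pij aE /(twist_form _ _ _ _ sP s0) /(_ i j)[+ _ _].
rewrite !mxE mulr0 mul0r subr0 addr0 (aE j i) => /eqP.
rewrite mulf_eq0 (negPf Pij) orbF -mulr2n mulrn_eq0 /= => /eqP ai.
by apply/rowP => l; rewrite (aE l i) ai mxE.
Qed.

Definition elem_skew m (i j : 'I_m) : 'M[F]_m := delta_mx i j - delta_mx j i.

Lemma elem_skew_skew m (i j : 'I_m) : (elem_skew i j)^T = - elem_skew i j.
Proof. by rewrite /elem_skew raddfB /= !trmx_delta opprB. Qed.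

Lemma elem_skew_neq0 m (i j : 'I_m) : i != j -> elem_skew i j i j != 0.
Proof. by move=> /negPf ij; rewrite !mxE !eqxx ij /= subr0 oner_neq0. Qed.

Lemma rank_ge_six : exists X : nat -> 'M[F]_(3 + 3),
  (35 <= \rank (Jac (@prodmap F (3 + 3) 3) (param X)))%N.
Proof.
have [A1 [sA1 uA1] H] := exists_large_even (isT : 2 < 3)%N.
pose J := symplectic_mx (const_mx 1 : 'rV[F]_3).
have sJ : J^T = - J by apply: symplectic_skew.
have uJ : J \in unitmx by apply: unitJ.
exists (fun i => 2%:R^-1 *: even_family A1 J J i).
apply: leq_trans (rank_ge_stab (A := even_family A1 J J)
  (C := fun _ : unit => delta_mx 0 0) _ _ _).
- by rewrite card_unit.
- by move=> i; apply: even_family_skew.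
- by move=> i; apply: even_family_unit.
move=> T /(@stab_even_family _ _ _ _ 3 _ isT)[a [b [c [-> /H[b0 c0 aE _]]]]] CT.
apply: torus_eq0 => //; apply/rowP => i; rewrite (aE i 0) mxE.
have := CT tt; rewrite mul_delta_entry.
have -> : (0 : 'I_(3 + 3)) = lshift 3 0 by apply/val_inj.
by rewrite /torus block_mxEul mxE eqxx.
Qed.

Lemma dim_mu_six r : (3 < r)%N -> krull_dim (mu r (skew_mx F 6)) 36.
Proof.
move=> r4; have [A1 [sA1 uA1] H] := exists_large_even (isT : 2 < 3)%N.
pose J := symplectic_mx (const_mx 1 : 'rV[F]_3).
have sJ : J^T = - J by apply: symplectic_skew.
have uJ : J \in unitmx by apply: unitJ.
(* The first three factors leave b = c = 0 and a constant; one nonzero entry in the upper left block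
   of the fourth gives 2 a = 0. *)
pose P : 'M[F]_3 := elem_skew 0 1; have sP : P^T = - P by apply: elem_skew_skew.
pose A3 := skew_block P 1%:M 0.
have s3 : A3^T = - A3 by apply: skew_block_skew; rewrite ?trmx0 ?oppr0.
have u3 : A3 \in unitmx by apply/skew_block_unit/unitmx1.
apply: (krull_mu (X := fun i => 2%:R^-1 *: even_family A1 A3 J i)); last first.
  exact: (@zdense_rank_full F 6).
apply: leq_trans (rank_ge_stab (A := even_family A1 A3 J) (C := fun _ : void => 0) _ _ _).
- by rewrite card_void.
- by move=> i; apply: even_family_skew.
- by move=> i; apply: even_family_unit.
move=> T sT _; have s := sT 3 r4; rewrite /twist /= in s.
have [a [b [c [TE sT1]]]] := stab_even_family (ltnW r4) sT.
rewrite TE in sT1; have [b0 c0 aE _] := H _ _ _ sT1; rewrite {}TE b0 c0 in s *.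
by apply: torus_eq0 => //; apply: torus_diag_eq0 sP (elem_skew_neq0 _) aE s.
Qed.

Definition four_Q (i j : 'I_2) : 'M[F]_2 := 1%:M + delta_mx i j.

Lemma four_Q_unit (i j : 'I_2) : i != j -> four_Q i j \in unitmx.
Proof.
move=> ij; have /mulmx1_unit[] // : four_Q i j *m (1%:M - delta_mx i j) = 1%:M.
rewrite mulmxDl mul1mx mulmxBr mulmx1 mul_delta_mx_0 1?eq_sym // subr0.
by rewrite subrK.
Qed.

(** There is a single pair of indices. The 2 x 2 matrix intertwining t_0 and t_1 is diag (0, 1) for
    A1, which leaves b_1, c_0 and the common value of a: dimension 16 - 3. It is diag (1, 0) for A3,
    which kills b_1 and c_0: dimension 16 - 1. A4 kills a. *)
Let A1 : 'M[F]_(2 + 2) := skew_block 0 (four_Q 0 1) 0.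
Let A3 : 'M[F]_(2 + 2) := skew_block 0 (four_Q 1 0) 0.
Let A4 : 'M[F]_(2 + 2) := skew_block (elem_skew 0 1) 1%:M 0.

Let s0 : (0 : 'M[F]_2)^T = - 0.
Proof. by rewrite trmx0 oppr0. Qed.

Lemma four_family_skew i : (even_family A1 A3 A4 i)^T = - even_family A1 A3 A4 i.
Proof. by apply: even_family_skew; apply: skew_block_skew => //; apply: elem_skew_skew. Qed.

Lemma four_family_unit i : even_family A1 A3 A4 i \in unitmx.
Proof.
by apply: even_family_unit; apply: skew_block_unit; rewrite ?unitmx1 ?four_Q_unit.
Qed.

Lemma ord2_cases (i : 'I_2) : i = 0 \/ i = 1.
Proof. by case: i => [[|[|i]] //] H; [left|right]; apply/val_inj. Qed.

Lemma four_stab3 (a b c : 'rV[F]_2) : - (torus a b c)^T *m A1 = A1 *m torus a b c ->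
  [/\ c 0 1 = 0, b 0 0 = 0 & a 0 0 = a 0 1].
Proof.
move=> /(twist_form _ _ _ _ s0 s0) /(_ 0 1) []; rewrite !mxE /= !(mulr0n, mulr1n).
rewrite !(mulr0, mul0r, addr0, add0r, subr0, mulr1, mul1r) => -> aE ->; split=> //.
by move/eqP: aE; rewrite subr_eq0 => /eqP.
Qed.

Lemma four_stab4 (a b c : 'rV[F]_2) : - (torus a b c)^T *m A3 = A3 *m torus a b c ->
  c 0 0 = 0 /\ b 0 1 = 0.
Proof.
move=> /(twist_form _ _ _ _ s0 s0) /(_ 0 1) []; rewrite !mxE /= !(mulr0n, mulr1n).
rewrite !(mulr0, mul0r, addr0, add0r, subr0, mulr1, mul1r, sub0r) => c0 _ b1.
by split; apply/eqP; rewrite -oppr_eq0 ?c0 ?b1.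
Qed.

Lemma rV2_eq0 (a : 'rV[F]_2) : a 0 0 = 0 -> a 0 1 = 0 -> a = 0.
Proof. by move=> a0 a1; apply/rowP => i; rewrite mxE; case: (ord2_cases i) => ->. Qed.

Let L (i : 'I_2) : 'I_(2 + 2) := lshift 2 i.
Let R (i : 'I_2) : 'I_(2 + 2) := rshift 2 i.

Lemma rank_ge_four3 : (13 <= \rank (Jac (@prodmap F (2 + 2) 3)
     (param (fun i => (2%:R^-1 *: even_family A1 A3 A4 i)%R))))%N.
Proof.
apply: leq_trans (rank_ge_stab (A := even_family A1 A3 A4) (C := fun i : option bool => match i with
   | None => delta_mx (L 0) (L 0) | Some true => delta_mx (R 1) (L 1)
   | Some false => delta_mx (L 0) (R 0) end) four_family_skew four_family_unit _).
  by rewrite card_option card_bool.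
move=> T /(@stab_even_family _ _ _ _ 3 _ isT)[a [b [c [-> /four_stab3[c1 b0 aE]]]]] CT.
have a0 : a 0 0 = 0.
  by have := CT None; rewrite mul_delta_entry /torus block_mxEul mxE eqxx.
have b1 : b 0 1 = 0.
  by have := CT (Some true); rewrite mul_delta_entry /torus block_mxEur mxE eqxx.
have c0 : c 0 0 = 0.
  by have := CT (Some false); rewrite mul_delta_entry /torus block_mxEdl mxE eqxx.
by apply: torus_eq0; apply: rV2_eq0; rewrite -?aE.
Qed.

Lemma rank_ge_four4 : (15 <= \rank (Jac (@prodmap F (2 + 2) 4)
     (param (fun i => (2%:R^-1 *: even_family A1 A3 A4 i)%R))))%N.
Proof.
apply: leq_trans (rank_ge_stab (A := even_family A1 A3 A4) (C := fun _ : unit => delta_mx (L 0) (L 0))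
  four_family_skew four_family_unit _).
  by rewrite card_unit.
move=> T sT CT; have s := sT 3 isT; rewrite /twist /= in s.
have [a [b [c [TE sT1]]]] := @stab_even_family _ _ _ _ 4 _ isT sT.
rewrite {}TE in s sT1 CT *; have [c1 b0 aE] := four_stab3 sT1; have [c0 b1] := four_stab4 s.
have a0 : a 0 0 = 0 by have := CT tt; rewrite mul_delta_entry /torus block_mxEul mxE eqxx.
by apply: torus_eq0; apply: rV2_eq0; rewrite -?aE.
Qed.

Lemma dim_mu_four r : (4 < r)%N -> krull_dim (mu r (skew_mx F 4)) 16.
Proof.
move=> r5; apply: (krull_mu (X := fun i => 2%:R^-1 *: even_family A1 A3 A4 i)); last first.
  exact: (@zdense_rank_full F 4).
apply: leq_trans (rank_ge_stab (A := even_family A1 A3 A4) (C := fun _ : void => 0)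
  four_family_skew four_family_unit _).
  by rewrite card_void.
move=> T sT _; have s3 := sT 3 (ltnW r5); have s4 := sT 4 r5; rewrite /twist /= in s3 s4.
have [a [b [c [TE sT1]]]] := stab_even_family (ltnW (ltnW r5)) sT.
rewrite {}TE in s3 s4 sT1 *; have [c1 b0 aE] := four_stab3 sT1; have [c0 b1] := four_stab4 s3.
have cE : c = 0 by apply: rV2_eq0.
have bE : b = 0 by apply: rV2_eq0.
have a0 : a 0 0 = 0.
  (* Position 4 is even, so the equation is T A4 = - A4 T^T, to which [twist_form] does not apply.
     Its entry (0, 1) reads a_0 + a_1 = 0. *)
  have := congr1 (fun M : 'M_(2 + 2) => ulsubmx M 0 1) s4.
  rewrite /torus /A4 /skew_block tr_block_mx !linearN /= !tr_diag_mx cE bE !linear0.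
  rewrite !mulmx_block opp_block_mx !block_mxKul !mul0mx !mulmx0 !addr0.
  rewrite mul_diag_mx mul_mx_diag !mxE !eqxx /= subr0 mulr1 mul1r -aE => /eqP.
  by rewrite -addr_eq0 -mulr2n mulrn_eq0 /= => /eqP.
by apply: torus_eq0 => //; apply: rV2_eq0; rewrite -?aE.
Qed.

End EvenDimensions.

(** * Even size: exceptional upper bounds *)

Section Gauge.
Variables (R : comNzRingType) (m : nat).
Local Notation n := (m + m)%N.

Definition diag_row (M : 'M[R]_n) : 'rV[R]_m := \row_i M (lshift m i) (lshift m i).

(** [skewize] discards N + N^T and doubles a skew matrix, which [half] undoes: the result is the
    normal form in the basis U. *)
Definition congr_sym (half : R) (U N : 'M[R]_n) (d : 'rV[R]_m) : 'M[R]_n :=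
  half *: (U *m symplectic_mx d *m U^T) + (N + N^T).

(* Y 0 is the change of basis g, Y 1 carries the diagonal matrix; Y 2 and Y 3 add symmetric
   matrices, which skewize kills, so as to reach every matrix. *)
Definition gauge (half : R) (Y : nat -> 'M[R]_n) (i : nat) : 'M[R]_n :=
  match i with
  | 0 => congr_sym half (Y 0%N) (Y 2%N) (const_mx 1)
  | 1 => Y 4%N
  | 2 => congr_sym half (Y 0%N) (Y 3%N) (diag_row (Y 1%N))
  | _ => Y 5%N
  end.

End Gauge.

Lemma map_symplectic (R S : comNzRingType) (f : {rmorphism R -> S}) m (d : 'rV[R]_m) :
  map_mx f (symplectic_mx d) = symplectic_mx (map_mx f d).
Proof. by rewrite map_block_mx map_mxN !map_mx0 map_diag_mx. Qed.

Lemma map_gauge (R S : comNzRingType) (f : {rmorphism R -> S}) m half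
    (Y : nat -> 'M[R]_(m + m)) i :
  map_mx f (gauge half Y i) = gauge (f half) (fun j => map_mx f (Y j)) i.
Proof.
have gE (U N : 'M[R]_(m + m)) d : map_mx f (congr_sym half U N d)
    = congr_sym (f half) (map_mx f U) (map_mx f N) (map_mx f d).
  by rewrite /congr_sym !map_mxD map_mxZ !map_mxM map_symplectic !map_trmx.
case: i => [|[|[|i]]] //; rewrite [LHS]gE /gauge; congr (congr_sym _ _ _ _).
  by apply/rowP => i; rewrite !mxE rmorph1.
by apply/rowP => i; rewrite !mxE.
Qed.

Section Density.
Variables (F : numFieldType) (m r : nat).
Hypothesis r4 : (r <= 4)%N.
Local Notation n := (m + m)%N.
Local Notation K := (r * (n * n))%N.
Local Notation L := (6 * (n * n))%N.
Local Notation half := (2%:R^-1 : F).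
Local Notation J := (symplectic_mx (const_mx 1 : 'rV[F]_m)).
Local Notation JD := (symplectic_mx (natrow F m)).

Definition gauge_var i : 'M[{mpoly F[L]}]_n := gauge half%:MP (@varmx F n 6) i.
Definition Gam (c : 'I_K) : {mpoly F[L]} := mxvec (\matrix_(i < r) mxvec (gauge_var i)) 0 c.

Lemma meval_gauge (Y : nat -> 'M[F]_n) i :
  map_mx (meval (param Y)) (gauge_var i) = gauge half Y i.
Proof.
rewrite /gauge_var map_gauge /= mevalC; case: i => [|[|[|i]]] /=; by rewrite !(@meval_varmx F n 6).
Qed.

Lemma meval_Gam (Y : nat -> 'M[F]_n) c : (Gam c).@[param Y] = param (gauge half Y) c.
Proof.
rewrite /Gam /param /encode; case/mxvec_indexP: c => i c; case/mxvec_indexP: c => a b.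
by rewrite !mxvecE !mxE !mxvecE -meval_gauge mxE.
Qed.

Let Y0 (i : nat) : 'M[F]_n :=
  match i with 0 => 1%:M | 1 => block_mx (diag_mx (natrow F m)) 0 0 0 | _ => 0 end.

Definition dgauge (V : nat -> 'M[F]_n) (i : nat) : 'M[F]_n :=
  match i with
  | 0 => half *: (V 0%N *m J + J *m (V 0%N)^T) + (V 2%N + (V 2%N)^T)
  | 1 => V 4%N
  | 2 => half *: (V 0%N *m JD + symplectic_mx (diag_row (V 1%N)) + JD *m (V 0%N)^T) + (V 3%N + (V 3%N)^T)
  | _ => V 5%N
  end.

Lemma dmx_symplectic x v (d : 'rV[{mpoly F[L]}]_m) :
  dmx (n := n) (r := 6) x v (symplectic_mx d) = symplectic_mx (dmx (n := n) (r := 6) x v d).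
Proof.
have d0 : dmx (n := n) (r := 6) x v (0 : 'M_m) = 0 by rewrite -(map_mx0 (@mpolyC L F)) dmx_const.
by rewrite /symplectic_mx dmx_block dmxN dmx_diag !d0.
Qed.

Lemma dmx_congr_sym V (N : 'M[{mpoly F[L]}]_n) d W e :
  dmx (n := n) (r := 6) (param Y0) (param V) N = W ->
  map_mx (meval (param (r := 6) Y0)) d = e ->
  dmx (n := n) (r := 6) (param Y0) (param V) (congr_sym half%:MP (@varmx F n 6 0%N) N d)
  = half *: (V 0%N *m symplectic_mx e
      + symplectic_mx (dmx (n := n) (r := 6) (param Y0) (param V) d)
      + symplectic_mx e *m (V 0%N)^T) + (W + W^T).
Proof.
move=> <- <-; rewrite /congr_sym !dmxD dmxZ !dmxM !dmx_tr dmx_varmx // dmx_symplectic.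
rewrite -map_trmx meval_varmx // map_mxM meval_varmx // map_symplectic /=.
by rewrite trmx1 !mulmx1 !mul1mx.
Qed.

Lemma dmx_gauge V i :
  dmx (n := n) (r := 6) (param Y0) (param V) (gauge_var i) = dgauge V i.
Proof.
case: i => [|[|[|i]]]; rewrite /gauge_var /=.
- rewrite (dmx_congr_sym (W := V 2%N) (e := const_mx 1)) ?dmx_varmx //; last first.
    by apply/rowP => i; rewrite !mxE meval1.
  have -> : const_mx 1 = map_mx (@mpolyC L F) (const_mx 1 : 'rV[F]_m).
    by apply/rowP => i; rewrite !mxE mpolyC1.
  rewrite dmx_const (_ : symplectic_mx 0 = 0) ?addr0 //.
  by rewrite /symplectic_mx linear0 oppr0 block_mx0.
- exact: dmx_varmx.
- have dE : map_mx (meval (param (r := 6) Y0)) (diag_row (@varmx F n 6 1%N)) = natrow F m.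
    apply/rowP => i; have := meval_varmx Y0 (isT : 1 < 6)%N.
    move/matrixP/(_ (lshift m i) (lshift m i)); rewrite [LHS]mxE /= block_mxEul => E.
    by apply: etrans (etrans E _); rewrite !mxE ?eqxx.
  have := dmx_congr_sym (dmx_varmx Y0 V (isT : 3 < 6)%N) dE; rewrite /dgauge => ->.
  have -> : dmx (n := n) (r := 6) (param Y0) (param V) (diag_row (@varmx F n 6 1%N)) = diag_row (V 1%N).
    apply/rowP => i; have /matrixP/(_ (lshift m i) (lshift m i)) := dmx_varmx Y0 V (isT : 1 < 6)%N.
    by rewrite !mxE => <-; apply: eq_bigr.
  by [].
- exact: dmx_varmx.
Qed.

Lemma Jac_Gam V : Jac Gam (param Y0) *m (encode 6 V)^T = (encode r (dgauge V))^T.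
Proof.
apply/colP => c; rewrite [RHS]mxE; case/mxvec_indexP: c => i c; case/mxvec_indexP: c => a b.
rewrite [RHS]param_entry -dmx_gauge !mxE; apply: eq_bigr => j _.
by rewrite !mxE /Gam !mxvecE mxE mxvecE.
Qed.

Lemma sum_encode (Z W : nat -> 'M[F]_n) :
  \sum_c encode r Z 0 c * encode r W 0 c = \sum_(i < r) \tr ((Z i)^T *m W i).
Proof.
under [RHS]eq_bigr do rewrite -mxvec_tr.
rewrite pair_bigA /= (reindex _ (curry_mxvec_bij r (n * n))) /=.
by apply: eq_bigr => -[i l] _; rewrite /encode /= !mxvecE !mxE.
Qed.

Lemma trace_eq0 (W : 'M[F]_n) : (forall M, \tr (W *m M) = 0) -> W = 0.
Proof.
by move=> H; apply/matrixP => i j; rewrite mxE -(mxtrace_mul_delta W j i).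
Qed.

Lemma trace_add_sym (Z : 'M[F]_n) : (forall M, \tr (Z^T *m (M + M^T)) = 0) -> Z^T = - Z.
Proof.
move=> H; apply/eqP; rewrite -addr_eq0; apply/eqP/trace_eq0 => M.
rewrite mulmxDl raddfD /= -[\tr (Z *m M)]mxtrace_tr trmx_mul [X in _ + X]mxtrace_mulC.
by have := H M; rewrite mulmxDr raddfD.
Qed.

Lemma trace_skew_pair (Z S H : 'M[F]_n) : Z^T = - Z -> S^T = - S ->
  \tr (Z^T *m (H *m S + S *m H^T)) = - (2%:R * \tr (S *m Z *m H)).
Proof.
move=> sZ sS; rewrite mulmxDr raddfD /= sZ.
have -> : \tr (- Z *m (H *m S)) = - \tr (S *m Z *m H).
  by rewrite mulNmx raddfN /= mulmxA mxtrace_mulC mulmxA.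
have -> : \tr (- Z *m (S *m H^T)) = - \tr (S *m Z *m H).
  rewrite mulNmx raddfN /= -mxtrace_tr !trmx_mul trmxK sZ sS.
  by rewrite !(mulmxN, mulNmx, opprK) -mulmxA mxtrace_mulC.
ring.
Qed.

(** The relation says Z0 = - N Z2 with N = diag (d, d), d being [natrow F m]. Since Z0 and Z2 are
    skew and N is symmetric, transposition gives the commutation. *)
Lemma skew_comm (Z0 Z2 : 'M[F]_n) : J *m Z0 + JD *m Z2 = 0 -> Z0^T = - Z0 -> Z2^T = - Z2 ->
  Z2 *m block_mx (diag_mx (natrow F m)) 0 0 (diag_mx (natrow F m))
  = block_mx (diag_mx (natrow F m)) 0 0 (diag_mx (natrow F m)) *m Z2.
Proof.
move=> JZ s0 s2; set N := block_mx _ _ _ _.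
have sN : N^T = N by rewrite tr_block_mx !tr_diag_mx trmx0.
have Z0E : Z0 = - (N *m Z2).
  have := congr1 (mulmx J) JZ; rewrite mulmxDr !mulmxA mulJJ mulNmx mul1mx mulmx0.
  move/eqP; rewrite addrC subr_eq0 => /eqP <-; rewrite mul_symplectic diag_mx_const1 mul1mx.
  by rewrite -mulNmx opp_block_mx !oppr0.
by move: s0; rewrite Z0E linearN /= trmx_mul s2 sN mulNmx opprK => ->; rewrite opprK.
Qed.

(** Distinct entries make the four blocks diagonal, and skewness leaves only matrices of the form
    [symplectic_mx q], on which the trace pairing is nondegenerate. *)
Lemma skew_comm_symplectic (Z : 'M[F]_n) : Z^T = - Z ->
  Z *m block_mx (diag_mx (natrow F m)) 0 0 (diag_mx (natrow F m))
  = block_mx (diag_mx (natrow F m)) 0 0 (diag_mx (natrow F m)) *m Z ->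
  (forall v : 'rV[F]_m, \tr (Z^T *m symplectic_mx v) = 0) -> Z = 0.
Proof.
move=> sZ; rewrite -[Z]submxK in sZ *.
move: (ulsubmx Z) (ursubmx Z) (dlsubmx Z) (drsubmx Z) sZ => p q u s sZ.
rewrite !mulmx_block !(mulmx0, mul0mx, addr0, add0r) => /eq_block_mx[pD qD uD sD] trZ.
have pE := comm_diag_mx (@natrow_inj F m) pD; have qE := comm_diag_mx (@natrow_inj F m) qD.
have sE := comm_diag_mx (@natrow_inj F m) sD.
move: (sZ); rewrite tr_block_mx opp_block_mx => /eq_block_mx[sp _ qu ss].
have diag0 (x : 'M[F]_m) : x^T = - x -> x = diag_mx (\row_i x i i) -> x = 0.
  move=> sx ->; apply: diag_mx_eq0 => i; rewrite mxE.
  have /matrixP/(_ i i) := sx; rewrite [LHS]mxE [RHS]mxE => /eqP.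
  by rewrite -addr_eq0 -mulr2n mulrn_eq0 /= => /eqP.
have p0 := diag0 p sp pE; have s0 := diag0 s ss sE.
have q0 : \row_i q i i = 0.
  apply/rowP => i; rewrite [RHS]mxE; have := trZ (delta_mx 0 i).
  have -> : block_mx p q u s = symplectic_mx (\row_i q i i).
    have uE : u = - q by rewrite -[u]opprK -qu {1}qE tr_diag_mx -qE.
    by rewrite p0 s0 uE {1 2}qE.
  rewrite symplectic_skew mulNmx mul_symplectic opp_block_mx !opprK mxtrace_block.
  rewrite mulmx_diag mxtrace_diag (bigD1 i) //= big1 => [|j /negPf ji].
    by rewrite !mxE !eqxx mulr1 addr0 -mulr2n => /eqP; rewrite mulrn_eq0 /= => /eqP.
  by rewrite !mxE ji andbF mulr0.
have q1 : q = 0 by rewrite qE q0 linear0.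
have u0 : u = 0 by rewrite -[u]opprK -qu q1 trmx0 oppr0.
by rewrite p0 s0 q1 u0 block_mx0.
Qed.

(** The differential of [gauge] at [Y0] is onto. A covector Z orthogonal to its image has Z 1 = 0,
    and Z 3 = 0 if r = 4 (directions V 4, V 5), Z 0 and Z 2 skew (V 2, V 3), J Z 0 + JD Z 2 = 0 (V
    0), and Z 2 orthogonal to all [symplectic_mx v] (V 1). Hence Z 2 = 0, then Z 0 = 0. *)
Lemma Gam_indep : (2 < r)%N -> algindep Gam.
Proof.
move=> r3; apply: (@jac_indep _ _ _ _ (param Y0)).
rewrite -kermx_eq0; apply/rowV0P => z /sub_kermxP.
have [Z <-] := encode_surj z => ZJ.
have pair V : \sum_(i < r) \tr ((Z i)^T *m dgauge V i) = 0.
  rewrite -sum_encode; have := congr1 (mulmx^~ (encode 6 V)^T) ZJ.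
  rewrite /= mul0mx -mulmxA Jac_Gam => /matrixP/(_ 0 0); rewrite !mxE => E.
  by rewrite -[RHS]E; apply: eq_bigr => c _; rewrite mxE.
have pairE V0 V1 V2 V3 V4 V5 :
    \tr ((Z 0%N)^T *m (half *: (V0 *m J + J *m V0^T) + (V2 + V2^T))) + (\tr ((Z 1%N)^T *m V4) +
    (\tr ((Z 2%N)^T *m (half *: (V0 *m JD + symplectic_mx (diag_row V1) + JD *m V0^T)
        + (V3 + V3^T))) + (if r == 4%N then \tr ((Z 3%N)^T *m V5) else 0))) = 0.
  have sum_r (f : nat -> F) :
      \sum_(i < r) f i = f 0%N + (f 1%N + (f 2%N + (if r == 4%N then f 3%N else 0))).
    have [e|e] : (r = 3 \/ r = 4)%N by lia.
      by rewrite e !big_ord_recl big_ord0.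
    by rewrite e !big_ord_recl big_ord0 addr0.
  have := pair (nth 0 [:: V0; V1; V2; V3; V4; V5]).
  by rewrite (sum_r (fun i => \tr ((Z i)^T *m dgauge _ i))).
have symp0 : symplectic_mx (0 : 'rV[F]_m) = 0.
  by rewrite /symplectic_mx linear0 oppr0 block_mx0.
have diag_row0 : diag_row (0 : 'M[F]_n) = 0 by apply/rowP => i; rewrite !mxE.
have simp := (mul0mx, mulmx0, trmx0, addr0, add0r, scaler0, symp0, diag_row0, mxtrace0).
have Z1 : Z 1%N = 0.
  apply: trmx_inj; rewrite trmx0; apply: trace_eq0 => M.
  by have := pairE 0 0 0 0 M 0; rewrite !simp; case: ifP; rewrite addr0.
have Z3 : r = 4%N -> Z 3%N = 0.
  move=> e; apply: trmx_inj; rewrite trmx0; apply: trace_eq0 => M.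
  by have := pairE 0 0 0 0 0 M; rewrite !simp e eqxx.
have s0 : (Z 0%N)^T = - Z 0%N.
  apply: trace_add_sym => M.
  by have := pairE 0 0 M 0 0 0; rewrite !simp; case: ifP; rewrite !simp.
have s2 : (Z 2%N)^T = - Z 2%N.
  apply: trace_add_sym => M.
  by have := pairE 0 0 0 M 0 0; rewrite !simp; case: ifP; rewrite !simp.
have trZ (X W : 'M[F]_n) : \tr (X *m (half *: W)) = half * \tr (X *m W).
  by rewrite -scalemxAr mxtraceZ.
have half0 : (half == 0) = false by rewrite invr_eq0 pnatr_eq0.
have red (S0 S2 M : 'M[F]_n) :
    \tr ((Z 0%N)^T *m (half *: (M *m S0 + S0 *m M^T) + (0 + 0^T))) + (\tr ((Z 1%N)^T *m 0) +
    (\tr ((Z 2%N)^T *m (half *: (M *m S2 + symplectic_mx (diag_row (0 : 'M[F]_n)) + S2 *m M^T)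
        + (0 + 0^T))) + (if r == 4%N then \tr ((Z 3%N)^T *m 0) else 0)))
    = half * (\tr ((Z 0%N)^T *m (M *m S0 + S0 *m M^T)) + \tr ((Z 2%N)^T *m (M *m S2 + S2 *m M^T))).
  by rewrite !simp if_same addr0 !trZ mulrDr.
have JZ : J *m Z 0%N + JD *m Z 2%N = 0.
  have sJ : J^T = - J by apply: symplectic_skew.
  have sJD : JD^T = - JD by apply: symplectic_skew.
  apply: trace_eq0 => M; have := pairE M 0 0 0 0 0; rewrite red.
  move: J JD sJ sJD => S0 S2 sS0 sS2.
  rewrite !trace_skew_pair // -opprD -mulrDr => /eqP.
  by rewrite mulf_eq0 half0 oppr_eq0 mulf_eq0 pnatr_eq0 /= mulmxDl mxtraceD => /eqP.
have dZ (v : 'rV[F]_m) : \tr ((Z 2%N)^T *m symplectic_mx v) = 0.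
  have := pairE 0 (block_mx (diag_mx v) 0 0 0) 0 0 0 0; rewrite !simp if_same addr0.
  have -> : diag_row (block_mx (diag_mx v) 0 0 0) = v.
    by apply/rowP => i; rewrite mxE block_mxEul mxE eqxx.
  by rewrite trZ => /eqP; rewrite mulf_eq0 half0 => /eqP.
have Z2 : Z 2%N = 0 by exact: skew_comm_symplectic s2 (skew_comm JZ s0 s2) dZ.
have Z0 : Z 0%N = 0.
  move: JZ; rewrite Z2 mulmx0 addr0 => JZ; rewrite -[LHS](mulKmx (unitJ F m)) JZ mulmx0 //.
rewrite /encode (_ : \matrix_(i < r) _ = 0) ?linear0 //.
apply/row_matrixP => i; rewrite rowK row0; case: i => i ir /=.
have : [\/ i = 0, i = 1, i = 2 | i = 3 /\ r = 4]%N.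
  case: i ir => [|[|[|[|i]]]] ir; [by constructor 1|by constructor 2|by constructor 3| |lia].
  by constructor 4; split=> //; lia.
by case=> [->|->|->|[-> e]]; rewrite ?Z0 ?Z1 ?Z2 ?Z3 ?linear0.
Qed.

End Density.

Section GaugeUpper.
Variable F : numFieldType.

Lemma stab_conj n (A B : nat -> 'M[F]_n) r T g : g \in unitmx ->
  (forall i, (i < r)%N -> ~~ odd i -> A i = g *m B i *m g^T) ->
  (forall i, (i < r)%N -> odd i -> B i = g^T *m A i *m g) ->
  stab B r T -> stab A r (g *m T *m invmx g).
Proof.
move=> ug Ae Ao sT i ir; have sTi := sT i ir.
have ugT : g^T \in unitmx by rewrite unitmx_tr.
have twT : (g *m T *m invmx g)^T = invmx g^T *m T^T *m g^T.
  by rewrite !trmx_mul trmx_inv mulmxA.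
move: sTi; rewrite /twist /=; case: ifP => /= [oi|ei] sTi; rewrite twT.
  apply: (can_inj (mulKmx ugT)); apply: (can_inj (mulmxK ug)).
  rewrite !mulNmx !mulmxN !mulNmx !mulmxA mulmxV // mul1mx mulmxKV //.
  by move: sTi; rewrite Ao // mulNmx !mulmxA.
rewrite Ae ?ei // !mulmxN !mulmxA mulmxKV // mulmxK //.
by rewrite -[g *m T *m B i]mulmxA sTi !(mulmxN, mulNmx) mulmxA.
Qed.

Lemma torus_symplectic m (a b c d : 'rV[F]_m) :
  torus a b c *m symplectic_mx d = symplectic_mx d *m - (torus a b c)^T.
Proof.
rewrite mulmxN /torus tr_block_mx [(- diag_mx a)^T]raddfN /= !tr_diag_mx !mulmx_block.
rewrite opp_block_mx !(mulmx0, mul0mx, addr0, add0r, mulNmx, mulmxN, opprK).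
by rewrite ![diag_mx d *m _]diag_mxC.
Qed.

Variables (m r : nat).
Hypotheses (r3 : (2 < r)%N) (r4 : (r <= 4)%N).
Local Notation n := (m + m)%N.
Local Notation L := (6 * (n * n))%N.
Local Notation half := (2%:R^-1 : F).

(** The 2-form at an odd position, transported to the basis [Y 0] in which the factors 0 and 2 are
    normal. *)
Definition middle (R : comNzRingType) (Y : nat -> 'M[R]_n) j := (Y 0%N)^T *m (Y j - (Y j)^T) *m Y 0%N.

Definition torus_stabilizer c (B1 B3 : 'M[F]_n) (S : 'I_c -> 'M[F]_n) :=
  [/\ forall i, exists a b c, S i = torus a b c,
      forall i, - (S i)^T *m B1 = B1 *m S i,
      forall i, (3 < r)%N -> - (S i)^T *m B3 = B3 *m S i &
      forall u : 'I_c -> F, \sum_i u i *: S i = 0 -> forall i, u i = 0].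

(** By independence of [Gam], a nonzero w has a nonzero pullback, and its product with h is nonzero.
    Open conditions on the gauge parameters thus hold at a dense set of points. *)
Lemma zdense_gauge (h : {mpoly F[L]}) : h != 0 ->
  zdense (fun x : 'I_(r * (n * n)) -> F =>
    exists2 Y, x = param (gauge half Y) & h.@[param Y] != 0).
Proof.
move=> h0 w w0; have := @Gam_indep F m r r4 r3 w => indep.
have wh0 : compm (@Gam F m r) w * h != 0.
  by rewrite mulf_neq0 //; apply: contra_neq w0.
have /existsNP[y ny] : ~ forall y, (compm (@Gam F m r) w * h).@[y] = 0.
  by move=> /mpoly_infinite_eq0/eqP; rewrite (negPf wh0).
have [Y YE] := param_surj y; rewrite -YE mevalM meval_compm in ny.
exists (param (gauge half Y)).
  by exists Y => //; apply: contra_notN ny => /eqP ->; rewrite mulr0.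
apply: contra_notN ny => /eqP w1.
rewrite (_ : (fun i => _) = param (gauge half Y)) ?w1 ?mul0r //.
by apply: funext => c; rewrite meval_Gam.
Qed.

Lemma skewize_congr_sym (U N : 'M[F]_n) d :
  congr_sym half U N d - (congr_sym half U N d)^T = U *m symplectic_mx d *m U^T.
Proof.
have sS : (U *m symplectic_mx d *m U^T)^T = - (U *m symplectic_mx d *m U^T).
  by rewrite !trmx_mul trmxK symplectic_skew mulNmx mulmxN mulmxA.
have E : (congr_sym half U N d)^T = - (half *: (U *m symplectic_mx d *m U^T)) + (N + N^T).
  by rewrite /congr_sym linearD linearZ /= linearD /= sS trmxK scalerN [N^T + N]addrC.
rewrite E opprD opprK /congr_sym addrACA subrr addr0 -scalerDl.
by rewrite -mulr2n -[_ *+ 2]mulr_natr mulVf ?scale1r // pnatr_eq0.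
Qed.

Lemma rank_gauge c (Y : nat -> 'M[F]_n) (S : 'I_c -> 'M[F]_n) :
  Y 0%N \in unitmx -> (forall i, diag_row (Y 1%N) 0 i != 0) ->
  Y 4%N - (Y 4%N)^T \in unitmx -> Y 5%N - (Y 5%N)^T \in unitmx ->
  torus_stabilizer (middle Y 4) (middle Y 5) S ->
  (\rank (Jac (@prodmap F n r) (param (gauge half Y))) <= n * n - c)%N.
Proof.
move=> u0 d0 u4 u5 [tS S1 S3 free].
have u0T : (Y 0%N)^T \in unitmx by rewrite unitmx_tr.
set g := Y 0%N in u0 u0T *.
have X0 : skewize (gauge half Y) 0 = g *m symplectic_mx (const_mx 1) *m g^T.
  exact: skewize_congr_sym.
have X2 : skewize (gauge half Y) 2 = g *m symplectic_mx (diag_row (Y 1%N)) *m g^T.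
  exact: skewize_congr_sym.
apply: (rank_le_stab (S := fun i => g *m S i *m invmx g)).
- case=> [|[|[|i]]] //.
    by rewrite X0 !unitmx_mul u0 u0T unitJ.
  by rewrite X2 !unitmx_mul u0 u0T unit_symplectic.
- move=> i; have [a [b [e SE]]] := tS i.
  pose B j : 'M[F]_n := match j with
    | 0 => symplectic_mx (const_mx 1) | 1 => middle Y 4
    | 2 => symplectic_mx (diag_row (Y 1%N)) | _ => middle Y 5 end.
  apply: (@stab_conj _ _ B) => //.
  + by move=> [|[|[|[|j]]]] //= jr _; lia.
  + by move=> [|[|[|[|j]]]] //= jr _; lia.
  move=> [|[|[|[|j]]]] jr; last by lia.
  + by rewrite /twist /= SE torus_symplectic.
  + exact: S1.
  + by rewrite /twist /= SE torus_symplectic.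
  + exact: S3.
move=> u; under eq_bigr do rewrite scalemxAl scalemxAr.
rewrite -mulmx_suml -mulmx_sumr => H; apply: free.
by rewrite -[LHS](mulKmx u0) -[g *m _](mulmxKV u0) H mul0mx mulmx0.
Qed.

(** All nondegeneracy conditions are gathered in one polynomial, so the single test point [Ys] shows
    that they hold generically. *)
Lemma zdense_torus c (e : {mpoly F[L]}) (Ys : nat -> 'M[F]_n) :
  (forall Y, e.@[param Y] != 0 -> exists S : 'I_c -> 'M[F]_n,
     torus_stabilizer (middle Y 4) (middle Y 5) S) ->
  Ys 0%N \in unitmx -> (forall i, diag_row (Ys 1%N) 0 i != 0) ->
  Ys 4%N - (Ys 4%N)^T \in unitmx -> Ys 5%N - (Ys 5%N)^T \in unitmx ->
  e.@[param Ys] != 0 ->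
  zdense (fun y => (\rank (Jac (@prodmap F n r) y) <= n * n - c)%N).
Proof.
move=> eS u0 d0 u4 u5 es w w0.
pose X := @varmx F n 6.
pose h := e * (\det (X 0%N) * \prod_i diag_row (X 1%N) 0 i * \det (skewize X 4) * \det (skewize X 5)).
have hE Y : h.@[param Y] = e.@[param Y] * (\det (Y 0%N) * \prod_i diag_row (Y 1%N) 0 i
    * \det (skewize Y 4) * \det (skewize Y 5)).
  rewrite /h !mevalM rmorph_prod /= -!det_map_mx !meval_skewize // meval_varmx //.
  congr (_ * (_ * _ * _ * _)); apply: eq_bigr => i _.
  by rewrite !mxE -(meval_varmx Y (isT : 1 < 6)%N) mxE.
have h0 : h != 0.
  apply: contra_neq es => h0; have := hE Ys; rewrite h0 meval0 => /esym/eqP.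
  rewrite mulf_eq0 => /orP[/eqP //|]; apply: contraTeq => _.
  rewrite !mulf_neq0 -?unitfE -?unitmxE // unitfE.
  by apply/prodf_neq0 => i _; apply: d0.
have [x [Y -> hY] wx] := zdense_gauge h0 w0.
exists (param (gauge half Y)) => //; move: hY; rewrite hE !mulf_eq0 !negb_or.
case/andP=> eY /andP[/andP[/andP[v0 v1] v4] v5]; have [S SP] := eS Y eY.
apply: rank_gauge SP; rewrite ?unitmxE ?unitfE // => i.
by move/prodf_neq0: v1 => /(_ i isT).
Qed.

End GaugeUpper.

Section Middle.
Variables (F : numFieldType) (m : nat).
Local Notation n := (m + m)%N.

Lemma meval_middle (Y : nat -> 'M[F]_n) j (a b : 'I_n) : (j < 6)%N ->
  (middle (@varmx F n 6) j a b).@[param Y] = middle Y j a b.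
Proof.
move=> j6; have <- : map_mx (meval (param Y)) (middle (@varmx F n 6) j) = middle Y j.
  by rewrite /middle !map_mxM map_mxB -!map_trmx !meval_varmx.
by rewrite [RHS]mxE.
Qed.

Lemma middle_skew (Y : nat -> 'M[F]_n) j : (middle Y j)^T = - middle Y j.
Proof. by rewrite /middle !trmx_mul trmxK raddfB /= trmxK -opprB mulNmx mulmxN mulmxA. Qed.

Lemma skew_blockP (B : 'M[F]_n) : B^T = - B -> exists P Q R,
  [/\ B = skew_block P Q R, P^T = - P & R^T = - R].
Proof.
rewrite -{1 2}[B]submxK tr_block_mx opp_block_mx => /eq_block_mx[sP _ uQ sR].
exists (ulsubmx B), (ursubmx B), (drsubmx B); split=> //.
by rewrite -[LHS]submxK /skew_block uQ opprK.
Qed.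

Lemma skew_entry (P : 'M[F]_m) : P^T = - P -> (forall i, P i i = 0) /\ forall i j, P j i = - P i j.
Proof.
move=> sP; have Pji i j : P j i = - P i j by have /matrixP/(_ i j) := sP; rewrite !mxE.
split=> // i; have /eqP := Pji i i.
by rewrite -addr_eq0 -mulr2n mulrn_eq0 /= => /eqP.
Qed.

Definition test_point (B1 B3 : 'M[F]_n) (i : nat) : 'M[F]_n :=
  match i with
  | 0 => 1%:M
  | 1 => block_mx (diag_mx (natrow F m)) 0 0 0
  | 4 => 2%:R^-1 *: B1
  | _ => 2%:R^-1 *: B3
  end.

Lemma half_skew (B : 'M[F]_n) : B^T = - B -> 2%:R^-1 *: B - (2%:R^-1 *: B)^T = B.
Proof. by move=> sB; have /(congr1 (@^~ 0%N)) := @skewize_half F n (fun=> B) (fun=> sB). Qed.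

Lemma zdense_torus_test r c (e : {mpoly F[6 * (n * n)]}) (B1 B3 : 'M[F]_n) :
  (2 < r)%N -> (r <= 4)%N ->
  (forall Y, e.@[param Y] != 0 -> exists S : 'I_c -> 'M[F]_n,
     torus_stabilizer r (middle Y 4) (middle Y 5) S) ->
  B1^T = - B1 -> B3^T = - B3 -> B1 \in unitmx -> B3 \in unitmx ->
  (forall Y, middle Y 4 = B1 -> middle Y 5 = B3 -> e.@[param Y] != 0) ->
  zdense (fun y => (\rank (Jac (@prodmap F n r) y) <= n * n - c)%N).
Proof.
move=> r3 r4 eS s1 s3 u1 u3 eT; apply: (zdense_torus r3 r4 (Ys := test_point B1 B3) eS).
- exact: unitmx1.
- by move=> i; rewrite /diag_row mxE block_mxEul !mxE eqxx mulr1n pnatr_eq0.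
- by rewrite half_skew.
- by rewrite half_skew.
- by apply: eT; rewrite /middle /= trmx1 mulmx1 mul1mx half_skew.
Qed.

End Middle.

(** * Explicit stabilizers in sizes 4 and 6 *)

Section UpperFour.
Variable F : numFieldType.

(* The blocks det(h) t and adj(h) t h, where t = [[a, b], [c, - a]] and h = [[y, - s], [p, x]]
   is the 2 x 2 matrix attached to the only pair of indices. *)
Definition pair_torus (p x y s a b c : F) : 'M[F]_(2 + 2) :=
  let N := x * y + p * s in
  torus (\row_i if i == 0 then N * a else a * (x * y - p * s) + s * y * c + x * p * b)
    (\row_i if i == 0 then N * b else x ^+ 2 * b - 2%:R * x * s * a - s ^+ 2 * c)
    (\row_i if i == 0 then N * c else y ^+ 2 * c - 2%:R * p * y * a - p ^+ 2 * b).

Lemma twist_form2 (a b c : 'rV[F]_2) (P Q R : 'M[F]_2) : P^T = - P -> R^T = - R ->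
  (a 0 0 + a 0 1) * P 0 1 + Q 0 1 * c 0 1 - c 0 0 * Q 1 0 = 0 ->
  (a 0 0 - a 0 1) * Q 0 1 + c 0 0 * R 0 1 + P 0 1 * b 0 1 = 0 ->
  (a 0 1 - a 0 0) * Q 1 0 - c 0 1 * R 0 1 - P 0 1 * b 0 0 = 0 ->
  b 0 0 * Q 0 1 - Q 1 0 * b 0 1 - (a 0 0 + a 0 1) * R 0 1 = 0 ->
  - (torus a b c)^T *m skew_block P Q R = skew_block P Q R *m torus a b c.
Proof.
move=> sP sR e1 e2 e3 e4; apply/twist_form => // i j.
have [P0 Pji] := skew_entry sP; have [R0 Rji] := skew_entry sR.
case: (ord2_cases i) => ->; case: (ord2_cases j) => ->; rewrite ?P0 ?R0 ?(Pji 0 1) ?(Rji 0 1).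
- by split; ring.
- by split.
- by split; [rewrite -[RHS]oppr0 -e1|rewrite -[RHS]e3|rewrite -[RHS]oppr0 -e4]; ring.
- by split; ring.
Qed.

Lemma pair_torus_twist (P Q R : 'M[F]_2) a b c : P^T = - P -> R^T = - R ->
  let T := pair_torus (P 0 1) (Q 0 1) (Q 1 0) (R 0 1) a b c in
  - T^T *m skew_block P Q R = skew_block P Q R *m T.
Proof. by move=> sP sR; apply: twist_form2; rewrite // !mxE /=; ring. Qed.

Let l (i : 'I_2) : 'I_(2 + 2) := lshift 2 i.
Let r (i : 'I_2) : 'I_(2 + 2) := rshift 2 i.

(** The determinant of the 2 x 2 matrix h of the pair (0, 1). The solutions [pair_torus] carry it as
    the factor of a, b, c in t_0, so they are independent where it is nonzero. *)
Definition pair_norm (R : comNzRingType) (B : 'M[R]_(2 + 2)) :=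
  B (l 0) (r 1) * B (l 1) (r 0) + B (l 0) (l 1) * B (r 0) (r 1).

(** The lower left entry of h' adj (h), which decides that the solution in [upper_four4] is
    nonzero. *)
Definition pair_cross (R : comNzRingType) (B B' : 'M[R]_(2 + 2)) :=
  B' (l 0) (l 1) * B (l 0) (r 1) - B' (l 0) (r 1) * B (l 0) (l 1).

Lemma skew_block_entries (P Q R : 'M[F]_2) i j :
  [/\ skew_block P Q R (l i) (l j) = P i j, skew_block P Q R (l i) (r j) = Q i j &
      skew_block P Q R (r i) (r j) = R i j].
Proof. by rewrite /l /r /skew_block block_mxEul block_mxEur block_mxEdr. Qed.

Let Q2 k : 'M[F]_2 := k%:M + (delta_mx 0 1 + delta_mx 1 0).

Lemma pair_norm_test (P R : 'M[F]_2) k : P 0 1 = 0 -> pair_norm (skew_block P (Q2 k) R) = 1.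
Proof.
move=> P0; rewrite /pair_norm; have [-> -> _] := skew_block_entries P (Q2 k) R 0 1.
have [_ -> _] := skew_block_entries P (Q2 k) R 1 0.
by rewrite P0 mul0r addr0 !mxE /= !mulr0n !add0r addr0 mulr1.
Qed.

Lemma meval_mul2D k (a b c d : {mpoly F[k]}) v :
  (a * b + c * d).@[v] = a.@[v] * b.@[v] + c.@[v] * d.@[v].
Proof. by rewrite mevalD !mevalM. Qed.

Lemma meval_mul2B k (a b c d : {mpoly F[k]}) v :
  (a * b - c * d).@[v] = a.@[v] * b.@[v] - c.@[v] * d.@[v].
Proof. by rewrite mevalB !mevalM. Qed.

Lemma meval_pair_norm (Y : nat -> 'M[F]_(2 + 2)) :
  (pair_norm (middle (m := 2) (@varmx F (2 + 2) 6) 4)).@[param Y] = pair_norm (middle (m := 2) Y 4).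
Proof. by rewrite /pair_norm meval_mul2D !meval_middle. Qed.

Lemma meval_pair_cross (Y : nat -> 'M[F]_(2 + 2)) :
  (pair_cross (middle (m := 2) (@varmx F (2 + 2) 6) 4)
    (middle (m := 2) (@varmx F (2 + 2) 6) 5)).@[param Y]
  = pair_cross (middle (m := 2) Y 4) (middle (m := 2) Y 5).
Proof.
rewrite /pair_cross meval_mul2B.
by congr (_ * _ - _ * _); exact: meval_middle.
Qed.

Lemma upper_four3 : zdense (fun y => (\rank (Jac (@prodmap F (2 + 2) 3) y) <= 13)%N).
Proof.
have s0 : (0 : 'M[F]_2)^T = - 0 by rewrite trmx0 oppr0.
have [k uQ] := exists_unit_shift (delta_mx 0 1 + delta_mx 1 0 : 'M[F]_2).
pose B1 := skew_block 0 (Q2 k) 0; pose X := @varmx F (2 + 2) 6.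
have s1 : B1^T = - B1 by apply: skew_block_skew.
have u1 : B1 \in unitmx by apply: skew_block_unit.
have eE Y := meval_pair_norm Y.
apply: (zdense_torus_test (m := 2) (c := 3) (e := pair_norm (middle (m := 2) X 4))
  (B1 := B1) (B3 := B1)) => // Y.
  rewrite eE => NY; have [P [Q [R [BE sP sR]]]] := skew_blockP (middle_skew Y 4).
  pose S (i : 'I_3) := pair_torus (P 0 1) (Q 0 1) (Q 1 0) (R 0 1)
    (i == 0 :> nat)%:R (i == 1 :> nat)%:R (i == 2 :> nat)%:R.
  exists S; split=> [i|i|//|u Su].
  - by do 3 eexists.
  - by rewrite BE; apply: pair_torus_twist.
  move: NY; rewrite /pair_norm BE.
  have [-> -> ->] := skew_block_entries P Q R 0 1; have [_ -> _] := skew_block_entries P Q R 1 0.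
  set N := _ + _ => N0.
  have entry (i j : 'I_(2 + 2)) : \sum_v u v * S v i j = 0.
    have /matrixP/(_ i j) := Su; rewrite summxE [RHS]mxE => E; rewrite -[RHS]E.
    by apply: eq_bigr => v _; rewrite [RHS]mxE.
  have [ea eb ec] := And3 (entry (l 0) (l 0)) (entry (l 0) (r 0)) (entry (r 0) (l 0)).
  have Na v : S v (l 0) (l 0) = N * (v == 0 :> nat)%:R.
    by rewrite /S /pair_torus /torus block_mxEul !mxE eqxx.
  have Nb v : S v (l 0) (r 0) = N * (v == 1 :> nat)%:R.
    by rewrite /S /pair_torus /torus block_mxEur !mxE eqxx.
  have Nc v : S v (r 0) (l 0) = N * (v == 2 :> nat)%:R.
    by rewrite /S /pair_torus /torus block_mxEdl !mxE eqxx.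
  have pick j : \sum_v u v * (N * (v == j :> nat)%:R) = 0 -> forall v : 'I_3, v = j :> nat -> u v = 0.
    move=> H v vj; move: H; rewrite (bigD1 v) //= big1 => [|v' /negPf v'v].
      by rewrite vj eqxx mulr1 addr0 => /eqP; rewrite mulf_eq0 (negPf N0) orbF => /eqP.
    by rewrite -vj val_eqE v'v !mulr0.
  have pa := pick 0%N; have pb := pick 1%N; have pc := pick 2%N.
  case=> [[|[|[|v]]] iv] //.
  - by apply: pa => //; rewrite -[RHS]ea; apply: eq_bigr => v _; rewrite Na.
  - by apply: pb => //; rewrite -[RHS]eb; apply: eq_bigr => v _; rewrite Nb.
  - by apply: pc => //; rewrite -[RHS]ec; apply: eq_bigr => v _; rewrite Nc.
by move=> Y4 _; rewrite eE Y4 pair_norm_test ?mxE // oner_neq0.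
Qed.

Lemma free_one n (M : 'M[F]_n) i j : M i j != 0 ->
  forall u : 'I_1 -> F, \sum_v u v *: (fun=> M) v = 0 -> forall v, u v = 0.
Proof.
move=> M0 u; rewrite big_ord1 => /matrixP/(_ i j); rewrite [LHS]mxE [RHS]mxE => /eqP.
by rewrite mulf_eq0 (negPf M0) orbF => /eqP u0 v; rewrite ord1.
Qed.

Lemma upper_four4 : zdense (fun y => (\rank (Jac (@prodmap F (2 + 2) 4) y) <= 15)%N).
Proof.
have s0 : (0 : 'M[F]_2)^T = - 0 by rewrite trmx0 oppr0.
have [k uQ] := exists_unit_shift (delta_mx 0 1 + delta_mx 1 0 : 'M[F]_2).
pose B1 := skew_block 0 (Q2 k) 0; pose X := @varmx F (2 + 2) 6.
pose B3 : 'M[F]_(2 + 2) := skew_block (elem_skew F 0 1) 1%:M 0.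
have s1 : B1^T = - B1 by apply: skew_block_skew.
have u1 : B1 \in unitmx by apply: skew_block_unit.
have s3 : B3^T = - B3 by apply: skew_block_skew; rewrite ?elem_skew_skew.
have u3 : B3 \in unitmx by apply/skew_block_unit/unitmx1.
pose e := pair_norm (middle (m := 2) X 4) * pair_cross (middle (m := 2) X 4) (middle (m := 2) X 5).
have eE Y : e.@[param Y] = pair_norm (middle (m := 2) Y 4)
    * pair_cross (middle (m := 2) Y 4) (middle (m := 2) Y 5).
  by rewrite mevalM meval_pair_norm meval_pair_cross.
have isT4 : (2 < 4)%N := isT.
apply: (@zdense_torus_test F 2 4 1 e B1 B3 isT4 (leqnn 4) _ s1 s3 u1 u3) => Y.
  rewrite eE => NY; have [P [Q [R [BE sP sR]]]] := skew_blockP (middle_skew Y 4).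
  have [P' [Q' [R' [BE' sP' sR']]]] := skew_blockP (middle_skew Y 5).
  (* If t_0 h = h t_1 and t_0 h' = h' t_1 with h invertible, then t_0 commutes with h' adj (h). The
     parameters are those of twice the traceless part of this matrix. *)
  pose T := pair_torus (P 0 1) (Q 0 1) (Q 1 0) (R 0 1)
    (Q' 1 0 * Q 0 1 + R' 0 1 * P 0 1 - P' 0 1 * R 0 1 - Q' 0 1 * Q 1 0)
    (2%:R * (Q' 1 0 * R 0 1 - R' 0 1 * Q 1 0)) (2%:R * (P' 0 1 * Q 0 1 - Q' 0 1 * P 0 1)).
  exists (fun=> T); split=> [i|i|i _|].
  - by do 3 eexists.
  - by rewrite BE; apply: pair_torus_twist.
  - by rewrite BE'; apply: twist_form2; rewrite // !mxE /=; ring.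
  apply: (@free_one _ _ (r 0) (l 0)).
  rewrite /T /pair_torus /torus block_mxEdl !mxE eqxx /= mulr1n mulrCA mulf_neq0 ?pnatr_eq0 //.
  move: NY; rewrite /pair_norm /pair_cross BE BE'.
  have [-> -> ->] := skew_block_entries P Q R 0 1; have [_ -> _] := skew_block_entries P Q R 1 0.
  by have [-> -> _] := skew_block_entries P' Q' R' 0 1.
move=> Y4 Y5; rewrite eE Y4 Y5 pair_norm_test ?mxE // mul1r /pair_cross.
have [-> -> _] := skew_block_entries (elem_skew F 0 1) 1%:M 0 0 1.
have [-> -> _] := skew_block_entries 0 (Q2 k) 0 0 1.
by rewrite !mxE /= !mulr0n !mulr1n !add0r !mulr0 !subr0 addr0 mulr1 oner_neq0.
Qed.

End UpperFour.

Section UpperSix.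
Variable F : numFieldType.

Let l (i : 'I_3) : 'I_(3 + 3) := lshift 3 i.
Let r (i : 'I_3) : 'I_(3 + 3) := rshift 3 i.

(* The pair (i, j) of a skew block matrix is seen as the 2 x 2 matrix
   h_ij = [[Q j i, - R i j], [P i j, Q i j]], for which h_ji = adj(h_ij). A block diagonal t
   stabilizes the form iff t_i h_ij = h_ij t_j for all i, j; around a triangle, the traceless
   part of the holonomy h_ij h_jk h_ki is a solution. *)
Section Holonomy.
Variables (S : comNzRingType) (P Q R : 'I_3 -> 'I_3 -> S) (i j k : 'I_3).

Definition hol11 :=
  (Q j i * Q k j - R i j * P j k) * Q i k + (- Q j i * R j k - R i j * Q j k) * P k i.
Definition hol12 :=
  - (Q j i * Q k j - R i j * P j k) * R k i + (- Q j i * R j k - R i j * Q j k) * Q k i.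
Definition hol21 :=
  (P i j * Q k j + Q i j * P j k) * Q i k + (- P i j * R j k + Q i j * Q j k) * P k i.
Definition hol22 :=
  - (P i j * Q k j + Q i j * P j k) * R k i + (- P i j * R j k + Q i j * Q j k) * Q k i.

End Holonomy.

Definition hol_torus (P Q R : 'M[F]_3) : 'M[F]_(3 + 3) :=
  torus (\row_i (hol11 P Q R i (ordS i) (ordS (ordS i)) - hol22 P Q R i (ordS i) (ordS (ordS i))))
    (\row_i (2%:R * hol12 P Q R i (ordS i) (ordS (ordS i))))
    (\row_i (2%:R * hol21 P Q R i (ordS i) (ordS (ordS i)))).

Lemma ord3_cases (i : 'I_3) : [\/ i = 0, i = ordS 0 | i = ordS (ordS 0)].
Proof.
case: i => [[|[|[|i]]] //] H.
- by constructor 1; apply/val_inj.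
- by constructor 2; apply/val_inj.
- by constructor 3; apply/val_inj.
Qed.

Lemma hol_torus_twist (P Q R : 'M[F]_3) : P^T = - P -> R^T = - R ->
  - (hol_torus P Q R)^T *m skew_block P Q R = skew_block P Q R *m hol_torus P Q R.
Proof.
move=> sP sR; apply/twist_form => // i j; rewrite !mxE.
have [P0 Pji] := skew_entry sP; have [R0 Rji] := skew_entry sR.
have S3 : ordS (ordS (ordS (0 : 'I_3))) = 0 by apply/val_inj.
pose o1 : 'I_3 := ordS 0; pose o2 : 'I_3 := ordS (ordS 0).
rewrite /hol11 /hol12 /hol21 /hol22.
case: (ord3_cases i) => ->; case: (ord3_cases j) => ->; rewrite ?S3 -?/o1 -?/o2;
  rewrite ?P0 ?R0 ?(Pji 0 o1) ?(Pji 0 o2) ?(Pji o1 o2) ?(Rji 0 o1) ?(Rji 0 o2) ?(Rji o1 o2);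
  by split; ring.
Qed.

Lemma map_hol21 (S S' : comNzRingType) (f : {rmorphism S -> S'}) (P Q R : 'I_3 -> 'I_3 -> S) i j k :
  f (hol21 P Q R i j k)
  = hol21 (fun a b => f (P a b)) (fun a b => f (Q a b)) (fun a b => f (R a b)) i j k.
Proof. by rewrite /hol21 !(rmorphD, rmorphM, rmorphN). Qed.

Definition hol_test (S : comNzRingType) (B : 'M[S]_(3 + 3)) : S :=
  hol21 (fun i j => B (l i) (l j)) (fun i j => B (l i) (r j)) (fun i j => B (r i) (r j))
    0 (ordS 0) (ordS (ordS 0)).

Lemma hol_test_block (P Q R : 'M[F]_3) :
  hol_test (skew_block P Q R) = hol21 P Q R 0 (ordS 0) (ordS (ordS 0)).
Proof.
have E i j : [/\ skew_block P Q R (l i) (l j) = P i j, skew_block P Q R (l i) (r j) = Q i j &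
    skew_block P Q R (r i) (r j) = R i j].
  by rewrite /l /r /skew_block block_mxEul block_mxEur block_mxEdr.
by congr hol21; apply: funext => i; apply: funext => j; case: (E i j).
Qed.

Lemma meval_hol_test (Y : nat -> 'M[F]_(3 + 3)) :
  (hol_test (middle (m := 3) (@varmx F (3 + 3) 6) 4)).@[param Y] = hol_test (middle (m := 3) Y 4).
Proof.
apply: etrans (map_hol21 (meval (param Y)) _ _ _ _ _ _) _.
by congr hol21; apply: funext => i; apply: funext => j; exact: meval_middle.
Qed.

Lemma upper_six : zdense (fun y => (\rank (Jac (@prodmap F (3 + 3) 3) y) <= 35)%N).
Proof.
have s0 : (0 : 'M[F]_3)^T = - 0 by rewrite trmx0 oppr0.
pose o1 : 'I_3 := ordS 0; pose o2 : 'I_3 := ordS (ordS 0).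
(* With R = 0, P supported on {0, 2} and Q joining 0, 1 and 1, 2, the lower left entry of the
   holonomy reduces to Q_01 Q_12 P_20 = - 1. *)
pose M : 'M[F]_3 := (delta_mx 0 o1 + delta_mx o1 0) + (delta_mx o1 o2 + delta_mx o2 o1).
have [k uQ] := exists_unit_shift M.
pose B1 := skew_block (elem_skew F 0 o2) (k%:M + M) 0.
have s1 : B1^T = - B1 by apply: skew_block_skew; rewrite ?elem_skew_skew.
have u1 : B1 \in unitmx by apply: skew_block_unit.
pose e := hol_test (middle (m := 3) (@varmx F (3 + 3) 6) 4).
have isT3 : (2 < 3)%N := isT; have isT4 : (3 <= 4)%N := isT.
apply: (@zdense_torus_test F 3 3 1 e B1 B1 isT3 isT4 _ s1 s1 u1 u1) => Y.
  rewrite meval_hol_test => NY.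
  have [P [Q [R [BE sP sR]]]] := skew_blockP (middle_skew Y 4).
  exists (fun=> hol_torus P Q R); split=> [i|i|i //|].
  - by do 3 eexists.
  - by rewrite BE; apply: hol_torus_twist.
  apply: (@free_one _ _ _ (r 0) (l 0)); move: NY; rewrite BE hol_test_block => NY.
  by rewrite /hol_torus /torus block_mxEdl mxE eqxx mulr1n mxE mulf_neq0 ?pnatr_eq0.
move=> Y4 _; rewrite meval_hol_test Y4 hol_test_block /hol21 !mxE /=.
rewrite !(mulr0n, mulr1n, mulr0, mul0r, addr0, add0r, subr0, sub0r, mulr1, mul1r, oppr0).
by rewrite ?oppr_eq0 oner_neq0.
Qed.

End UpperSix.

(** * The dimension formulas *)

Section Exceptional.
Variable F : numFieldType.

Lemma dim_mu3_four : krull_dim (mu 3 (skew_mx F 4)) 13.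
Proof. exact: krull_mu (rank_ge_four3 F) (@upper_four3 F). Qed.

Lemma dim_mu4_four : krull_dim (mu 4 (skew_mx F 4)) 15.
Proof. exact: krull_mu (rank_ge_four4 F) (@upper_four4 F). Qed.

Lemma dim_mu3_six : krull_dim (mu 3 (skew_mx F 6)) 35.
Proof. by have [X rX] := rank_ge_six F; exact: krull_mu rX (@upper_six F). Qed.

Lemma dim_mu2 n : krull_dim (mu 2 (skew_mx F n)) (n ^ 2 - (3 * n) %/ 2)%N.
Proof.
have [on|en] := boolP (odd n).
  have [m ->] : exists m, n = (m + m + 1)%N by exists n./2; lia.
  have -> : ((m + m + 1) ^ 2 - (3 * (m + m + 1)) %/ 2 = 2 * 'C(m + m + 1, 2) - m)%N.
    by rewrite bin2 -divn2; nia.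
  exact: dim_mu2_odd.
have [m ->] : exists m, n = (m + m)%N by exists n./2; lia.
have -> : ((m + m) ^ 2 - (3 * (m + m)) %/ 2 = 2 * 'C(m + m, 2) - m)%N.
  by rewrite bin2 -divn2; nia.
exact: dim_mu2_even.
Qed.

End Exceptional.

Local Open Scope complex_scope.

Theorem theorem4p11 (R : realType) :
  (forall r : nat, (1 <= r)%N -> krull_dim (mu r (skew_mx R[i] 2)) 1) /\
  (forall n : nat, (3 <= n)%N ->
     krull_dim (mu 1 (skew_mx R[i] n)) ((n * (n - 1)) %/ 2)) /\
  (forall n : nat, (3 <= n)%N ->
     krull_dim (mu 2 (skew_mx R[i] n)) (n ^ 2 - (3 * n) %/ 2)) /\
  (krull_dim (mu 3 (skew_mx R[i] 3)) 7 /\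
   forall r : nat, (4 <= r)%N -> krull_dim (mu r (skew_mx R[i] 3)) 8) /\
  (krull_dim (mu 3 (skew_mx R[i] 4)) 13 /\
   krull_dim (mu 4 (skew_mx R[i] 4)) 15 /\
   forall r : nat, (5 <= r)%N -> krull_dim (mu r (skew_mx R[i] 4)) 16) /\
  (krull_dim (mu 3 (skew_mx R[i] 6)) 35 /\
   forall r : nat, (4 <= r)%N -> krull_dim (mu r (skew_mx R[i] 6)) 36) /\
  (forall n r : nat, (5 <= n)%N -> odd n -> (3 <= r)%N ->
     krull_dim (mu r (skew_mx R[i] n)) (n ^ 2 - 1)) /\
  (forall n r : nat, (8 <= n)%N -> ~~ odd n -> (3 <= r)%N ->
     krull_dim (mu r (skew_mx R[i] n)) (n ^ 2)).
Proof.
split; first by move=> r r1; exact: dim_mu_n2.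
split.
  move=> n n3; have -> : ((n * (n - 1)) %/ 2 = 'C(n, 2))%N by rewrite bin2 -divn2 subn1.
  by apply: dim_mu1; exact: ltn_trans n3.
split; first by move=> n _; exact: dim_mu2.
split; first by split; [exact: dim_mu3_n3 | move=> r; exact: dim_mu_n3].
split.
  split; first exact: dim_mu3_four.
  by split; [exact: dim_mu4_four | move=> r; exact: dim_mu_four].
split; first by split; [exact: dim_mu3_six | move=> r; exact: dim_mu_six].
split=> n r n5 on r3.
  have [m nE] : exists m, n = (m + m + 1)%N by exists n./2; lia.
  by rewrite {}nE in n5 *; apply: dim_mu_odd => //; lia.
have [m nE] : exists m, n = (m + m)%N by exists n./2; lia.
by rewrite {}nE in n5 *; apply: dim_mu_large_even => //; lia.
Qed.
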